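(* Let $n\geq 3$, let $r>2$, and let $D_r=\{\xi\in\mathbb{R}^n : |\xi|^2\leq r|\xi_1|\}$. Let $\alpha$ be a multi-index and $l\geq 0$ an integer. (1) Let $p\in[1,2)$ and $q\in[\frac{2p}{2-p},+\infty]$. There is a constant $C$, depending only on $n,r,p,q,\alpha,l$, such that for all $u_0,u_1\in L^p(\mathbb{R}^n)$ with $\operatorname{supp}\hat u_0\subset D_r$ and $\operatorname{supp}\hat u_1\subset D_r$, the solution $u$ of the Cauchy problem $u_{tt}-u_{x_1x_1}=\Delta u_t$ on $\mathbb{R}^n\times(0,\infty)$, $u|_{t=0}=u_0$, $u_t|_{t=0}=u_1$, satisfies for all $t>0$ $$\|\partial_x^{\alpha}\partial_t^l u(\cdot,t)\|_{L^q}\leq C t^{-\frac{|\alpha|}{2}-[\frac{l}{2}]-\frac n2(\frac1p-\frac1q)}\|u_0\|_{L^p}+C t^{-\frac{|\alpha|}{2}-[\frac{l-1}{2}]-\frac n2(\frac1p-\frac1q)}\|u_1\|_{L^p}.$$ (2) Let $q\in[2,+\infty]$. There is a constant $C$, depending only on $n,r,q,\alpha,l$, such that for all $u_0,u_1\in L^2(\mathbb{R}^n)$ with $\operatorname{supp}\hat u_0\subset D_r$ and $\operatorname{supp}\hat u_1\subset D_r$, the solution $u$ of the same Cauchy problem satisfies for all $t>0$ $$\|\partial_x^{\alpha}\partial_t^l u(\cdot,t)\|_{L^q}\leq C t^{-\frac{|\alpha|}{2}-[\frac{l}{2}]-\frac n2(\frac12-\frac1q)}\|u_0\|_{L^2}+C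 t^{-\frac{|\alpha|}{2}-[\frac{l-1}{2}]-\frac n2(\frac12-\frac1q)}\|u_1\|_{L^2}.$$
   Context: Norms are $\|\cdot\|_{L^p}=\|\cdot\|_{L^p(\mathbb{R}^n)}$; $\hat{f}$ denotes the Fourier transform in $x\in\mathbb{R}^n$ (convention such that $\partial_{x_j}$ corresponds to multiplication by $\pm i\xi_j$); $\Delta=\sum_{j=1}^n\partial_{x_j}^2$; $\xi=(\xi_1,\dots,\xi_n)$. The symbol $[s]$ is Gauss' symbol, the greatest integer $\leq s$ (so $[-\frac12]=-1$). For $p=\frac{2p}{2-p}$-type endpoints, $q=+\infty$ is read with $1/q=0$. ''The solution $u$'' is the one given by the Green function: for $t>0$, $$\hat u(\xi,t)=(\partial_t+|\xi|^2)\hat G(\xi,t)\,\hat u_0(\xi)+\hat G(\xi,t)\,\hat u_1(\xi),$$ where, for each $\xi\in\mathbb{R}^n$, $\hat G(\xi,\cdot)$ is the solution of $\hat G_{tt}+|\xi|^2\hat G_t+\xi_1^2\hat G=0$, $\hat G(\xi,0)=0$, $\hat G_t(\xi,0)=1$. Explicitly, $\hat G(\xi,t)=\frac{e^{\lambda_+t}-e^{\lambda_-t}}{\lambda_0}$ with $\lambda_\pm=\frac{-|\xi|^2\pm\sqrt{|\xi|^4-4\xi_1^2}}{2}$ and $\lambda_0=\sqrt{|\xi|^4-4\xi_1^2}$ (where $\lambda_0=0$ the quotient is understood as its limit $te^{-|\xi|^2t/2}$). *)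

(* Defs.v *)
From HB Require Import structures.
From mathcomp Require Import all_boot all_order all_algebra.
From mathcomp Require Import complex.
From mathcomp Require Import all_classical all_reals all_analysis.
From mathcomp Require Import ring lra.

Set Implicit Arguments.
Unset Strict Implicit.
Unset Printing Implicit Defensive.
Import Order.TTheory GRing.Theory Num.Theory.
Import numFieldNormedType.Exports.

Local Open Scope classical_set_scope.
Local Open Scope ring_scope.
Local Open Scope complex_scope.

(** * Lebesgue measure on row vectors *)

Definition rV_display : measure_display.
Proof. exact: default_measure_display. Qed.

(* The sigma-algebra generated by the coordinates, i.e. the Borel sets. *)
Section measurable_rV.
Context (R : realType) (n : nat).

Let coords : 'I_n -> 'rV[R]_n -> measurableTypeR R := fun i x => x 0 i.

Let rV_set0 : g_sigma_preimage coords set0.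
Proof. exact: sigma_algebra0. Qed.

Let rV_setC A : g_sigma_preimage coords A -> g_sigma_preimage coords (~` A).
Proof. exact: sigma_algebraC. Qed.

Let rV_bigcup (F : _^nat) : (forall i, g_sigma_preimage coords (F i)) ->
  g_sigma_preimage coords (\bigcup_i (F i)).
Proof. exact: sigma_algebra_bigcup. Qed.

HB.instance Definition _ := @isMeasurable.Build rV_display
  'rV[R]_n (g_sigma_preimage coords) rV_set0 rV_setC rV_bigcup.

End measurable_rV.

Section lebesgue_rV.
Context (R : realType).

Lemma measurable_coord n (i : 'I_n) :
  measurable_fun setT (fun x : 'rV[R]_n => x 0 i : measurableTypeR R).
Proof.
move=> _ Y mY; rewrite setTI; apply: sub_sigma_algebra => /=.
rewrite -bigcup_seq/=; exists i => /=; first by rewrite mem_index_enum.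
by exists Y => //; rewrite setTI.
Qed.

Lemma measurable_rVP d (T : measurableType d) n (f : T -> 'rV[R]_n) :
  (forall i, measurable_fun setT (fun x => f x 0 i : measurableTypeR R)) ->
  measurable_fun setT f.
Proof.
move=> mf _ A mA; rewrite setTI.
suff: image_set_system setT f measurable A
  by rewrite -[X in measurable X]setTI.
move: A mA; apply: smallest_sub => /=.
  by apply: sigma_algebra_image; exact: sigma_algebra_measurable.
rewrite -bigcup_seq => A [i /= _ [B mB <-]].
rewrite /image_set_system/= !setTI -[X in measurable X]setTI.
exact: mf.
Qed.

Definition rV_cons n (z : 'rV[R]_n * measurableTypeR R) : 'rV[R]_n.+1 :=
  row_mx (z.2%:M : 'rV[R]_1) z.1.

Lemma rV_consE n z i : @rV_cons n z 0 i =
  if unlift ord0 i is Some j then z.1 0 j else z.2.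
Proof.
rewrite /rV_cons mxE; case: splitP => j ij.
  have -> : i = ord0 by apply/val_inj; rewrite /= ij (ord1 j).
  by rewrite unlift_none !mxE (ord1 j) eqxx.
have -> : i = lift ord0 j by apply/val_inj; rewrite /= ij.
by rewrite liftK.
Qed.

Lemma measurable_rV_cons n : measurable_fun setT (@rV_cons n).
Proof.
apply: measurable_rVP => i.
under eq_fun do rewrite rV_consE.
case: unliftP => [j _|_].
  apply: (measurableT_comp (measurable_coord j)).
  exact: measurable_fst.
exact: measurable_snd.
Qed.

Section leb_succ.
Variables (n : nat) (m : {measure set 'rV[R]_n -> \bar R}).

Definition leb_succ : set 'rV[R]_n.+1 -> \bar R :=
  pushforward (m \x (@lebesgue_measure R))%E (@rV_cons n).

HB.instance Definition _ := Measure.copy leb_succ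
  (measure_function_pushforward__canonical__measure_function_Measure
     (m \x (@lebesgue_measure R))%E (@measurable_rV_cons n)).

End leb_succ.

(* [leb n] is the n-fold product of the Lebesgue measure of the line; on the
   one-point space 'rV_0 it is the unit mass. *)
Fixpoint leb n : {measure set 'rV[R]_n -> \bar R} :=
  match n with
  | 0 => \d_(0 : 'rV[R]_0)
  | m.+1 => leb_succ (leb m)
  end.

Lemma leb_box n (A : 'I_n -> set R) :
  (forall i, measurable (A i : set (measurableTypeR R))) ->
  leb n [set x | forall i, A i (x 0 i)] =
  (\prod_(i < n) lebesgue_measure (A i))%E.
Proof.
elim: n A => [|n IH] A mA.
  rewrite big_ord0 /= diracE mem_set//=.
  by case.
rewrite big_ord_recl /= /leb_succ /pushforward.
rewrite (_ : _ @^-1` _ =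
  [set x : 'rV[R]_n | forall i, A (lift ord0 i) (x 0 i)] `*` A ord0); last first.
  apply/seteqP; split => [z /= Az|z /= [Az A0] i].
    split=> [i|]; first by have := Az (lift ord0 i); rewrite rV_consE liftK.
    by have := Az ord0; rewrite rV_consE unlift_none.
  by rewrite rV_consE; case: unliftP => [j ->|->].
rewrite product_measure1E//.
  by rewrite muleC (IH (fun i => A (lift ord0 i))).
rewrite (_ : [set _ | _] = \big[setI/setT]_(i < n)
    ((fun x : 'rV[R]_n => x 0 i : measurableTypeR R) @^-1` A (lift ord0 i))).
  apply: bigsetI_measurable => i _.
  rewrite -[X in measurable X]setTI; exact: measurable_coord.
rewrite -bigcap_seq; apply/seteqP; split => [x /= Ax i _|x Ax i]; first exact: Ax.
by apply: (Ax i); rewrite /= mem_index_enum.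
Qed.

End lebesgue_rV.

(** * Complex-valued functions *)

Section complex_valued.
Context (R : realType).

Definition expc (z : R[i]) : R[i] :=
  (expR (complex.Re z))%:C * (cos (complex.Im z) +i* sin (complex.Im z)).

Definition dotv n (x y : 'rV[R]_n) : R := \sum_(i < n) x 0 i * y 0 i.

(* Euclidean; the norm of 'rV[R]_n in the library is the sup norm. *)
Definition sqnorm n (x : 'rV[R]_n) : R := dotv x x.

Definition cintegral n (f : 'rV[R]_n -> R[i]) : R[i] :=
  (\int[leb R n]_x complex.Re (f x)) +i* (\int[leb R n]_x complex.Im (f x)).

Definition cLnorm n (p : \bar R) (f : 'rV[R]_n -> R[i]) : \bar R :=
  Lnorm (leb R n) p (fun x => (Normc.normc (f x))%:E).

Definition in_Lp n (p : \bar R) (f : 'rV[R]_n -> R[i]) : Prop :=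
  [/\ measurable_fun setT (fun x => complex.Re (f x) : measurableTypeR R),
      measurable_fun setT (fun x => complex.Im (f x) : measurableTypeR R) &
      (cLnorm p f < +oo)%E].

(* Support of the class of f modulo null sets. *)
Definition ess_support n (f : 'rV[R]_n -> R[i]) : set 'rV[R]_n :=
  ~` \bigcup_(U in [set U | open U /\ {ae leb R n, forall x, U x -> f x = 0}]) U.

(** * Derivatives of complex-valued functions *)

Definition ctime_derive (f : R -> R[i]) (t : R) : R[i] :=
  derive1 (fun s => complex.Re (f s)) t +i* derive1 (fun s => complex.Im (f s)) t.

(* Derivative of a complex-valued function with existence, as opposed to the
   total operator [ctime_derive]. *)
Definition is_ctime_derive (f : R -> R[i]) (t : R) (d : R[i]) :=
  is_derive t 1 (fun s => complex.Re (f s)) (complex.Re d) /\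
  is_derive t 1 (fun s => complex.Im (f s)) (complex.Im d).

Lemma ctdE f t d : is_ctime_derive f t d -> ctime_derive f t = d.
Proof.
case: d => a b [/= h1 h2]; rewrite /ctime_derive !derive1E.
by rewrite !derive_val.
Qed.

Lemma is_ctdB f g t d e : is_ctime_derive f t d -> is_ctime_derive g t e ->
  is_ctime_derive (fun s => f s - g s) t (d - e).
Proof.
move=> [f1 f2] [g1 g2]; split.
  rewrite (_ : (fun s => _) =
    (fun s => complex.Re (f s)) - (fun s => complex.Re (g s))); last first.
    by apply/funext => s /=; rewrite raddfB.
  by apply: is_derive_eq; rewrite raddfB.
rewrite (_ : (fun s => _) =
    (fun s => complex.Im (f s)) - (fun s => complex.Im (g s))); last first.
  by apply/funext => s /=; rewrite raddfB.
by apply: is_derive_eq; rewrite raddfB.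
Qed.

Lemma is_ctdZ c f t d : is_ctime_derive f t d ->
  is_ctime_derive (fun s => c * f s) t (c * d).
Proof.
case: c => a b [f1 f2]; split.
  rewrite (_ : (fun s => _) =
    a *: (fun s => complex.Re (f s)) - b *: (fun s => complex.Im (f s))); last first.
    apply/funext => s; rewrite !fctE /=; case: (f s) => x y //=.
  apply: is_derive_eq; case: d f1 f2 => x y //=.
rewrite (_ : (fun s => _) =
    a *: (fun s => complex.Im (f s)) + b *: (fun s => complex.Re (f s))); last first.
  apply/funext => s; rewrite !fctE /=; case: (f s) => x y //=.
apply: is_derive_eq; case: d f1 f2 => x y //=.
Qed.

Lemma is_ctd_expc l t :
  is_ctime_derive (fun s => expc (l * s%:C)) t (l * expc (l * t%:C)).
Proof.
case: l => a b; rewrite /expc; split => /=.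
  under eq_fun do rewrite !mulr0 !mul0r !subr0 ?add0r.
  apply: is_derive_eq; rewrite /GRing.scale /=.
  rewrite !mulr0 !mul0r !subr0 !add0r !addr0 ?mulr1. ring.
under eq_fun do rewrite !mulr0 !mul0r !subr0 ?add0r ?addr0.
apply: is_derive_eq; rewrite /GRing.scale /=.
rewrite !mulr0 !mul0r !subr0 !add0r !addr0 ?mulr1; ring.
Qed.

Definition cpartial n (j : 'I_n) (f : 'rV[R]_n -> R[i]) (x : 'rV[R]_n) : R[i] :=
  'D_(delta_mx 0 j) (fun y => complex.Re (f y)) x
    +i* 'D_(delta_mx 0 j) (fun y => complex.Im (f y)) x.

Definition multi_partial n (a : 'I_n -> nat) (f : 'rV[R]_n -> R[i]) :=
  foldr (fun j => iter (a j) (cpartial j)) f (enum 'I_n).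

Definition multi_size n (a : 'I_n -> nat) : nat := \sum_(j < n) a j.

(** * Fourier transform *)

Definition fourier n (f : 'rV[R]_n -> R[i]) (xi : 'rV[R]_n) : R[i] :=
  cintegral (fun x => expc (0 -i* dotv x xi) * f x).

Definition inv_fourier n (g : 'rV[R]_n -> R[i]) (x : 'rV[R]_n) : R[i] :=
  ((pi *+ 2) ^- n)%:C * cintegral (fun xi => expc (0 +i* dotv x xi) * g xi).

(* For 1 <= p <= 2 and f in L^p, [g] represents the Fourier transform of [f]:
   the transform on L^p, with values in L^p' for the conjugate exponent p', is
   the continuous extension of the Fourier integral from the intersection of
   L^1 and L^p. *)
Definition is_fourier n (p : \bar R) (f g : 'rV[R]_n -> R[i]) : Prop :=
  in_Lp (hoelder_conjugate p) g /\
  exists F : nat -> 'rV[R]_n -> R[i],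
    [/\ forall k, in_Lp 1%E (F k) /\ in_Lp p (F k),
       cLnorm p (fun x => F k x - f x) @[k --> \oo] --> 0%E &
       cLnorm (hoelder_conjugate p) (fun xi => fourier (F k) xi - g xi)
         @[k --> \oo] --> 0%E].

(** * The equation u_tt - u_{x_1 x_1} = Delta u_t *)

(* [e] is the distinguished direction, carrying the coordinate x_1. *)
Definition disc n (e : 'I_n) (xi : 'rV[R]_n) : R :=
  sqnorm xi ^+ 2 - 4 * xi 0 e ^+ 2.

Definition lambda0 n (e : 'I_n) (xi : 'rV[R]_n) : R[i] := sqrtc (disc e xi)%:C.

Definition lambda_plus n (e : 'I_n) (xi : 'rV[R]_n) : R[i] :=
  (- (sqnorm xi)%:C + lambda0 e xi) / 2.

Definition lambda_minus n (e : 'I_n) (xi : 'rV[R]_n) : R[i] :=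
  (- (sqnorm xi)%:C - lambda0 e xi) / 2.

Definition Ghat n (e : 'I_n) (xi : 'rV[R]_n) (t : R) : R[i] :=
  if lambda0 e xi == 0 then (t * expR (- sqnorm xi * t / 2))%:C
  else (expc (lambda_plus e xi * t%:C) - expc (lambda_minus e xi * t%:C))
         / lambda0 e xi.

Definition Ghat_d n (e : 'I_n) (xi : 'rV[R]_n) (t : R) : R[i] :=
  if lambda0 e xi == 0 then
    ((1 - sqnorm xi / 2 * t) * expR (- sqnorm xi * t / 2))%:C
  else (lambda0 e xi)^-1 * (lambda_plus e xi * expc (lambda_plus e xi * t%:C)
    - lambda_minus e xi * expc (lambda_minus e xi * t%:C)).

Definition Ghat_dd n (e : 'I_n) (xi : 'rV[R]_n) (t : R) : R[i] :=
  if lambda0 e xi == 0 then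
    ((- sqnorm xi + sqnorm xi ^+ 2 / 4 * t) * expR (- sqnorm xi * t / 2))%:C
  else (lambda0 e xi)^-1 *
    (lambda_plus e xi * (lambda_plus e xi * expc (lambda_plus e xi * t%:C))
    - lambda_minus e xi * (lambda_minus e xi * expc (lambda_minus e xi * t%:C))).

Lemma Ghat_d1 n (e : 'I_n) xi t : is_ctime_derive (Ghat e xi) t (Ghat_d e xi t).
Proof.
rewrite /Ghat_d; case: ifPn => h.
  rewrite /Ghat h; split => /=; last by apply: is_derive_eq.
  apply: is_derive_eq; rewrite /GRing.scale /= ?mulr1 ?mulr0 ?addr0.
  by field.
have -> : Ghat e xi = fun s => (lambda0 e xi)^-1 *
    (expc (lambda_plus e xi * s%:C) - expc (lambda_minus e xi * s%:C)).
  by apply/funext => s; rewrite /Ghat (negbTE h) mulrC.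
by apply: is_ctdZ; apply: is_ctdB; exact: is_ctd_expc.
Qed.

Lemma Ghat_d2 n (e : 'I_n) xi t : is_ctime_derive (Ghat_d e xi) t (Ghat_dd e xi t).
Proof.
rewrite /Ghat_dd /Ghat_d; case: ifP => h.
  split => /=; last first.
     by apply: is_derive_eq.
  apply: is_derive_eq; rewrite /GRing.scale /= ?mulr1 ?mulr0 ?addr0.
  by field.
by apply: is_ctdZ; apply: is_ctdB; apply: is_ctdZ; exact: is_ctd_expc.
Qed.

Lemma expc0 : expc (0 : R[i]) = 1.
Proof. by rewrite /expc /= expR0 cos0 sin0 mul1r. Qed.

Lemma Ghat_ode n (e : 'I_n) (xi : 'rV[R]_n) :
  [/\ Ghat e xi 0 = 0, ctime_derive (Ghat e xi) 0 = 1 &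
   forall t, ctime_derive (ctime_derive (Ghat e xi)) t
     + (sqnorm xi)%:C * ctime_derive (Ghat e xi) t
     + (xi 0 e ^+ 2)%:C * Ghat e xi t = 0].
Proof.
have E : ctime_derive (Ghat e xi) = Ghat_d e xi.
  by apply/funext => t; exact: ctdE (Ghat_d1 _ _ _).
have sq : lambda0 e xi ^+ 2 = (disc e xi)%:C by exact: sqr_sqrtc.
split; rewrite ?E.
- rewrite /Ghat; case: ifP => h; first by rewrite mul0r.
  by rewrite !mulr0 subrr mul0r.
- rewrite /Ghat_d; case: ifPn => h.
    by rewrite !mulr0 mul0r expR0 subr0 mulr1.
  rewrite !mulr0 expc0 /lambda_plus /lambda_minus; by field.
- move=> t; rewrite (ctdE (Ghat_d2 _ _ _)) /Ghat /Ghat_d /Ghat_dd; case: ifPn => h.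
    have d0 : disc e xi = 0.
      by move: sq; rewrite (eqP h) expr0n/= => /esym[].
    rewrite -!rmorphM -!rmorphD/=; congr (_%:C).
    have -> : xi 0 e ^+ 2 = sqnorm xi ^+ 2 / 4 by move: d0; rewrite /disc; lra.
    by field.
  set x := expc _; set y := expc _.
  have -> : (xi 0 e ^+ 2)%:C = ((sqnorm xi)%:C ^+ 2 - lambda0 e xi ^+ 2) / 4.
    rewrite sq -(rmorph_nat (real_complex R) 4) -rmorphXn -rmorphB -fmorphV -rmorphM.
    by congr (_%:C); rewrite /disc; field.
  rewrite /lambda_plus /lambda_minus; by field.
Qed.

Definition uhat n (e : 'I_n) (v0 v1 : 'rV[R]_n -> R[i]) (t : R)
    (xi : 'rV[R]_n) : R[i] :=
  (ctime_derive (Ghat e xi) t + (sqnorm xi)%:C * Ghat e xi t) * v0 xi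
    + Ghat e xi t * v1 xi.

(* The solution whose data have Fourier transforms v0 and v1: the inverse
   Fourier transform in x of [uhat]. It is an absolutely convergent integral
   when v0 and v1 belong to some L^q, q >= 1, and have bounded support, which
   is the case for supports in [Dset e r]; the solution is then smooth. *)
Definition solution n (e : 'I_n) (v0 v1 : 'rV[R]_n -> R[i]) (x : 'rV[R]_n)
    (t : R) : R[i] :=
  inv_fourier (uhat e v0 v1 t) x.

Definition mixed_derivative n (a : 'I_n -> nat) (l : nat)
    (u : 'rV[R]_n -> R -> R[i]) (t : R) : 'rV[R]_n -> R[i] :=
  multi_partial a (fun x => iter l ctime_derive (u x) t).

Definition Dset n (e : 'I_n) (r : R) : set 'rV[R]_n :=
  [set xi | sqnorm xi <= r * `|xi 0 e|].

End complex_valued.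

Definition dir1 n (hn : (3 <= n)%N) : 'I_n := Ordinal (ltnW (ltnW hn)).

(* Main.v *)
(* On D_r one has |xi|^2 <= r |xi_1|, so that an energy estimate for
   y'' + |xi|^2 y' + xi_1^2 y = 0 with the Lyapunov function
   y'^2 + xi_1^2 y^2 + eps |xi|^2 y y' bounds the l-th time derivative of the
   Green function by |xi_1|^(l-1) exp(-c |xi|^2 t), with |xi_1|^(-1) replaced
   by t when l = 0, and |xi_1|^l is at most
   (1 + r) |xi|^(2 [l/2]) because |xi_1| <= r on D_r. Hence the symbol of
   d_x^alpha d_t^l is a power of t times a Gaussian exp(-c' |xi|^2 t).

   The passage from L^p to L^q uses no Hausdorff-Young inequality. On the data
   side, \int exp(-k |xi|^2) |f^(xi)|^2 is bounded by splitting f at a height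
   into an L^1 part, whose transform is bounded, and an L^2 part, which is
   handled by Plancherel; the optimal height gives the scaling in k. On the
   solution side, Cauchy-Schwarz against the Gaussian bounds the sup norm,
   Plancherel bounds the L^2 norm, and L^q is interpolated between the two.
   Only the inequality \int |f^|^2 <= (2 pi)^n \int |f|^2 is needed: inserting
   the weight exp(-e |xi_1| - ... - e |xi_n|) turns the left side into a
   quadratic form with the Poisson kernel, to which Schur's test applies. *)

From HB Require Import structures.
Require Import Defs.
From mathcomp Require Import all_boot all_order all_algebra.
From mathcomp Require Import complex.
From mathcomp Require Import all_classical all_reals all_analysis.
From mathcomp Require Import measurable_realfun ess_sup_inf ring lra.
Set Implicit Arguments.
Unset Strict Implicit.
Unset Printing Implicit Defensive.
Import Order.TTheory GRing.Theory Num.Theory.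
Import numFieldNormedType.Exports.
Local Open Scope classical_set_scope.
Local Open Scope ring_scope.
Local Open Scope complex_scope.

(** * Integration on row vectors *)

(** The weight exp(-k |xi|^2), with k a fixed multiple of t, is the only interface between the two
    sides. The data contribute k^(-(n/2)(1/p - 1/2)), the solution k^(-(n/2)(1/2 - 1/q)), and the
    product is the power of t for (p, q); hence only Gaussian-weighted L^2 norms of transforms have
    to be estimated. The obstacle is that the transforms of the data are known only as limits in
    L^p', with supports modulo null sets. The weighted bound is therefore proved for integrable
    functions and carried to the limit, the error being controlled because p' >= 2; and the
    transforms are replaced by representatives vanishing everywhere off D_r, so that symbol bounds
    and differentiation under the integral hold pointwise. In the L^2 inequality the weight is a
    tensor product, which reduces its transform to integrals on the line, and the mass of the
    resulting kernel is bounded by (2 pi)^n uniformly in e, which lets e tend to 0. *)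

Lemma leb_sigma_finite (R : realType) n : sigma_finite setT (leb R n).
Proof.
pose A k := [set x : 'rV[R]_n |
  forall i : 'I_n, (`[- k%:R, k%:R]%classic : set R) (x 0 i)].
have mA k : measurable (A k).
  rewrite (_ : A k = \big[setI/setT]_(i < n)
      ((fun x : 'rV[R]_n => x 0 i : measurableTypeR R) @^-1`
        `[- k%:R, k%:R]%classic)).
    apply: bigsetI_measurable => i _; rewrite -[X in measurable X]setTI.
    exact: measurable_coord.
  rewrite -bigcap_seq; apply/seteqP; split => [x Ax i _|x Ax i]; first exact: Ax.
  by apply: (Ax i); rewrite /= mem_index_enum.
exists A => [|k].
  apply/seteqP; split => // x _.
  pose b := \sum_(i < n) `|x 0 i|.
  exists (Num.bound b) => //= i.
  have xb : `|x 0 i| <= b by rewrite /b (bigD1 i) //= lerDl sumr_ge0.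
  have b0 : 0 <= b by exact: sumr_ge0.
  have bb : `|x 0 i| <= (Num.bound b)%:R.
    by apply: (le_trans xb); apply: ltW; exact: archi_boundP.
  suff : x 0 i \in `[- (Num.bound b)%:R, (Num.bound b)%:R] by [].
  by rewrite in_itv /= -ler_norml.
split => //.
have -> := @leb_box R n (fun=> `[- k%:R, k%:R]%classic) (fun=> measurable_itv _).
have E : lebesgue_measure (`[- k%:R, k%:R]%classic : set R) = (k%:R + k%:R)%:E.
  rewrite lebesgue_measure_itv/= lte_fin; case: ltP => h.
    by rewrite -EFinD opprK.
  have : (k%:R : R) = 0 by have := ler0n R k; lra.
  by move=> ->; rewrite addr0.
by under eq_bigr do rewrite E; rewrite prodEFin ltry.
Qed.

(** A copy of [leb R n] under its own head symbol, to which the sigma-finite structure required by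
    product measures and Fubini is attached. *)
Definition sigma_leb (R : realType) n : set 'rV[R]_n -> \bar R := leb R n.
HB.instance Definition _ (R : realType) n := Measure.copy (@sigma_leb R n) (leb R n).
HB.instance Definition _ (R : realType) n :=
  Measure_isSigmaFinite.Build _ _ _ (@sigma_leb R n) (leb_sigma_finite R n).

Lemma ge0_integral_leb0 (R : realType) (f : 'rV[R]_0 -> \bar R) :
  measurable_fun setT f -> (forall x, (0 <= f x)%E) -> (\int[leb R 0]_x f x)%E = f 0.
Proof. by move=> mf f0 /=; rewrite integral_dirac// diracT mul1e. Qed.

Lemma ge0_integral_lebS (R : realType) n (f : 'rV[R]_n.+1 -> \bar R) :
  measurable_fun setT f -> (forall x, (0 <= f x)%E) ->
  (\int[leb R n.+1]_x f x =
  \int[leb R n]_x \int[lebesgue_measure]_y f (rV_cons (x, y)))%E.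
Proof.
move=> mf f0 /=; rewrite /leb_succ /=.
rewrite ge0_integral_pushforward//; last first.
  exact: measurable_rV_cons.
rewrite preimage_setT.
rewrite (fubini_tonelli1 (m1 := @sigma_leb R n) (m2:=lebesgue_measure) (f \o @rV_cons R n))//=.
by apply: measurableT_comp => //; exact: measurable_rV_cons.
Qed.

(** * The two-sided exponential on the line and its cosine transform *)

Lemma is_derive_expcos (R : realType) (e x y : R) : 0 < e ->
  is_derive y 1 (fun z => expR (- e * z) *
      ((x * sin (x * z) - e * cos (x * z)) / (e ^+ 2 + x ^+ 2) - e^-1))
    (expR (- e * y) * (1 + cos (x * y))).
Proof.
move=> e0; have ex : e ^+ 2 + x ^+ 2 != 0.
  by rewrite gt_eqF// ltr_wpDr ?sqr_ge0 ?exprn_gt0.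
apply: is_derive_eq; rewrite /GRing.scale /=; field.
by rewrite ex gt_eqF.
Qed.

Lemma cvg_expR_mulNy (R : realType) (e : R) : 0 < e ->
  expR (- e * y) @[y --> +oo] --> (0 : R).
Proof.
move=> e0; rewrite (_ : (fun y => _) = (fun y => expR (- (e * y)))); last first.
  by apply/funext => y; rewrite mulNr.
apply: (@cvg_comp _ _ _ (fun y => e * y) (fun y => expR (- y))); last first.
  exact: cvgr_expR.
by apply: gt0_cvgMry => //; exact: cvg_id.
Qed.

(** Adding 1 to the cosine makes the integrand nonnegative, so that evenness and the fundamental
    theorem on [0, +oo[ for nonnegative functions apply; the primitive is the one of
    [is_derive_expcos], which tends to 0 at infinity. *)
Lemma integral_exp_one_plus_cos (R : realType) (e x : R) : 0 < e ->
  (\int[lebesgue_measure]_y (expR (- e * `|y|) * (1 + cos (x * y)))%:E)%E =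
  (2 / e + 2 * e / (e ^+ 2 + x ^+ 2))%:E.
Proof.
move=> e0; have ex : e ^+ 2 + x ^+ 2 != 0.
  by rewrite gt_eqF// ltr_wpDr ?sqr_ge0 ?exprn_gt0.
have c1 (y : R) : 0 <= 1 + cos (x * y).
  by have := cos_geN1 (x * y); lra.
rewrite ge0_symfun_integralT; last 3 first.
- by move=> y; rewrite mulr_ge0// expR_ge0.
- move=> y; apply: cvgM.
    apply: continuous_comp; last exact: continuous_expR.
    by apply: cvgM; [exact: cvg_cst|exact: norm_continuous].
  apply: cvgD; first exact: cvg_cst.
  apply: continuous_comp; last exact: continuous_cos.
  by apply: cvgM; [exact: cvg_cst|exact: cvg_id].
- by move=> y /=; rewrite normrN mulrN cosN.
rewrite (_ : [set y | (0 <= y)%R] = `[(0:R), +oo[%classic); last first.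
  by apply/seteqP; split => y/=; rewrite in_itv/= andbT.
under eq_integral.
  move=> y; rewrite inE/= in_itv/= andbT => y0; rewrite ger0_norm//.
  over.
pose F (z : R) := expR (- e * z) *
  ((x * sin (x * z) - e * cos (x * z)) / (e ^+ 2 + x ^+ 2) - e^-1).
have dF (y : R) : is_derive y 1 F (expR (- e * y) * (1 + cos (x * y))).
  exact: is_derive_expcos.
have cF (y : R) : {for y, continuous F}.
  by apply: differentiable_continuous; apply/derivable1_diffP; case: (dF y).
rewrite (@ge0_continuous_FTC2y _ _ F 0 0); first last.
- by move=> y _; rewrite derive1E derive_val.
- by apply: cvg_at_right_filter; exact: cF.
- by move=> y _; case: (dF y).
- pose M := (`|x| + `|e|) / (e ^+ 2 + x ^+ 2) + e^-1.
  have FM (y : R) : `|F y| <= expR (- e * y) * M.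
    rewrite /F normrM ger0_norm ?expR_ge0// ler_wpM2l ?expR_ge0//.
    apply: (le_trans (ler_normB _ _)); apply: lerD; last first.
      by rewrite ger0_norm// invr_ge0 ltW.
    rewrite normrM [X in _ * X]ger0_norm; last first.
      by rewrite invr_ge0 addr_ge0 ?sqr_ge0.
    apply: ler_wpM2r; first by rewrite invr_ge0 addr_ge0 ?sqr_ge0.
    apply: (le_trans (ler_normB _ _)); rewrite !normrM; apply: lerD.
      by rewrite ler_piMr// ler_norml sin_geN1 sin_le1.
    by rewrite ler_piMr// ler_norml cos_geN1 cos_le1.
  apply/norm_cvg0P; apply: (@squeeze_cvgr _ _ _ _ (fun=> 0) (fun y => expR (- e * y) * M)).
  + by near=> y; rewrite normr_ge0 FM.
  + exact: cvg_cst.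
  + rewrite -(mul0r M); apply: cvgMl; exact: cvg_expR_mulNy.
- apply: continuous_subspaceT => y.
  apply: cvgM.
    apply: continuous_comp; last exact: continuous_expR.
    by apply: cvgM; [exact: cvg_cst|exact: cvg_id].
  apply: cvgD; first exact: cvg_cst.
  apply: continuous_comp; last exact: continuous_cos.
  by apply: cvgM; [exact: cvg_cst|exact: cvg_id].
- by move=> y _; rewrite mulr_ge0// expR_ge0.
rewrite /F !mulr0 expR0 sin0 cos0 -EFinB -EFinM; congr (_%:E); field.
by rewrite ex gt_eqF.
Unshelve. all: by end_near.
Qed.

Lemma measurable_exp_abs (R : realType) (e : R) :
  measurable_fun setT (fun y : R => expR (- e * `|y|)).
Proof.
apply: measurableT_comp => //; apply: measurable_funM => //.
Qed.

Lemma measurable_trig_mul (R : realType) (x : R) :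
  measurable_fun setT (fun y : R => cos (x * y)) /\
  measurable_fun setT (fun y : R => sin (x * y)).
Proof.
have mx : measurable_fun setT (fun y : R => x * y).
  by apply: measurable_funM.
split; apply: measurableT_comp mx; apply: continuous_measurable_fun.
  exact: continuous_cos.
exact: continuous_sin.
Qed.

Lemma integrable_exp_abs (R : realType) (e : R) : 0 < e ->
  (@lebesgue_measure R).-integrable setT (fun y => (expR (- e * `|y|))%:E).
Proof.
move=> e0; apply/integrableP; split.
  by apply/measurable_EFinP; exact: measurable_exp_abs.
have := integral_exp_one_plus_cos 0 e0.
move=> h; apply: (@le_lt_trans _ _ (2 / e + 2 * e / (e ^+ 2 + 0 ^+ 2))%:E); last first.
  by rewrite ltry.
rewrite -h; apply: ge0_le_integral => //.
- by apply/measurable_EFinP; apply: measurableT_comp => //; exact: measurable_exp_abs.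
- by apply/measurable_EFinP; apply: measurable_funM; [exact: measurable_exp_abs|
    apply: measurable_funD => //; exact: (measurable_trig_mul 0).1].
- move=> y _; rewrite lee_fin mul0r cos0 ger0_norm ?expR_ge0//.
  by rewrite ler_peMr ?expR_ge0//; lra.
Qed.

Lemma integrable_exp_abs_mul (R : realType) (e : R) (g : R -> R) : 0 < e ->
  measurable_fun setT g -> (forall y, `|g y| <= 1) ->
  (@lebesgue_measure R).-integrable setT (fun y => (expR (- e * `|y|) * g y)%:E).
Proof.
move=> e0 mg g1.
apply: (le_integrable measurableT _ _ (integrable_exp_abs e0)).
  by apply/measurable_EFinP; apply: measurable_funM; [exact: measurable_exp_abs|].
move=> y _; rewrite /= lee_fin normrM ler_piMr//.
Qed.

(** The case [x = 0] of [integral_exp_one_plus_cos] gives 2 / e for the integral of the exponential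
    alone; subtracting it leaves the cosine term. *)
Lemma integral_exp_cos (R : realType) (e x : R) : 0 < e ->
  \int[lebesgue_measure]_y (expR (- e * `|y|) * cos (x * y)) =
  2 * e / (e ^+ 2 + x ^+ 2).
Proof.
move=> e0.
have E0 : \int[lebesgue_measure]_y (expR (- e * `|y|)) = 2 / e.
  have := integral_exp_one_plus_cos 0 e0.
  under eq_integral do rewrite mul0r cos0 -(natrD _ 1 1) mulrC EFinM.
  rewrite integralZl//; last exact: integrable_exp_abs.
  rewrite -[X in (_ * X)%E]fineK; last first.
    by apply: integrable_fin_num => //; exact: integrable_exp_abs.
  rewrite -EFinM => -[] /esym h; apply: (@mulfI _ 2) => //.
  by rewrite /Rintegral -h; field; rewrite gt_eqF.
have := integral_exp_one_plus_cos x e0.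
have ic := integrable_exp_abs_mul e0 (measurable_trig_mul x).1.
have {}ic : (@lebesgue_measure R).-integrable setT (EFin \o (fun y => (expR (- e * `|y|) * cos (x * y)))).
  by apply: ic => y; rewrite ler_norml cos_geN1 cos_le1.
under eq_integral do rewrite mulrDr mulr1 EFinD.
rewrite integralD//; last exact: integrable_exp_abs.
rewrite -[X in (X + _)%E]fineK; last first.
  by apply: integrable_fin_num => //; exact: integrable_exp_abs.
rewrite -[X in (_ + X)%E]fineK; last exact: integrable_fin_num.
rewrite -EFinD => -[]; rewrite -/(Rintegral _ _ _) E0.
by move=> /addrI.
Qed.

Lemma bigcup_itvcc_nat (R : realType) :
  \bigcup_k `[- k%:R, k%:R]%classic = [set: R].
Proof.
apply/seteqP; split => // x _; exists (Num.bound `|x|) => //=.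
suff : x \in `[- (Num.bound `|x|)%:R, (Num.bound `|x|)%:R] by [].
by rewrite in_itv /= -ler_norml ltW// archi_boundP.
Qed.

Lemma nondecreasing_itvcc_nat (R : realType) :
  {homo (fun k : nat => `[- k%:R, k%:R]%classic : set R) : n m /
    (n <= m)%N >-> (n <= m)%O}.
Proof.
move=> n m nm; apply/subsetPset => x /=; rewrite !in_itv/= => /andP[h1 h2].
have nmR : n%:R <= m%:R :> R by rewrite ler_nat.
by apply/andP; split; lra.
Qed.

(** The integrand is odd: on [-k, k] the substitution y -> -y shows that the integral equals its
    opposite, and dominated convergence extends this to the line. *)
Lemma integral_exp_sin (R : realType) (e x : R) : 0 < e ->
  \int[lebesgue_measure]_y (expR (- e * `|y|) * sin (x * y)) = 0.
Proof.
move=> e0; rewrite /Rintegral; set f := fun y => _.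
have cf : continuous (fun y : R => expR (- e * `|y|) * sin (x * y)).
  move=> y; apply: cvgM.
    apply: continuous_comp; last exact: continuous_expR.
    by apply: cvgM; [exact: cvg_cst|exact: norm_continuous].
  apply: continuous_comp; last exact: continuous_sin.
  by apply: cvgM; [exact: cvg_cst|exact: cvg_id].
have fi : (@lebesgue_measure R).-integrable setT f.
  apply: integrable_exp_abs_mul => //; first exact: (measurable_trig_mul x).2.
  by move=> y; rewrite ler_norml sin_geN1 sin_le1.
have mitv k : measurable (`[- k%:R, k%:R]%classic : set R) by exact: measurable_itv.
have Z k : (\int[lebesgue_measure]_(y in `[(- k%:R)%R, k%:R]) f y = 0)%E.
  have := @integration_by_substitution_oppr R (fun y => expR (- e * `|y|) * sin (x * y)) (- k%:R) k%:R.
  rewrite opprK => /(_ _ (continuous_subspaceT cf)) H.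
  have {}H := H (ge0_cp (ler0n R k)).2.
  have fik : (@lebesgue_measure R).-integrable `[(- k%:R)%R, k%:R] f.
    exact: (integrableS measurableT).
  set I := (\int[lebesgue_measure]_(y in _) f y)%E.
  have IN : I = (- I)%E.
    rewrite /I -integralN; last exact: integrable_add_def.
    by rewrite [LHS]H; apply: eq_integral => y _; rewrite /= normrN mulrN sinN mulrN.
  have : I \is a fin_num by exact: integrable_fin_num.
  case: I IN => // i [] ii _; congr (_%:E); lra.
have mf : measurable_fun setT f by case/integrableP : fi.
pose A k := `[- k%:R, k%:R]%classic : set R.
have : (\int[lebesgue_measure]_y (f \_ (A k)) y)%E @[k --> \oo] -->
    (\int[lebesgue_measure]_y f y)%E.
  apply: (@dominated_cvg _ _ _ lebesgue_measure _ measurableT _ _ (abse \o f)).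
  - by move=> k; apply/(measurable_restrictT _ (mitv k)); exact: measurable_funTS mf.
  - move=> y _; have [k _ Ay] : (\bigcup_k A k) y by rewrite bigcup_itvcc_nat.
    apply: cvg_near_cst; exists k => // m /= km.
    rewrite patchE mem_set//.
    by have /subsetPset := nondecreasing_itvcc_nat R km; exact.
  - by move=> y _.
  - exact: integrable_abse.
  - by move=> k y _; rewrite patchE; case: ifP => // _; rewrite abse0 abse_ge0.
rewrite (_ : (fun k => _) = fun=> 0%E); last first.
  by apply/funext => k; rewrite -integral_mkcond Z.
by move=> /cvg_lim => <- //; rewrite lim_cst.
Qed.

(** On [-n, n] the integral is an increment of [F]; monotone convergence then bounds the whole
    integral by the oscillation of [F], without computing limits of [F] at infinity. *)
Lemma ge0_integral_le_primitive (R : realType) (f F : R -> R) (C : R) :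
  continuous f -> (forall x, 0 <= f x) ->
  (forall x : R, is_derive x 1 F (f x)) -> (forall x y, F y - F x <= C) ->
  (\int[lebesgue_measure]_x (f x)%:E <= C%:E)%E.
Proof.
move=> cf f0 dF FC.
have mf : measurable_fun setT f by exact: continuous_measurable_fun.
have := @ge0_nondecreasing_set_cvg_integral _ (measurableTypeR R) R _ (EFin \o f) lebesgue_measure
  (@nondecreasing_itvcc_nat R).
move=> /(_ (fun=> measurable_itv _)); rewrite bigcup_itvcc_nat => H.
have {}H := H _ _.
apply: (@closed_cvg _ _ _ eventually_filter (fun n => \int[lebesgue_measure]_(x in `[(- n%:R)%R, n%:R]) (f x)%:E)%E [set z | (z <= C%:E)%E]); last first.
- apply: H => [i|i x _]; last by rewrite lee_fin.
  by apply/measurable_EFinP; exact: measurable_funTS.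
- exists 1%N => // n /= n1.
  have n0 : - n%:R < n%:R :> R by rewrite gtrN// ltr0n.
  rewrite (@continuous_FTC2 _ _ F)//.
  + by rewrite -EFinB lee_fin FC.
  + exact: continuous_subspaceT.
  + have dc : forall z : R, {for z, continuous F}.
      by move=> z; apply: differentiable_continuous; apply/derivable1_diffP; case: (dF z).
    split=> [z _||]; first by case: (dF z).
      by apply: cvg_at_right_filter; exact: dc.
    by apply: cvg_at_left_filter; exact: dc.
  + by move=> z _; rewrite derive1E derive_val.
- exact: closed_ereal_ge_ereal.
Qed.

(** A primitive is 2 atan((x - a) / e), whose oscillation is at most 2 pi whatever [e] and [a]
    are. *)
Lemma integral_cauchy_kernel (R : realType) (e a : R) : 0 < e ->
  (\int[lebesgue_measure]_x (2 * e / (e ^+ 2 + (x - a) ^+ 2))%:E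
    <= (2 * pi)%:E)%E.
Proof.
move=> e0.
have ex (x : R) : 0 < e ^+ 2 + (x - a) ^+ 2.
  by rewrite ltr_wpDr ?sqr_ge0 ?exprn_gt0.
apply: (@ge0_integral_le_primitive _ _ (fun x => 2 * atan ((x - a) / e))).
- move=> x; apply: cvgM; first exact: cvg_cst.
  apply: cvgV; first by rewrite gt_eqF.
  apply: cvgD; first exact: cvg_cst.
  by rewrite expr2; apply: cvgM; apply: cvgB; do ?[exact: cvg_id|exact: cvg_cst].
- by move=> x; rewrite divr_ge0 ?ltW// mulr_gt0.
- move=> x; apply: is_derive_eq.
  rewrite /GRing.scale /=; field.
  rewrite !gt_eqF//.
- move=> x y; have := atan_gtNpi2 ((x - a) / e); have := atan_ltpi2 ((y - a) / e).
  lra.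
Qed.

Lemma rV_cons0 (R : realType) n (x : 'rV[R]_n) (y : R) :
  rV_cons (x, y) 0 ord0 = y.
Proof. by rewrite rV_consE unlift_none. Qed.

Lemma rV_consS (R : realType) n (x : 'rV[R]_n) (y : R) i :
  rV_cons (x, y) 0 (lift ord0 i) = x 0 i.
Proof. by rewrite rV_consE liftK. Qed.

Lemma dotv_cons (R : realType) n (x : 'rV[R]_n.+1) (y : 'rV[R]_n) (z : R) :
  dotv x (rV_cons (y, z)) =
  x 0 ord0 * z + dotv (\row_j x 0 (lift ord0 j)) y.
Proof.
rewrite /dotv big_ord_recl rV_cons0; congr (_ + _).
by apply: eq_bigr => i _; rewrite rV_consS mxE.
Qed.

Lemma measurable_prod_coord (R : realType) n (f : 'I_n -> R -> R) :
  (forall i, measurable_fun setT (f i)) ->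
  measurable_fun setT (fun x : 'rV[R]_n => \prod_i f i (x 0 i)).
Proof.
move=> mf; apply: measurable_prod => i _.
exact: (measurableT_comp (mf i) (measurable_coord i)).
Qed.

Lemma integral_prod_coord (R : realType) n (f : 'I_n -> R -> R) :
  (forall i, measurable_fun setT (f i)) -> (forall i x, 0 <= f i x) ->
  (\int[leb R n]_x (\prod_i f i (x 0 i))%:E =
   \prod_i \int[lebesgue_measure]_y (f i y)%:E)%E.
Proof.
elim: n f => [|n IH] f mf f0.
  rewrite big_ord0 ge0_integral_leb0.
  - by rewrite big_ord0.
  - by apply/measurable_EFinP; exact: measurable_prod_coord.
  - by move=> x; rewrite lee_fin prodr_ge0.
rewrite ge0_integral_lebS; first last.
- by move=> x; rewrite lee_fin prodr_ge0.
- by apply/measurable_EFinP; exact: measurable_prod_coord.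
under eq_integral => x _.
  under eq_integral => y _.
    rewrite big_ord_recl rV_cons0; under eq_bigr do rewrite rV_consS.
    rewrite mulrC EFinM; over.
  rewrite ge0_integralZl//; last 3 first.
  - by apply/measurable_EFinP; exact: mf.
  - by move=> y _; rewrite lee_fin.
  - by rewrite lee_fin prodr_ge0.
  over.
rewrite ge0_integralZr//; last 3 first.
- by apply/measurable_EFinP; exact: (measurable_prod_coord (fun i => mf (lift ord0 i))).
- by move=> y _; rewrite lee_fin prodr_ge0.
- by apply: integral_ge0 => y _; rewrite lee_fin.
by rewrite (IH (fun i => f (lift ord0 i)))// big_ord_recl muleC.
Qed.

Lemma integrable_lebS (R : realType) n (f : 'rV[R]_n.+1 -> \bar R) :
  (leb R n.+1).-integrable setT f ->
  (\int[leb R n.+1]_x f x =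
   \int[leb R n]_x \int[lebesgue_measure]_y f (rV_cons (x, y)))%E.
Proof.
move=> fi; have mf : measurable_fun setT f by case/integrableP : fi.
have mc := @measurable_rV_cons R n.
have mfc : measurable_fun setT (f \o @rV_cons R n) by exact: measurableT_comp.
have fi' : (@sigma_leb R n \x lebesgue_measure)%E.-integrable setT (f \o @rV_cons R n).
  apply/integrableP; split => //; case/integrableP : fi => _.
  rewrite /= /leb_succ ge0_integral_pushforward//.
  by apply: measurableT_comp.
rewrite /= /leb_succ integral_pushforward//.
by rewrite (integral12_prod_meas1 (m1 := @sigma_leb R n) fi').
Qed.

Lemma measurable_fun_dotv d (T : measurableType d) (R : realType) n
    (f g : T -> 'rV[R]_n) :
  measurable_fun setT f -> measurable_fun setT g ->
  measurable_fun setT (fun t => dotv (f t) (g t)).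
Proof.
move=> mf mg; apply: measurable_sum => i; apply: measurable_funM.
  exact: (measurableT_comp (measurable_coord i) mf).
exact: (measurableT_comp (measurable_coord i) mg).
Qed.

Lemma measurable_dotv (R : realType) n (x : 'rV[R]_n) :
  measurable_fun setT (dotv x).
Proof. exact: (measurable_fun_dotv (f := cst x)). Qed.

Lemma measurable_sqnorm (R : realType) n :
  measurable_fun setT (@sqnorm R n).
Proof. exact: measurable_fun_dotv. Qed.

Lemma measurable_cosT (R : realType) : measurable_fun [set: R] cos.
Proof. exact: continuous_measurable_fun (@continuous_cos R). Qed.

Lemma measurable_sinT (R : realType) : measurable_fun [set: R] sin.
Proof. exact: continuous_measurable_fun (@continuous_sin R). Qed.

(** * A Plancherel inequality *)

Definition exp_weight (R : realType) n (e : R) (x : 'rV[R]_n) : R :=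
  \prod_i expR (- e * `|x 0 i|).

(** A product of one-dimensional kernels, one per coordinate, rather than the rotation-invariant
    Poisson kernel: it is the transform of the product weight [exp_weight]. *)
Definition poisson_kernel (R : realType) n (e : R) (x : 'rV[R]_n) : R :=
  \prod_i (2 * e / (e ^+ 2 + x 0 i ^+ 2)).

Lemma exp_weight_ge0 (R : realType) n (e : R) (x : 'rV[R]_n) :
  0 <= exp_weight e x.
Proof. by apply: prodr_ge0 => i _; exact: expR_ge0. Qed.

Lemma measurable_exp_weight (R : realType) n (e : R) :
  measurable_fun setT (@exp_weight R n e).
Proof.
exact: (measurable_prod_coord (f := fun=> fun y => expR (- e * `|y|))
  (fun=> measurable_exp_abs e)).
Qed.

Lemma integrable_exp_weight (R : realType) n (e : R) : 0 < e ->
  (leb R n).-integrable setT (fun x => (exp_weight e x)%:E).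
Proof.
move=> e0; apply/integrableP; split.
  by apply/measurable_EFinP; exact: measurable_exp_weight.
under eq_integral do rewrite /= ger0_norm ?exp_weight_ge0//.
rewrite (integral_prod_coord (f := fun=> fun y => expR (- e * `|y|))).
- rewrite lt_neqAle leey andbT.
  have /fin_numPlt : (\int[lebesgue_measure]_y (expR (- e * `|y|))%:E)%E \is a fin_num.
    by apply: integrable_fin_num => //; exact: integrable_exp_abs.
  case: (\int[lebesgue_measure]_y _)%E => // s _.
  by rewrite prodEFin.
- by move=> _; exact: measurable_exp_abs.
- by move=> _ y; exact: expR_ge0.
Qed.

Lemma integrable_exp_weight_mul (R : realType) n (e : R) (g : 'rV[R]_n -> R) :
  0 < e -> measurable_fun setT g -> (forall y, `|g y| <= 1) ->
  (leb R n).-integrable setT (fun y => (exp_weight e y * g y)%:E).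
Proof.
move=> e0 mg g1.
apply: (le_integrable measurableT _ _ (integrable_exp_weight n e0)).
  by apply/measurable_EFinP; apply: measurable_funM; [exact: measurable_exp_weight|].
move=> y _; rewrite /= lee_fin normrM ler_piMr//.
Qed.

(** Induction on the dimension: the addition formula for the cosine of x_0 z + (x', y) separates one
    coordinate, and the sine part of that coordinate integrates to 0 by oddness. *)
Lemma integral_exp_weight_cos (R : realType) n (e : R) (x : 'rV[R]_n) : 0 < e ->
  \int[leb R n]_y (exp_weight e y * cos (dotv x y)) = poisson_kernel e x.
Proof.
move=> e0; elim: n x => [|n IH] x.
  rewrite /Rintegral integral_dirac//; last first.
    apply/measurable_EFinP; apply: measurable_funM; first exact: measurable_exp_weight.
    apply: measurableT_comp; [exact: measurable_cosT|exact: measurable_dotv].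
  by rewrite diracT mul1e /exp_weight /poisson_kernel /dotv !big_ord0 cos0 mulr1.
rewrite /Rintegral integrable_lebS; last first.
  apply: integrable_exp_weight_mul => //.
    by apply: measurableT_comp; [exact: measurable_cosT|exact: measurable_dotv].
  by move=> y; rewrite ler_norml cos_geN1 cos_le1.
set x' : 'rV_n := \row_j x 0 (lift ord0 j).
transitivity (fine (\int[leb R n]_y (exp_weight e y * cos (dotv x' y) *
   (2 * e / (e ^+ 2 + x 0 ord0 ^+ 2)))%:E)%E).
  congr fine; apply: eq_integral => y _.
  pose c := exp_weight e y * cos (dotv x' y).
  pose s := exp_weight e y * sin (dotv x' y).
  under eq_integral => z _.
    rewrite /exp_weight big_ord_recl rV_cons0; under eq_bigr do rewrite rV_consS.
    rewrite dotv_cons cosD -/x'.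
    rewrite (_ : _ * _ * _ =
      c * (expR (- e * `|z|) * cos (x 0 ord0 * z)) -
      s * (expR (- e * `|z|) * sin (x 0 ord0 * z))); last first.
      rewrite /c /s /exp_weight; ring.
    rewrite EFinB (EFinM c) (EFinM s).
    over.
  have ic := integrable_exp_abs_mul e0 (measurable_trig_mul (x 0 ord0)).1.
  have {}ic : (@lebesgue_measure R).-integrable setT
      (fun z => (expR (- e * `|z|) * cos (x 0 ord0 * z))%:E).
    by apply: ic => z; rewrite ler_norml cos_geN1 cos_le1.
  have is_ := integrable_exp_abs_mul e0 (measurable_trig_mul (x 0 ord0)).2.
  have {}is_ : (@lebesgue_measure R).-integrable setT
      (fun z => (expR (- e * `|z|) * sin (x 0 ord0 * z))%:E).
    by apply: is_ => z; rewrite ler_norml sin_geN1 sin_le1.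
  rewrite integralB//; [|exact: integrableZl|exact: integrableZl].
  rewrite !integralZl//.
  rewrite -(fineK (integrable_fin_num measurableT ic)).
  rewrite -(fineK (integrable_fin_num measurableT is_)).
  rewrite -!/(Rintegral _ _ _) integral_exp_cos// integral_exp_sin//.
  by rewrite mule0 sube0.
rewrite -/(Rintegral _ _ _) RintegralZr//; last first.
  apply: integrable_exp_weight_mul => //.
    by apply: measurableT_comp; [exact: measurable_cosT|exact: measurable_dotv].
  by move=> y; rewrite ler_norml cos_geN1 cos_le1.
rewrite IH /poisson_kernel big_ord_recl mulrC; congr (_ * _).
by apply: eq_bigr => i _; rewrite mxE.
Qed.

Lemma integral_poisson_kernel (R : realType) n (e : R) (a : 'rV[R]_n) : 0 < e ->
  (\int[leb R n]_x (poisson_kernel e (x - a))%:E <= ((2 * pi) ^+ n)%:E)%E.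
Proof.
move=> e0; rewrite /poisson_kernel.
under eq_integral do under eq_bigr do rewrite !mxE.
rewrite (integral_prod_coord (f := fun i y => 2 * e / (e ^+ 2 + (y - a 0 i) ^+ 2))).
- have -> : (2 * pi) ^+ n = \prod_(i < n) (2 * pi) :> R.
    by rewrite prodr_const card_ord.
  rewrite -prodEFin.
  (* Nonnegativity is carried through the induction because products of extended reals are compared
     factor by factor only for nonnegative factors. *)
  suff : (0 <= \prod_i \int[lebesgue_measure]_y (2 * e / (e ^+ 2 + (y - a 0%R i) ^+ 2))%:E <=
      \prod_(i < n) (2 * pi)%:E)%E by case/andP.
  elim/big_ind2 : _ => [|x1 x2 y1 y2 /andP[? ?] /andP[? ?]|i _].
  + by rewrite lee01 lexx.
  + by rewrite mule_ge0// lee_pmul.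
  + rewrite integral_cauchy_kernel// andbT integral_ge0// => y _.
    by rewrite lee_fin divr_ge0 ?addr_ge0 ?sqr_ge0// mulr_ge0// ltW.
- move=> i; apply: continuous_measurable_fun => y.
  apply: cvgM; first exact: cvg_cst.
  apply: cvgV; first by rewrite gt_eqF// ltr_wpDr ?sqr_ge0 ?exprn_gt0.
  apply: cvgD; first exact: cvg_cst.
  by rewrite expr2; apply: cvgM; apply: cvgB; do ?[exact: cvg_id|exact: cvg_cst].
- move=> i y.
  by rewrite divr_ge0 ?addr_ge0 ?sqr_ge0// mulr_ge0// ltW.
Qed.

Lemma poisson_kernel_ge0 (R : realType) n (e : R) (x : 'rV[R]_n) : 0 < e ->
  0 <= poisson_kernel e x.
Proof.
move=> e0; apply: prodr_ge0 => i _.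
by rewrite divr_ge0 ?addr_ge0 ?sqr_ge0// mulr_ge0// ltW.
Qed.

Lemma poisson_kernelN (R : realType) n (e : R) (x : 'rV[R]_n) :
  poisson_kernel e (- x) = poisson_kernel e x.
Proof. by apply: eq_bigr => i _; rewrite mxE sqrrN. Qed.

Lemma measurable_poisson_kernel (R : realType) n (e : R) : 0 < e ->
  measurable_fun setT (@poisson_kernel R n e).
Proof.
move=> e0; apply: (measurable_prod_coord (f := fun=> fun y => 2 * e / (e ^+ 2 + y ^+ 2))).
move=> _; apply: continuous_measurable_fun => y.
apply: cvgM; first exact: cvg_cst.
apply: cvgV; first by rewrite gt_eqF// ltr_wpDr ?sqr_ge0 ?exprn_gt0.
apply: cvgD; first exact: cvg_cst.
by rewrite expr2; apply: cvgM; exact: cvg_id.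
Qed.

(** * Cosine and sine transforms of real functions *)

(** Plancherel is proved for real functions through these two real integrals; the complex transform
    is then assembled from those of the real and imaginary parts, at the price of a constant. *)
Definition cos_transform (R : realType) n (a : 'rV[R]_n -> R) (xi : 'rV[R]_n) : R :=
  \int[leb R n]_x (a x * cos (dotv x xi)).

Definition sin_transform (R : realType) n (a : 'rV[R]_n -> R) (xi : 'rV[R]_n) : R :=
  \int[leb R n]_x (a x * sin (dotv x xi)).

Lemma dotvC (R : realType) n (x y : 'rV[R]_n) : dotv x y = dotv y x.
Proof. by apply: eq_bigr => i _; rewrite mulrC. Qed.

Lemma dotvBl (R : realType) n (x y z : 'rV[R]_n) :
  dotv (x - y) z = dotv x z - dotv y z.
Proof.
by rewrite /dotv -sumrB; apply: eq_bigr => i _; rewrite !mxE mulrBl.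
Qed.

Lemma integrable_mul_bounded d (T : measurableType d) (R : realType)
    (mu : {measure set T -> \bar R}) (a g : T -> R) :
  mu.-integrable setT (fun x => (a x)%:E) -> measurable_fun setT g ->
  (forall x, `|g x| <= 1) -> mu.-integrable setT (fun x => (a x * g x)%:E).
Proof.
move=> ia mg g1; apply: (le_integrable measurableT _ _ ia).
  apply/measurable_EFinP; apply: measurable_funM => //.
  by case/integrableP : ia => /measurable_EFinP.
by move=> x _; rewrite /= lee_fin normrM ler_piMr.
Qed.

Lemma measurable_cos_dotv (R : realType) n (xi : 'rV[R]_n) :
  measurable_fun setT (fun x : 'rV[R]_n => cos (dotv x xi)).
Proof.
apply: measurableT_comp; first exact: measurable_cosT.
by apply: measurable_fun_dotv => //.
Qed.

Lemma measurable_sin_dotv (R : realType) n (xi : 'rV[R]_n) :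
  measurable_fun setT (fun x : 'rV[R]_n => sin (dotv x xi)).
Proof.
apply: measurableT_comp; first exact: measurable_sinT.
by apply: measurable_fun_dotv => //.
Qed.

Lemma normr_cos_le1 (R : realType) (x : R) : `|cos x| <= 1.
Proof. by rewrite ler_norml cos_geN1 cos_le1. Qed.

Lemma normr_sin_le1 (R : realType) (x : R) : `|sin x| <= 1.
Proof. by rewrite ler_norml sin_geN1 sin_le1. Qed.

Lemma integrable_prod_mul d d' (T : measurableType d) (T' : measurableType d')
    (R : realType) (m1 : {sigma_finite_measure set T -> \bar R})
    (m2 : {sigma_finite_measure set T' -> \bar R}) (f : T -> R) (g : T' -> R) :
  m1.-integrable setT (fun x => (f x)%:E) ->
  m2.-integrable setT (fun x => (g x)%:E) ->
  (m1 \x m2)%E.-integrable setT (fun z => (f z.1 * g z.2)%:E).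
Proof.
move=> fi gi.
have mf : measurable_fun setT f by case/integrableP : fi => /measurable_EFinP.
have mg : measurable_fun setT g by case/integrableP : gi => /measurable_EFinP.
apply/integrable12ltyP.
  apply/measurable_EFinP; apply: measurable_funM.
    exact: (measurableT_comp mf measurable_fst).
  exact: (measurableT_comp mg measurable_snd).
under eq_integral => x _.
  under eq_integral => y _ do rewrite /= normrM EFinM.
  rewrite ge0_integralZl//; last by apply/measurable_EFinP; exact: measurableT_comp.
  over.
rewrite ge0_integralZr//; last 2 first.
- by apply/measurable_EFinP; exact: measurableT_comp.
- by apply: integral_ge0.
rewrite lte_mul_pinfty//; last by case/integrableP : gi.
- exact: integral_ge0.
- by rewrite ge0_fin_numE; [case/integrableP : fi|exact: integral_ge0].
Qed.

(** Since cos(s - t) = cos s cos t + sin s sin t, the double integral is a sum of two integrals of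
    products, and Fubini makes each of them a square. *)
Lemma cos_sin_transform_sqr (R : realType) n (a : 'rV[R]_n -> R) (xi : 'rV[R]_n) :
  (leb R n).-integrable setT (fun x => (a x)%:E) ->
  (\int[@sigma_leb R n \x @sigma_leb R n]_z
     (a z.1 * a z.2 * cos (dotv (z.1 - z.2) xi))%:E)%E =
  (cos_transform a xi ^+ 2 + sin_transform a xi ^+ 2)%:E.
Proof.
move=> ia.
have ic : (@sigma_leb R n).-integrable setT (fun x => (a x * cos (dotv x xi))%:E).
  apply: integrable_mul_bounded => //; first exact: measurable_cos_dotv.
  by move=> x; exact: normr_cos_le1.
have is_ : (@sigma_leb R n).-integrable setT (fun x => (a x * sin (dotv x xi))%:E).
  apply: integrable_mul_bounded => //; first exact: measurable_sin_dotv.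
  by move=> x; exact: normr_sin_le1.
have icc := integrable_prod_mul ic ic.
have iss := integrable_prod_mul is_ is_.
under eq_integral => z _.
  rewrite (_ : _ * _ = (a z.1 * cos (dotv z.1 xi)) * (a z.2 * cos (dotv z.2 xi)) +
    (a z.1 * sin (dotv z.1 xi)) * (a z.2 * sin (dotv z.2 xi))); last first.
    by rewrite dotvBl cosB; ring.
  rewrite EFinD; over.
rewrite integralD// -(integral12_prod_meas1 icc) -(integral12_prod_meas1 iss).
rewrite /fubini_F /= EFinD; congr (_ + _)%E.
- under eq_integral => x _.
    under eq_integral => y _ do rewrite EFinM.
    rewrite integralZl// -(fineK (integrable_fin_num measurableT ic)); over.
  rewrite integralZr// -(fineK (integrable_fin_num measurableT ic)).
  by rewrite -EFinM -expr2.
- under eq_integral => x _.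
    under eq_integral => y _ do rewrite EFinM.
    rewrite integralZl// -(fineK (integrable_fin_num measurableT is_)); over.
  rewrite integralZr// -(fineK (integrable_fin_num measurableT is_)).
  by rewrite -EFinM -expr2.
Qed.

Lemma measurable_fun_sub_rV d (T : measurableType d) (R : realType) n
    (f g : T -> 'rV[R]_n) :
  measurable_fun setT f -> measurable_fun setT g ->
  measurable_fun setT (fun t => f t - g t).
Proof.
move=> mf mg; apply: measurable_rVP => i.
under eq_fun do rewrite !mxE.
apply: measurable_funB.
  exact: (measurableT_comp (measurable_coord i) mf).
exact: (measurableT_comp (measurable_coord i) mg).
Qed.

(* Schur's test for the positive kernel [poisson_kernel e (x - y)]. *)
Lemma schur_poisson_kernel (R : realType) n (e : R) (a : 'rV[R]_n -> R) :
  0 < e -> measurable_fun setT a ->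
  (\int[@sigma_leb R n \x @sigma_leb R n]_z
     (`|a z.1 * a z.2| * poisson_kernel e (z.1 - z.2))%:E <=
   ((2 * pi) ^+ n)%:E * \int[leb R n]_x (a x ^+ 2)%:E)%E.
Proof.
move=> e0 ma.
have K0 x : 0 <= @poisson_kernel R n e x by exact: poisson_kernel_ge0.
have mK : measurable_fun setT (fun z : 'rV[R]_n * 'rV[R]_n => poisson_kernel e (z.1 - z.2)).
  exact: (measurableT_comp (measurable_poisson_kernel e0)
    (measurable_fun_sub_rV measurable_fst measurable_snd)).
have ma1 : measurable_fun setT (fun z : 'rV[R]_n * 'rV[R]_n => a z.1).
  exact: (measurableT_comp ma measurable_fst).
have ma2 : measurable_fun setT (fun z : 'rV[R]_n * 'rV[R]_n => a z.2).
  exact: (measurableT_comp ma measurable_snd).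
have P0 (c k : R) : 0 <= k -> 0 <= 2^-1 * (c ^+ 2 * k).
  by move=> k0; apply: mulr_ge0 => //; apply: mulr_ge0 => //; exact: sqr_ge0.
(* As |a(x) a(y)| <= a(x)^2 / 2 + a(y)^2 / 2, the integral splits into two halves; in each, Tonelli
   integrates first in the variable on which [a] does not depend, where the kernel has mass at most
   (2 pi)^n. *)
pose h1 (z : 'rV[R]_n * 'rV[R]_n) := 2^-1 * (a z.1 ^+ 2 * poisson_kernel e (z.1 - z.2)).
pose h2 (z : 'rV[R]_n * 'rV[R]_n) := 2^-1 * (a z.2 ^+ 2 * poisson_kernel e (z.1 - z.2)).
have h10 z : (0 <= (h1 z)%:E)%E by rewrite lee_fin P0.
have h20 z : (0 <= (h2 z)%:E)%E by rewrite lee_fin P0.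
have mh1 : measurable_fun setT (EFin \o h1).
  apply/measurable_EFinP; apply: measurable_funM => //; apply: measurable_funM => //.
  exact: measurable_funX.
have mh2 : measurable_fun setT (EFin \o h2).
  apply/measurable_EFinP; apply: measurable_funM => //; apply: measurable_funM => //.
  exact: measurable_funX.
pose N := (\int[leb R n]_x (a x ^+ 2)%:E)%E.
have N0 : (0 <= N)%E by apply: integral_ge0 => x _; rewrite lee_fin sqr_ge0.
have half (h : 'rV[R]_n -> 'rV[R]_n -> R) :
    (forall x y, h x y = 2^-1 * (a x ^+ 2 * poisson_kernel e (y - x))) ->
    (\int[@sigma_leb R n]_x \int[@sigma_leb R n]_y (h x y)%:E <=
      (2^-1 * (2 * pi) ^+ n)%:E * N)%E.
  move=> hE.
  apply: (@le_trans _ _ (\int[leb R n]_x ((2^-1 * (2 * pi) ^+ n)%:E * (a x ^+ 2)%:E))%E); last first.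
    rewrite ge0_integralZl//.
    - by apply/measurable_EFinP; exact: measurable_funX.
    - by move=> x _; rewrite lee_fin sqr_ge0.
    - by rewrite lee_fin mulr_ge0// exprn_ge0// mulr_ge0// pi_ge0.
  have mKx x : measurable_fun setT (fun y : 'rV[R]_n => poisson_kernel e (y - x)).
    exact: (measurableT_comp (measurable_poisson_kernel e0)
      (measurable_fun_sub_rV (@measurable_id _ _ _) (measurable_cst x))).
  apply: ge0_le_integral => //.
  - move=> x _; apply: integral_ge0 => y _.
    by rewrite hE lee_fin P0.
  - apply: (measurable_fun_fubini_tonelli_F (m2 := @sigma_leb R n)
      (fun z => (h z.1 z.2)%:E)).
      apply/measurable_EFinP.
      under eq_fun do rewrite hE -poisson_kernelN opprB.
      exact/measurable_EFinP.
    by move=> z; rewrite hE lee_fin P0.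
  - apply/measurable_EFinP; apply: measurable_funM => //; exact: measurable_funX.
  move=> x _.
  under eq_integral do rewrite hE mulrA EFinM.
  rewrite ge0_integralZl//; last 3 first.
  - by apply/measurable_EFinP; exact: mKx.
  - by move=> y _; rewrite lee_fin.
  - by rewrite lee_fin mulr_ge0 ?sqr_ge0.
  have -> : ((2^-1 * (2 * pi) ^+ n)%:E * (a x ^+ 2)%:E)%E =
    ((2^-1 * a x ^+ 2)%:E * ((2 * pi) ^+ n)%:E)%E.
    by rewrite -!EFinM mulrAC.
  apply: lee_wpmul2l.
  - by rewrite lee_fin mulr_ge0 ?sqr_ge0.
  - exact: integral_poisson_kernel.
apply: (@le_trans _ _ (\int[@sigma_leb R n \x @sigma_leb R n]_z ((h1 z)%:E + (h2 z)%:E))%E).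
  apply: ge0_le_integral => //.
  - by move=> z _; rewrite lee_fin mulr_ge0.
  - apply/measurable_EFinP; apply: measurable_funM => //.
    by apply: measurableT_comp => //; exact: measurable_funM.
  - exact: emeasurable_funD.
  - move=> z _; rewrite -EFinD lee_fin /h1 /h2 -mulrDr -mulrDl mulrA ler_wpM2r//.
    rewrite normrM -(real_normK (num_real (a z.1))) -(real_normK (num_real (a z.2))).
    have := sqr_ge0 (`|a z.1| - `|a z.2|); lra.
rewrite ge0_integralD//.
have -> : ((2 * pi) ^+ n)%:E = ((2^-1 * (2 * pi) ^+ n)%:E + (2^-1 * (2 * pi) ^+ n)%:E)%E :> \bar R.
  by rewrite -EFinD; congr (_%:E); lra.
rewrite ge0_muleDl ?lee_fin ?mulr_ge0 ?exprn_ge0 ?mulr_ge0 ?pi_ge0//.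
apply: leeD.
  rewrite (fubini_tonelli1 (EFin \o h1))//=.
  apply: (half (fun x y => h1 (x, y))) => x y.
  by rewrite /h1 /= -poisson_kernelN opprB.
rewrite (fubini_tonelli2 (EFin \o h2))//=.
exact: (half (fun y x => h2 (x, y))).
Qed.

(* The library attaches to [m1 \x m2] only the instances for probabilities. *)
Lemma sigma_finite_product d d' (T : measurableType d) (T' : measurableType d')
    (R : realType) (m1 : {sigma_finite_measure set T -> \bar R})
    (m2 : {sigma_finite_measure set T' -> \bar R}) :
  sigma_finite setT (m1 \x m2)%E.
Proof.
have /sigma_finiteP[F [TF ndF Foo]] := sigma_finiteT m1.
have /sigma_finiteP[G [TG ndG Goo]] := sigma_finiteT m2.
exists (fun n => F n `*` G n).
  apply/seteqP; split => // -[x y] _.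
  have [i _ Fx] : (\bigcup_i F i) x by rewrite -TF.
  have [j _ Gy] : (\bigcup_i G i) y by rewrite -TG.
  exists (maxn i j) => //; split => /=.
    by move: x Fx; exact/subsetPset/ndF/leq_maxl.
  by move: y Gy; exact/subsetPset/ndG/leq_maxr.
move=> k; have [mF Fk] := Foo k; have [mG Gk] := Goo k.
split; first exact: measurableX.
by rewrite product_measure1E// lte_mul_pinfty// ge0_fin_numE.
Qed.

Definition sigma_product d d' (T : measurableType d) (T' : measurableType d')
    (R : realType) (m1 : {sigma_finite_measure set T -> \bar R})
    (m2 : {sigma_finite_measure set T' -> \bar R}) :
  set (T * T') -> \bar R := (m1 \x m2)%E.
HB.instance Definition _ d d' (T : measurableType d) (T' : measurableType d')
    (R : realType) (m1 : {sigma_finite_measure set T -> \bar R})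
    (m2 : {sigma_finite_measure set T' -> \bar R}) :=
  Measure.copy (sigma_product m1 m2) (m1 \x m2)%E.
HB.instance Definition _ d d' (T : measurableType d) (T' : measurableType d')
    (R : realType) (m1 : {sigma_finite_measure set T -> \bar R})
    (m2 : {sigma_finite_measure set T' -> \bar R}) :=
  Measure_isSigmaFinite.Build _ _ _ (sigma_product m1 m2)
    (sigma_finite_product m1 m2).

(** Thanks to the weight, exp_weight(xi) a(x) a(y) cos((x - y) . xi) is integrable in the three
    variables jointly. Fubini therefore allows integrating in xi before x and y, and this inner
    integral is the kernel at x - y. *)
Lemma weighted_plancherel (R : realType) n (e : R) (a : 'rV[R]_n -> R) :
  0 < e -> (leb R n).-integrable setT (fun x => (a x)%:E) ->
  (\int[leb R n]_xi (exp_weight e xi *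
      (cos_transform a xi ^+ 2 + sin_transform a xi ^+ 2))%:E <=
   ((2 * pi) ^+ n)%:E * \int[leb R n]_x (a x ^+ 2)%:E)%E.
Proof.
move=> e0 ia.
have ma : measurable_fun setT a by case/integrableP : ia => /measurable_EFinP.
pose m : {sigma_finite_measure set 'rV[R]_n -> \bar R} := @sigma_leb R n.
pose P : {sigma_finite_measure set ('rV[R]_n * 'rV[R]_n)%type -> \bar R} :=
  sigma_product m m.
pose F (w : 'rV[R]_n * ('rV[R]_n * 'rV[R]_n)) :=
  (exp_weight e w.1 * (a w.2.1 * a w.2.2)) * cos (dotv (w.2.1 - w.2.2) w.1).
have iaa := integrable_prod_mul (m1 := m) (m2 := m) ia ia.
have iwaa : (m \x P)%E.-integrable setT
    (fun w => (exp_weight e w.1 * (a w.2.1 * a w.2.2))%:E).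
  exact: (integrable_prod_mul (m1 := m) (m2 := P) (integrable_exp_weight n e0) iaa).
have iF : (m \x P)%E.-integrable setT (fun w => (F w)%:E).
  apply: integrable_mul_bounded => //; last by move=> w; exact: normr_cos_le1.
  apply: measurableT_comp; first exact: measurable_cosT.
  apply: measurable_fun_dotv; last exact: measurable_fst.
  apply: measurable_fun_sub_rV.
    exact: (measurableT_comp measurable_fst measurable_snd).
  exact: (measurableT_comp measurable_snd measurable_snd).
have intc z : P.-integrable setT
    (fun w => (a w.1 * a w.2 * cos (dotv (w.1 - w.2) z))%:E).
  apply: integrable_mul_bounded => //; last by move=> w; exact: normr_cos_le1.
  apply: measurableT_comp; first exact: measurable_cosT.
  apply: measurable_fun_dotv => //.
  exact: (measurable_fun_sub_rV measurable_fst measurable_snd).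
under eq_integral => xi _.
  rewrite EFinM -cos_sin_transform_sqr// -integralZl//.
  under eq_integral do rewrite -EFinM mulrA.
  over.
rewrite [leLHS](Fubini (m1 := m) (m2 := P) iF).
apply: le_trans (schur_poisson_kernel e0 ma).
apply: (@le_trans _ _ (\int[P]_z (a z.1 * a z.2 * poisson_kernel e (z.1 - z.2))%:E)%E).
  rewrite le_eqVlt; apply/orP; left; apply/eqP; apply: eq_integral => z _.
  under eq_integral => xi _.
    rewrite /F /= (mulrC (exp_weight e xi)) -mulrA EFinM; over.
  have iw : m.-integrable setT (fun xi => (exp_weight e xi * cos (dotv (z.1 - z.2) xi))%:E).
    apply: integrable_exp_weight_mul => //; last by move=> y; exact: normr_cos_le1.
    by apply: measurableT_comp; [exact: measurable_cosT|exact: measurable_dotv].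
  rewrite integralZl// -(fineK (integrable_fin_num measurableT iw)) -EFinM.
  by rewrite -[X in (_ * X)%:E]/(\int[leb R n]_y (exp_weight e y * cos (dotv (z.1 - z.2) y)))
    integral_exp_weight_cos.
have mK : measurable_fun setT (fun z : 'rV[R]_n * 'rV[R]_n => poisson_kernel e (z.1 - z.2)).
  exact: (measurableT_comp (measurable_poisson_kernel e0)
    (measurable_fun_sub_rV measurable_fst measurable_snd)).
have mG : measurable_fun setT (fun z : 'rV[R]_n * 'rV[R]_n => a z.1 * a z.2 * poisson_kernel e (z.1 - z.2)).
  apply: measurable_funM => //; case/integrableP : iaa => h _; exact/measurable_EFinP.
apply: (le_trans (lee_abs _)).
apply: (le_trans (le_abse_integral _ measurableT _)); first exact/measurable_EFinP.
rewrite le_eqVlt; apply/orP; left; apply/eqP; apply: eq_integral => z _.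
by rewrite /= normrM (ger0_norm (poisson_kernel_ge0 _ e0)).
Qed.

(** The integral is by definition the difference of the integrals of the positive and negative
    parts, and each of these is measurable in the parameter by Tonelli. *)
Lemma measurable_integral_param d d' (T : measurableType d) (T' : measurableType d')
    (R : realType) (m1 : {sigma_finite_measure set T -> \bar R})
    (f : T * T' -> \bar R) : measurable_fun setT f ->
  measurable_fun setT (fun y => \int[m1]_x f (x, y))%E.
Proof.
move=> mf.
rewrite (_ : (fun y => _) = (fun y => \int[m1]_x (f^\+)%E (x, y) -
    \int[m1]_x (f^\-)%E (x, y))%E); last first.
  apply/funext => y; rewrite [LHS]integralE.
  under eq_integral do rewrite (funepos_comp f (pair^~ y))/=.
  by under [X in (_ - X)%E = _]eq_integral do rewrite (funeneg_comp f (pair^~ y))/=.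
apply: emeasurable_funB.
  by apply: measurable_fun_fubini_tonelli_G => //; exact: measurable_funepos.
by apply: measurable_fun_fubini_tonelli_G => //; exact: measurable_funeneg.
Qed.

Lemma measurable_cos_sin_transform (R : realType) n (a : 'rV[R]_n -> R) :
  measurable_fun setT a ->
  measurable_fun setT (cos_transform a) /\ measurable_fun setT (sin_transform a).
Proof.
move=> ma.
suff H (g : R -> R) : measurable_fun setT g ->
    measurable_fun setT (fun xi => \int[leb R n]_x (a x * g (dotv x xi))).
  by split; apply: H; [exact: measurable_cosT|exact: measurable_sinT].
move=> mg; apply: (measurableT_comp (fine_measurable measurableT)).
apply: (measurable_integral_param (@sigma_leb R n)
  (f := fun w => (a w.1 * g (dotv w.1 w.2))%:E)).
apply/measurable_EFinP; apply: measurable_funM.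
  exact: (measurableT_comp ma measurable_fst).
exact: (measurableT_comp mg (measurable_fun_dotv measurable_fst measurable_snd)).
Qed.

Lemma exp_weight_cvg1 (R : realType) n (x : 'rV[R]_n) :
  exp_weight (k.+1%:R^-1) x @[k --> \oo] --> (1 : R).
Proof.
have -> : (fun k => exp_weight (k.+1%:R^-1) x) =
    (fun k => expR (- (\sum_i `|x 0 i|) * harmonic k)).
  apply/funext => k; rewrite /exp_weight -expR_sum; congr expR.
  by rewrite -mulr_sumr mulNr mulrC mulNr.
rewrite -(expR0 R); apply: continuous_cvg; first exact: continuous_expR.
set c := - _; rewrite -[X in _ --> X](mulr0 c).
by apply: cvgMr; exact: cvg_harmonic.
Qed.

Lemma exp_weight_le (R : realType) n (x : 'rV[R]_n) (e f : R) :
  e <= f -> exp_weight f x <= exp_weight e x.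
Proof.
move=> ef; apply: ler_prod => i _; rewrite expR_ge0 ler_expR !mulNr lerN2.
by rewrite ler_wpM2r.
Qed.

(** The right side of [weighted_plancherel] does not depend on e, and the weights with e = 1 / (k +
    1) increase to 1: monotone convergence removes them. *)
Lemma plancherel_le (R : realType) n (a : 'rV[R]_n -> R) :
  (leb R n).-integrable setT (fun x => (a x)%:E) ->
  (\int[leb R n]_xi (cos_transform a xi ^+ 2 + sin_transform a xi ^+ 2)%:E <=
   ((2 * pi) ^+ n)%:E * \int[leb R n]_x (a x ^+ 2)%:E)%E.
Proof.
move=> ia; have ma : measurable_fun setT a by case/integrableP : ia => /measurable_EFinP.
have [mc ms] := measurable_cos_sin_transform ma.
pose G xi := cos_transform a xi ^+ 2 + sin_transform a xi ^+ 2.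
have G0 xi : 0 <= G xi by rewrite addr_ge0 ?sqr_ge0.
have mG : measurable_fun setT G.
  by apply: measurable_funD; exact: measurable_funX.
pose g k xi := (exp_weight (k.+1%:R^-1) xi * G xi)%:E.
have := @cvg_monotone_convergence _ _ R (leb R n) setT measurableT g.
have -> : (\int[leb R n]_x limn (g^~ x) = \int[leb R n]_xi (G xi)%:E)%E.
  apply: eq_integral => xi _; apply/cvg_lim => //; apply: cvg_EFin.
    by near=> k.
  rewrite -[G xi in X in _ --> X]mul1r; apply: cvgMl; exact: exp_weight_cvg1.
move=> H; have {}H : (\int[leb R n]_x g k x)%E @[k --> \oo] --> (\int[leb R n]_xi (G xi)%:E)%E.
  apply: H => //.
  - move=> k; apply/measurable_EFinP; apply: measurable_funM => //.
    exact: measurable_exp_weight.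
  - by move=> k x _; rewrite lee_fin mulr_ge0// exp_weight_ge0.
  - move=> x _ k l kl; rewrite lee_fin ler_wpM2r// exp_weight_le//.
    by rewrite lef_pV2 ?posrE ?ltr0n// ler_nat.
apply: (@closed_cvg _ _ _ eventually_filter (fun k => \int[leb R n]_x g k x)%E
  [set z | (z <= ((2 * pi) ^+ n)%:E * \int[leb R n]_x (a x ^+ 2)%:E)%E] _ _ _ H).
  exact: closed_ereal_ge_ereal.
by near=> k; apply: weighted_plancherel => //; rewrite invr_gt0 ltr0n.
Unshelve. all: by end_near.
Qed.

Lemma integral_gauss_1d (R : realType) (k : R) : 0 < k ->
  (\int[lebesgue_measure]_y (expR (- k * y ^+ 2))%:E)%E = (Num.sqrt (pi / k))%:E.
Proof.
(* With variance 1 / (2 k) the normal density is a multiple of exp(-k y^2), and the multiple is read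
   off from its total mass 1. *)
move=> k0; pose s := Num.sqrt (2 * k)^-1.
have s0 : s != 0 by rewrite gt_eqF// sqrtr_gt0 invr_gt0 mulr_gt0.
have s2 : s ^+ 2 = (2 * k)^-1 by rewrite sqr_sqrtr// invr_ge0 mulr_ge0// ltW.
have := integral_normal_pdf 0 s; rewrite normal_pdfE// => h.
have p0 := normal_peak_gt0 s0.
move: h; under eq_integral do rewrite EFinM.
rewrite ge0_integralZl//; last 3 first.
- by apply/measurable_EFinP; exact: measurable_normal_fun.
- by move=> y _; rewrite lee_fin normal_fun_ge0.
- by rewrite lee_fin ltW.
have E : normal_fun 0 s = fun y => expR (- k * y ^+ 2).
  apply/funext => y; rewrite /normal_fun subr0 s2; congr expR; field.
  by rewrite gt_eqF.
rewrite E.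
set I := (\int[_]_x _)%E.
have P : (normal_peak s)^-1 = Num.sqrt (pi / k).
  rewrite /normal_peak invrK s2; congr Num.sqrt; field.
  by rewrite gt_eqF.
rewrite -P; case: I => [i||].
- rewrite -EFinM => -[] hi; congr (_%:E).
  by apply: (@mulfI _ (normal_peak s)); rewrite ?gt_eqF// hi divff// gt_eqF.
- by rewrite gt0_muley.
- by rewrite gt0_muleNy.
Qed.

(** * Gaussian weights and complex-valued functions *)

Definition gauss_weight (R : realType) n (k : R) (x : 'rV[R]_n) : R :=
  expR (- k * sqnorm x).

Lemma gauss_weightE (R : realType) n (k : R) (x : 'rV[R]_n) :
  gauss_weight k x = \prod_i expR (- k * x 0 i ^+ 2).
Proof.
rewrite /gauss_weight -expR_sum -mulr_sumr; congr (expR (_ * _)).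
Qed.

Lemma measurable_gauss_weight (R : realType) n (k : R) :
  measurable_fun setT (@gauss_weight R n k).
Proof.
apply: measurableT_comp => //; apply: measurable_funM => //.
exact: measurable_sqnorm.
Qed.

Lemma gauss_weight_ge0 (R : realType) n (k : R) (x : 'rV[R]_n) :
  0 <= gauss_weight k x.
Proof. exact: expR_ge0. Qed.

Lemma integral_gauss_weight (R : realType) n (k : R) : 0 < k ->
  (\int[leb R n]_x (gauss_weight k x)%:E)%E = (Num.sqrt (pi / k) ^+ n)%:E.
Proof.
move=> k0; under eq_integral do rewrite gauss_weightE.
rewrite (integral_prod_coord (f := fun=> fun y => expR (- k * y ^+ 2))).
- under eq_bigr do rewrite integral_gauss_1d//.
  by rewrite prodEFin prodr_const card_ord.
- by move=> _; apply: measurableT_comp => //; apply: measurable_funM.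
- by move=> _ x; exact: expR_ge0.
Qed.

Lemma integrable_gauss_weight (R : realType) n (k : R) : 0 < k ->
  (leb R n).-integrable setT (fun x => (gauss_weight k x)%:E).
Proof.
move=> k0; apply/integrableP; split.
  by apply/measurable_EFinP; exact: measurable_gauss_weight.
under eq_integral do rewrite /= ger0_norm ?gauss_weight_ge0//.
by rewrite integral_gauss_weight// ltry.
Qed.

Definition cmeasurable d (T : measurableType d) (R : realType) (f : T -> R[i]) :=
  measurable_fun setT (fun x => complex.Re (f x)) /\
  measurable_fun setT (fun x => complex.Im (f x)).

Definition sqnormc (R : realType) (z : R[i]) : R :=
  complex.Re z ^+ 2 + complex.Im z ^+ 2.

Section complex_lemmas.
Variable R : realType.
Implicit Types z w : R[i].

Lemma ReD z w : complex.Re (z + w) = complex.Re z + complex.Re w.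
Proof. by case: z w => a b [c d]. Qed.

Lemma ImD z w : complex.Im (z + w) = complex.Im z + complex.Im w.
Proof. by case: z w => a b [c d]. Qed.

Lemma ReN z : complex.Re (- z) = - complex.Re z.
Proof. by case: z. Qed.

Lemma ImN z : complex.Im (- z) = - complex.Im z.
Proof. by case: z. Qed.

Lemma ReM z w : complex.Re (z * w) =
  complex.Re z * complex.Re w - complex.Im z * complex.Im w.
Proof. by case: z w => a b [c d]. Qed.

Lemma ImM z w : complex.Im (z * w) =
  complex.Re z * complex.Im w + complex.Im z * complex.Re w.
Proof. by case: z w => a b [c d]. Qed.

Lemma ReV z : complex.Re z^-1 = complex.Re z / sqnormc z.
Proof. by case: z => a b. Qed.

Lemma ImV z : complex.Im z^-1 = - (complex.Im z / sqnormc z).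
Proof. by case: z. Qed.

Lemma sqnormc_ge0 z : 0 <= sqnormc z.
Proof. by rewrite addr_ge0 ?sqr_ge0. Qed.

Lemma normc_sqrt z : Normc.normc z = Num.sqrt (sqnormc z).
Proof. by case: z. Qed.

Lemma sqr_normc_sqnormc z : Normc.normc z ^+ 2 = sqnormc z.
Proof. by rewrite normc_sqrt sqr_sqrtr// sqnormc_ge0. Qed.

Lemma normc_ge0 z : 0 <= Normc.normc z.
Proof. by rewrite normc_sqrt sqrtr_ge0. Qed.

Lemma sqnormcM z w : sqnormc (z * w) = sqnormc z * sqnormc w.
Proof. by rewrite /sqnormc ReM ImM; ring. Qed.

Lemma sqnormcD z w : sqnormc (z + w) <= 2 * sqnormc z + 2 * sqnormc w.
Proof.
rewrite /sqnormc ReD ImD.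
have := sqr_ge0 (complex.Re z - complex.Re w).
have := sqr_ge0 (complex.Im z - complex.Im w).
by rewrite !sqrrB !sqrrD; lra.
Qed.

Lemma normr_Re z : `|complex.Re z| <= Normc.normc z.
Proof.
by rewrite normc_sqrt -sqrtr_sqr ler_wsqrtr// /sqnormc lerDl sqr_ge0.
Qed.

Lemma normr_Im z : `|complex.Im z| <= Normc.normc z.
Proof.
by rewrite normc_sqrt -sqrtr_sqr ler_wsqrtr// /sqnormc lerDr sqr_ge0.
Qed.

Lemma normc_le_ReIm z : Normc.normc z <= `|complex.Re z| + `|complex.Im z|.
Proof.
rewrite -(@ler_pXn2r _ 2) ?nnegrE ?normc_ge0 ?addr_ge0//.
rewrite sqr_normc_sqnormc /sqnormc sqrrD !real_normK ?num_real//.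
by rewrite lerD2r lerDl mulrn_wge0// mulr_ge0.
Qed.

Lemma normc_real (x : R) : Normc.normc x%:C = `|x|.
Proof. by rewrite /= expr0n/= addr0 sqrtr_sqr. Qed.

Section measurability.
Context d (T : measurableType d).
Implicit Types f g : T -> R[i].

Lemma cmeasurableD f g : cmeasurable f -> cmeasurable g ->
  cmeasurable (fun x => f x + g x).
Proof.
move=> [f1 f2] [g1 g2]; split.
  by under eq_fun do rewrite ReD; exact: measurable_funD.
by under eq_fun do rewrite ImD; exact: measurable_funD.
Qed.

Lemma cmeasurableN f : cmeasurable f -> cmeasurable (fun x => - f x).
Proof.
move=> [f1 f2]; split.
  by under eq_fun do rewrite ReN; exact: measurableT_comp.
by under eq_fun do rewrite ImN; exact: measurableT_comp.
Qed.

Lemma cmeasurableB f g : cmeasurable f -> cmeasurable g ->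
  cmeasurable (fun x => f x - g x).
Proof. by move=> mf mg; apply: cmeasurableD => //; exact: cmeasurableN. Qed.

Lemma cmeasurableM f g : cmeasurable f -> cmeasurable g ->
  cmeasurable (fun x => f x * g x).
Proof.
move=> [f1 f2] [g1 g2]; split.
  under eq_fun do rewrite ReM.
  by apply: measurable_funB; exact: measurable_funM.
under eq_fun do rewrite ImM.
by apply: measurable_funD; exact: measurable_funM.
Qed.

Lemma cmeasurable_cst (z : R[i]) : cmeasurable (fun _ : T => z).
Proof. by split. Qed.

Lemma cmeasurable_real (h : T -> R) : measurable_fun setT h ->
  cmeasurable (fun x => (h x)%:C).
Proof. by split. Qed.

Lemma measurable_sqnormc f : cmeasurable f ->
  measurable_fun setT (fun x => sqnormc (f x)).
Proof.
by move=> [f1 f2]; apply: measurable_funD; exact: measurable_funX.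
Qed.

Lemma measurable_sqrtT : measurable_fun [set: R] Num.sqrt.
Proof. by apply: continuous_measurable_fun; exact: sqrt_continuous. Qed.

Lemma measurable_normc f : cmeasurable f ->
  measurable_fun setT (fun x => Normc.normc (f x)).
Proof.
move=> mf; under eq_fun do rewrite normc_sqrt.
by apply: (measurableT_comp measurable_sqrtT); exact: measurable_sqnormc.
Qed.

(** Writing 1 / x as x times (x^2)^(-1) reduces to a real power of a nonnegative number; the
    identity also holds at 0, where the inverse is 0. *)
Lemma measurable_invT : measurable_fun [set: R] (fun x => x^-1).
Proof.
have -> : (fun x : R => x^-1) = (fun x => x * (x ^+ 2) `^ (-1)).
  apply/funext => x; rewrite powR_inv1 ?sqr_ge0//.
  have [->|x0] := eqVneq x 0; first by rewrite invr0 mul0r.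
  by field.
apply: measurable_funM => //.
by apply: (measurableT_comp (measurable_powR _)); exact: measurable_funX.
Qed.

Lemma cmeasurableV f : cmeasurable f -> cmeasurable (fun x => (f x)^-1).
Proof.
move=> mf; have m1 : measurable_fun setT (fun x => (sqnormc (f x))^-1).
  by apply: (measurableT_comp measurable_invT); exact: measurable_sqnormc.
case: mf => f1 f2; split.
  by under eq_fun do rewrite ReV; exact: measurable_funM.
under eq_fun do rewrite ImV -mulNr; apply: measurable_funM => //.
exact: measurableT_comp.
Qed.

Lemma cmeasurable_expc f : cmeasurable f -> cmeasurable (fun x => expc (f x)).
Proof.
move=> [f1 f2]; apply: cmeasurableM.
  by apply: cmeasurable_real; exact: measurableT_comp.
split.
  exact: (measurableT_comp (@measurable_cosT R) f2).
exact: (measurableT_comp (@measurable_sinT R) f2).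
Qed.

End measurability.
End complex_lemmas.

(** * Complex transforms: sup and square bounds *)

Definition cintegrable (R : realType) n (f : 'rV[R]_n -> R[i]) :=
  (leb R n).-integrable setT (fun x => (complex.Re (f x))%:E) /\
  (leb R n).-integrable setT (fun x => (complex.Im (f x))%:E).

Lemma cintegrable_cmeasurable (R : realType) n (f : 'rV[R]_n -> R[i]) :
  cintegrable f -> cmeasurable f.
Proof.
by move=> [/integrableP[/measurable_EFinP ? _] /integrableP[/measurable_EFinP ? _]].
Qed.

Lemma cintegrable_le (R : realType) n (f : 'rV[R]_n -> R[i]) (g : 'rV[R]_n -> R) :
  cmeasurable f -> (leb R n).-integrable setT (fun x => (g x)%:E) ->
  (forall x, Normc.normc (f x) <= g x) -> cintegrable f.
Proof.
move=> [mf1 mf2] ig fg; split; apply: (le_integrable measurableT _ _ ig).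
- exact/measurable_EFinP.
- move=> x _; rewrite /= lee_fin (le_trans (normr_Re _))// (le_trans (fg x))//.
  exact: ler_norm.
- exact/measurable_EFinP.
- move=> x _; rewrite /= lee_fin (le_trans (normr_Im _))// (le_trans (fg x))//.
  exact: ler_norm.
Qed.

Lemma integrable_normc (R : realType) n (f : 'rV[R]_n -> R[i]) :
  cintegrable f ->
  (leb R n).-integrable setT (fun x => (Normc.normc (f x))%:E).
Proof.
move=> cf; have mf := cintegrable_cmeasurable cf; case: cf => f1 f2.
apply: (@le_integrable _ _ _ _ _ measurableT _
  (fun x => (`|complex.Re (f x)|%:E + `|complex.Im (f x)|%:E)%E)).
- by apply/measurable_EFinP; exact: measurable_normc.
- move=> x _; rewrite -EFinD /= lee_fin (ger0_norm (normc_ge0 _)).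
  by rewrite [leRHS]ger0_norm ?addr_ge0// normc_le_ReIm.
- by apply: integrableD => //; exact: (integrable_abse (f := EFin \o _)).
Qed.

Definition l1norm (R : realType) n (f : 'rV[R]_n -> R[i]) : R :=
  \int[leb R n]_x Normc.normc (f x).

(** For integrable f this is the mean of |f^(xi)|^2 and |f^(-xi)|^2: the cross terms between real
    and imaginary parts cancel. It thus inherits Plancherel from real functions, and twice it bounds
    both the direct and, up to normalisation, the inverse transform. *)
Definition transform_sq (R : realType) n (f : 'rV[R]_n -> R[i]) (xi : 'rV[R]_n) : R :=
  (cos_transform (fun x => complex.Re (f x)) xi ^+ 2 +
   sin_transform (fun x => complex.Re (f x)) xi ^+ 2) +
  (cos_transform (fun x => complex.Im (f x)) xi ^+ 2 +
   sin_transform (fun x => complex.Im (f x)) xi ^+ 2).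

Lemma transform_sq_ge0 (R : realType) n (f : 'rV[R]_n -> R[i]) xi :
  0 <= transform_sq f xi.
Proof. by rewrite !addr_ge0 ?sqr_ge0. Qed.

Lemma measurable_transform_sq (R : realType) n (f : 'rV[R]_n -> R[i]) :
  cmeasurable f -> measurable_fun setT (transform_sq f).
Proof.
move=> [/measurable_cos_sin_transform[c1 s1] /measurable_cos_sin_transform[c2 s2]].
by apply: measurable_funD; apply: measurable_funD; exact: measurable_funX.
Qed.

Lemma integral_transform_sq (R : realType) n (f : 'rV[R]_n -> R[i]) :
  cintegrable f ->
  (\int[leb R n]_xi (transform_sq f xi)%:E <=
   ((2 * pi) ^+ n)%:E * \int[leb R n]_x (sqnormc (f x))%:E)%E.
Proof.
move=> cf; have [mf1 mf2] := cintegrable_cmeasurable cf; case: cf => f1 f2.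
have [c1 s1] := measurable_cos_sin_transform mf1.
have [c2 s2] := measurable_cos_sin_transform mf2.
under eq_integral do rewrite EFinD.
rewrite ge0_integralD//; last 4 first.
- by move=> x _; rewrite lee_fin addr_ge0 ?sqr_ge0.
- by apply/measurable_EFinP; apply: measurable_funD; exact: measurable_funX.
- by move=> x _; rewrite lee_fin addr_ge0 ?sqr_ge0.
- by apply/measurable_EFinP; apply: measurable_funD; exact: measurable_funX.
under [in leRHS]eq_integral do rewrite EFinD.
rewrite [in leRHS]ge0_integralD//; last 4 first.
- by move=> x _; rewrite lee_fin sqr_ge0.
- by apply/measurable_EFinP; exact: measurable_funX.
- by move=> x _; rewrite lee_fin sqr_ge0.
- by apply/measurable_EFinP; exact: measurable_funX.
rewrite ge0_muleDr; last 2 first.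
- by apply: integral_ge0 => x _; rewrite lee_fin sqr_ge0.
- by apply: integral_ge0 => x _; rewrite lee_fin sqr_ge0.
by apply: leeD; exact: plancherel_le.
Qed.

Lemma normr_transform_le (R : realType) n (a : 'rV[R]_n -> R) (f : 'rV[R]_n -> R[i])
    (g : 'rV[R]_n -> R) : cintegrable f -> measurable_fun setT a ->
  measurable_fun setT g ->
  (forall x, `|a x| <= Normc.normc (f x)) -> (forall x, `|g x| <= 1) ->
  `|\int[leb R n]_x (a x * g x)| <= l1norm f.
Proof.
move=> cf ma mg af g1.
have inf := integrable_normc cf.
have iag : (leb R n).-integrable setT (EFin \o (fun x => a x * g x)).
  apply: (le_integrable measurableT _ _ inf).
    by apply/measurable_EFinP; exact: measurable_funM.
  move=> x _; rewrite /= lee_fin normrM (ger0_norm (normc_ge0 _)).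
  by rewrite -[leRHS]mulr1 ler_pM.
apply: (le_trans (le_normr_Rintegral measurableT iag)).
apply: le_Rintegral => //; first exact: (integrable_abse iag).
move=> x _; rewrite normrM -[leRHS]mulr1 ler_pM//.
Qed.

Lemma transform_sq_le (R : realType) n (f : 'rV[R]_n -> R[i]) xi :
  cintegrable f -> transform_sq f xi <= 4 * l1norm f ^+ 2.
Proof.
move=> cf; have [mf1 mf2] := cintegrable_cmeasurable cf.
have sqle (c : R) : `|c| <= l1norm f -> c ^+ 2 <= l1norm f ^+ 2.
  by move=> h; rewrite -real_normK ?num_real// lerXn2r// nnegrE (le_trans _ h).
have H : 4 * l1norm f ^+ 2 = (l1norm f ^+ 2 + l1norm f ^+ 2) + (l1norm f ^+ 2 + l1norm f ^+ 2).
  ring.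
rewrite H; apply: lerD; apply: lerD; apply: sqle; apply: normr_transform_le => //.
all: try exact: measurable_cos_dotv.
all: try exact: measurable_sin_dotv.
all: move=> x; try exact: normr_Re; try exact: normr_Im.
all: try exact: normr_cos_le1.
all: exact: normr_sin_le1.
Qed.

Lemma expc_imag (R : realType) (y : R) : expc (0 +i* y) = cos y +i* sin y.
Proof. by rewrite /expc /= expR0 mul1r. Qed.

Lemma fourier_sqnormc_le (R : realType) n (f : 'rV[R]_n -> R[i]) xi :
  cintegrable f -> sqnormc (fourier f xi) <= 2 * transform_sq f xi.
Proof.
move=> cf; have [mf1 mf2] := cintegrable_cmeasurable cf; case: cf => f1 f2.
have ic g : (leb R n).-integrable setT (fun x => (g x)%:E) ->
    (leb R n).-integrable setT (EFin \o (fun x => g x * cos (dotv x xi))).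
  move=> ig; apply: integrable_mul_bounded => //.
    exact: measurable_cos_dotv.
  by move=> x; exact: normr_cos_le1.
have is_ g : (leb R n).-integrable setT (fun x => (g x)%:E) ->
    (leb R n).-integrable setT (EFin \o (fun x => g x * sin (dotv x xi))).
  move=> ig; apply: integrable_mul_bounded => //.
    exact: measurable_sin_dotv.
  by move=> x; exact: normr_sin_le1.
rewrite /sqnormc /fourier /cintegral /=.
rewrite (@eq_Rintegral _ _ _ _ _ (fun x => complex.Re (f x) * cos (dotv x xi) +
  complex.Im (f x) * sin (dotv x xi))); last first.
  by move=> x _; rewrite expc_imag ReM /= cosN sinN; ring.
rewrite (@eq_Rintegral _ _ _ _ _ (fun x => complex.Im (f x) * cos (dotv x xi) -
  complex.Re (f x) * sin (dotv x xi)) (fun x => complex.Im _)); last first.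
  by move=> x _; rewrite expc_imag ImM /= cosN sinN; ring.
rewrite RintegralD//; [|exact: ic|exact: is_].
rewrite RintegralB//; [|exact: ic|exact: is_].
rewrite /transform_sq -!/(cos_transform _ _) -!/(sin_transform _ _).
set A := cos_transform _ xi; set B := sin_transform _ xi.
set C := cos_transform _ xi; set D := sin_transform _ xi.
have := sqr_ge0 (A - B); have := sqr_ge0 (C + D); rewrite !sqrrB !sqrrD; lra.
Qed.

Lemma inv_fourier_sqnormc_le (R : realType) n (f : 'rV[R]_n -> R[i]) xi :
  cintegrable f ->
  sqnormc (inv_fourier f xi) <= 2 * ((pi *+ 2) ^- n) ^+ 2 * transform_sq f xi.
Proof.
move=> cf; have [mf1 mf2] := cintegrable_cmeasurable cf; case: cf => f1 f2.
have ic g : (leb R n).-integrable setT (fun x => (g x)%:E) ->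
    (leb R n).-integrable setT (EFin \o (fun x => g x * cos (dotv x xi))).
  move=> ig; apply: integrable_mul_bounded => //.
    exact: measurable_cos_dotv.
  by move=> x; exact: normr_cos_le1.
have is_ g : (leb R n).-integrable setT (fun x => (g x)%:E) ->
    (leb R n).-integrable setT (EFin \o (fun x => g x * sin (dotv x xi))).
  move=> ig; apply: integrable_mul_bounded => //.
    exact: measurable_sin_dotv.
  by move=> x; exact: normr_sin_le1.
rewrite /inv_fourier sqnormcM [X in X * _]/sqnormc /= expr0n/= addr0.
rewrite -mulrA mulrCA; apply: ler_wpM2l; first exact: sqr_ge0.
rewrite /sqnormc /cintegral /=.
rewrite (@eq_Rintegral _ _ _ _ _ (fun x => complex.Re (f x) * cos (dotv x xi) -
  complex.Im (f x) * sin (dotv x xi))); last first.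
  by move=> x _; rewrite dotvC expc_imag ReM /=; ring.
rewrite (@eq_Rintegral _ _ _ _ _ (fun x => complex.Im (f x) * cos (dotv x xi) +
  complex.Re (f x) * sin (dotv x xi)) (fun x => complex.Im _)); last first.
  by move=> x _; rewrite dotvC expc_imag ImM /=; ring.
rewrite RintegralB//; [|exact: ic|exact: is_].
rewrite RintegralD//; [|exact: ic|exact: is_].
rewrite /transform_sq -!/(cos_transform _ _) -!/(sin_transform _ _).
set A := cos_transform _ xi; set B := sin_transform _ xi.
set C := cos_transform _ xi; set D := sin_transform _ xi.
have := sqr_ge0 (A + B); have := sqr_ge0 (C - D); rewrite !sqrrB !sqrrD; lra.
Qed.

Lemma cos_transformD (R : realType) n (a b : 'rV[R]_n -> R) xi :
  (leb R n).-integrable setT (fun x => (a x)%:E) ->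
  (leb R n).-integrable setT (fun x => (b x)%:E) ->
  cos_transform (fun x => a x + b x) xi = cos_transform a xi + cos_transform b xi.
Proof.
have ic g : (leb R n).-integrable setT (fun x => (g x)%:E) ->
    (leb R n).-integrable setT (EFin \o (fun x => g x * cos (dotv x xi))).
  move=> ig; apply: integrable_mul_bounded => //; first exact: measurable_cos_dotv.
  by move=> x; exact: normr_cos_le1.
move=> ia ib; rewrite /cos_transform -RintegralD//; [|exact: ic|exact: ic].
by apply: eq_Rintegral => x _; rewrite mulrDl.
Qed.

Lemma sin_transformD (R : realType) n (a b : 'rV[R]_n -> R) xi :
  (leb R n).-integrable setT (fun x => (a x)%:E) ->
  (leb R n).-integrable setT (fun x => (b x)%:E) ->
  sin_transform (fun x => a x + b x) xi = sin_transform a xi + sin_transform b xi.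
Proof.
have ic g : (leb R n).-integrable setT (fun x => (g x)%:E) ->
    (leb R n).-integrable setT (EFin \o (fun x => g x * sin (dotv x xi))).
  move=> ig; apply: integrable_mul_bounded => //; first exact: measurable_sin_dotv.
  by move=> x; exact: normr_sin_le1.
move=> ia ib; rewrite /sin_transform -RintegralD//; [|exact: ic|exact: ic].
by apply: eq_Rintegral => x _; rewrite mulrDl.
Qed.

Lemma transform_sqD (R : realType) n (g h : 'rV[R]_n -> R[i]) xi :
  cintegrable g -> cintegrable h ->
  transform_sq (fun x => g x + h x) xi <= 2 * transform_sq g xi + 2 * transform_sq h xi.
Proof.
move=> [g1 g2] [h1 h2]; rewrite /transform_sq.
under eq_fun do rewrite ReD.
under [X in _ + (cos_transform X _ ^+ 2 + _)]eq_fun do rewrite ImD.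
under [X in _ + (_ + sin_transform X _ ^+ 2)]eq_fun do rewrite ImD.
rewrite !cos_transformD// !sin_transformD//.
have H (a b : R) : (a + b) ^+ 2 <= 2 * a ^+ 2 + 2 * b ^+ 2.
  by have := sqr_ge0 (a - b); rewrite sqrrB sqrrD; lra.
set A := cos_transform _ xi; set B := sin_transform _ xi.
set C := cos_transform _ xi; set D := sin_transform _ xi.
set A' := cos_transform _ xi; set B' := sin_transform _ xi.
set C' := cos_transform _ xi; set D' := sin_transform _ xi.
by have := H A C; have := H B D; have := H A' C'; have := H B' D'; lra.
Qed.

(** * Gaussian-weighted bound for the transform of an L^p function *)

Definition high_part (R : realType) n (L : R) (f : 'rV[R]_n -> R[i]) x : R[i] :=
  if L < Normc.normc (f x) then f x else 0.

Definition low_part (R : realType) n (L : R) (f : 'rV[R]_n -> R[i]) x : R[i] :=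
  if L < Normc.normc (f x) then 0 else f x.

Lemma high_low_part (R : realType) n (L : R) (f : 'rV[R]_n -> R[i]) :
  f = fun x => high_part L f x + low_part L f x.
Proof.
by apply/funext => x; rewrite /high_part /low_part; case: ifP; rewrite ?addr0 ?add0r.
Qed.

Lemma cmeasurable_high_low (R : realType) n (L : R) (f : 'rV[R]_n -> R[i]) :
  cmeasurable f -> cmeasurable (high_part L f) /\ cmeasurable (low_part L f).
Proof.
move=> mf; have mb : measurable_fun setT (fun x => L < Normc.normc (f x)).
  apply: measurable_fun_ltr => //; exact: measurable_normc.
case: mf => m1 m2; split; split.
- rewrite (_ : (fun x => _) = (fun x => if L < Normc.normc (f x) then complex.Re (f x) else 0)).
    exact: measurable_fun_ifT.
  by apply/funext => x; rewrite /high_part; case: ifP.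
- rewrite (_ : (fun x => _) = (fun x => if L < Normc.normc (f x) then complex.Im (f x) else 0)).
    exact: measurable_fun_ifT.
  by apply/funext => x; rewrite /high_part; case: ifP.
- rewrite (_ : (fun x => _) = (fun x => if L < Normc.normc (f x) then 0 else complex.Re (f x))).
    exact: measurable_fun_ifT.
  by apply/funext => x; rewrite /low_part; case: ifP.
- rewrite (_ : (fun x => _) = (fun x => if L < Normc.normc (f x) then 0 else complex.Im (f x))).
    exact: measurable_fun_ifT.
  by apply/funext => x; rewrite /low_part; case: ifP.
Qed.

Lemma normc_high_low_le (R : realType) n (L : R) (f : 'rV[R]_n -> R[i]) x :
  Normc.normc (high_part L f x) <= Normc.normc (f x) /\
  Normc.normc (low_part L f x) <= Normc.normc (f x).
Proof.
by rewrite /high_part /low_part; case: ifP => _; rewrite Normc.normc0 normc_ge0.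
Qed.

(** Where |f| > L, |f|^(1 - p) <= L^(1 - p) because p >= 1: the part above the height is integrable
    with a bound from the L^p norm. *)
Lemma high_part_le (R : realType) n (p L : R) (f : 'rV[R]_n -> R[i]) x :
  1 <= p -> 0 < L ->
  Normc.normc (high_part L f x) <= L `^ (1 - p) * Normc.normc (f x) `^ p.
Proof.
move=> p1 L0; rewrite /high_part; case: ifPn => [Ls|_]; last first.
  by rewrite Normc.normc0 mulr_ge0 ?powR_ge0.
have s0 : 0 < Normc.normc (f x) by exact: lt_trans Ls.
rewrite -{1}(powRr1 (ltW s0)) -{1}(subrK p 1) powRD; last by rewrite (gt_eqF s0) implybT.
rewrite ler_wpM2r ?powR_ge0//.
rewrite -(opprB p 1) !powRN lef_pV2 ?posrE ?powR_gt0//.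
by rewrite ge0_ler_powR ?nnegrE ?subr_ge0// ltW.
Qed.

(** Where |f| <= L, |f|^(2 - p) <= L^(2 - p) because p <= 2: the part below the height is
    square-integrable. *)
Lemma low_part_le (R : realType) n (p L : R) (f : 'rV[R]_n -> R[i]) x :
  p <= 2 -> 0 < p -> 0 < L ->
  sqnormc (low_part L f x) <= L `^ (2 - p) * Normc.normc (f x) `^ p.
Proof.
move=> p2 p0 L0; rewrite /low_part; case: ifPn => [_|].
  by rewrite /sqnormc/= expr0n/= addr0 mulr_ge0 ?powR_ge0.
rewrite -leNgt => sL; rewrite -sqr_normc_sqnormc.
have [->|s0] := eqVneq (Normc.normc (f x)) 0.
  by rewrite expr0n/= mulr_ge0 ?powR_ge0.
have {}s0 : 0 < Normc.normc (f x) by rewrite lt_neqAle eq_sym s0 normc_ge0.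
rewrite -(powR_mulrn 2 (ltW s0)) -{1}(subrK p 2%:R) powRD; last by rewrite (gt_eqF s0) implybT.
rewrite ler_wpM2r ?powR_ge0//.
by rewrite ge0_ler_powR ?nnegrE ?subr_ge0// ltW.
Qed.

Lemma sqrt_div_expn (R : realType) n (k : R) : 0 < k ->
  Num.sqrt (pi / k) ^+ n = Num.sqrt pi ^+ n * k `^ (- (n%:R / 2)).
Proof.
move=> k0; rewrite sqrtrM ?pi_ge0// exprMn; congr (_ * _).
have ki : 0 <= k^-1 by rewrite invr_ge0 ltW.
rewrite -(powR12_sqrt ki) -(powR_inv1 (ltW k0)) -powRrM.
by rewrite -powR_mulrn ?powR_ge0// -powRrM; congr (_ `^ _); field.
Qed.

Lemma cmeasurable_comp d d' (T : measurableType d) (T' : measurableType d')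
    (R : realType) (f : T' -> R[i]) (g : T -> T') :
  cmeasurable f -> measurable_fun setT g -> cmeasurable (fun x => f (g x)).
Proof.
move=> [f1 f2] mg; split.
  exact: (measurableT_comp f1 mg).
exact: (measurableT_comp f2 mg).
Qed.

Lemma cmeasurable_cintegral_param (R : realType) n m
    (f : 'rV[R]_n * 'rV[R]_m -> R[i]) : cmeasurable f ->
  cmeasurable (fun y => cintegral (fun x => f (x, y))).
Proof.
move=> [f1 f2]; split; apply: (measurableT_comp (fine_measurable measurableT)).
  apply: (measurable_integral_param (@sigma_leb R n) (f := fun w => (complex.Re (f w))%:E)).
  exact/measurable_EFinP.
apply: (measurable_integral_param (@sigma_leb R n) (f := fun w => (complex.Im (f w))%:E)).
exact/measurable_EFinP.
Qed.

Lemma cmeasurable_pair (R : realType) d (T : measurableType d) (f g : T -> R) :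
  measurable_fun setT f -> measurable_fun setT g ->
  cmeasurable (fun x => f x +i* g x).
Proof. by split. Qed.

Lemma cmeasurable_fourier (R : realType) n (f : 'rV[R]_n -> R[i]) :
  cmeasurable f -> cmeasurable (fourier f).
Proof.
move=> mf; apply: (cmeasurable_cintegral_param
  (f := fun w => expc (0 -i* dotv w.1 w.2) * f w.1)).
apply: cmeasurableM; last exact: (cmeasurable_comp mf measurable_fst).
apply: cmeasurable_expc; apply: cmeasurable_pair => //.
apply: measurableT_comp => //.
exact: (measurable_fun_dotv measurable_fst measurable_snd).
Qed.

Lemma cmeasurable_inv_fourier (R : realType) n (f : 'rV[R]_n -> R[i]) :
  cmeasurable f -> cmeasurable (inv_fourier f).
Proof.
move=> mf; apply: cmeasurableM; first exact: cmeasurable_cst.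
apply: (cmeasurable_cintegral_param
  (f := fun w => expc (0 +i* dotv w.2 w.1) * f w.1)).
apply: cmeasurableM; last exact: (cmeasurable_comp mf measurable_fst).
apply: cmeasurable_expc; apply: cmeasurable_pair => //.
exact: (measurable_fun_dotv measurable_snd measurable_fst).
Qed.

(** From |f^|^2 <= 4 T(high) + 4 T(low) with T = [transform_sq]: T(high) is at most 4 times the
    squared L^1 norm, against a Gaussian of mass pi^(n/2) k^(-n/2), and T(low) costs the Plancherel
    constant (2 pi)^n. *)
Definition gauss_const (R : realType) (n : nat) : R :=
  16 * Num.sqrt pi ^+ n + 4 * (2 * pi) ^+ n.

Lemma gauss_const_ge0 (R : realType) n : 0 <= gauss_const R n.
Proof.
by rewrite addr_ge0// mulr_ge0// exprn_ge0 ?sqrtr_ge0// mulr_ge0// pi_ge0.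
Qed.

(* The splitting height [L] balances the contributions of the L^1 and the L^2
   parts; this replaces the Hausdorff-Young inequality. *)
Lemma gauss_fourier_le (R : realType) n (p k M : R) (f : 'rV[R]_n -> R[i]) :
  1 <= p -> p <= 2 -> 0 < k -> 0 < M -> cintegrable f ->
  (\int[leb R n]_x (Normc.normc (f x) `^ p)%:E <= (M `^ p)%:E)%E ->
  (\int[leb R n]_xi (gauss_weight k xi * sqnormc (fourier f xi))%:E <=
   (gauss_const R n * (M ^+ 2 * k `^ (- (n%:R * (p^-1 - 2^-1)))))%:E)%E.
Proof.
move=> p1 p2 k0 M0 cf fM.
have p0 : 0 < p by lra.
(* The two contributions are L^(2 - 2p) M^(2p) k^(-n/2) and L^(2 - p) M^p. They agree when (M / L)^p
   = k^(n/2), and both are then equal to M^2 k^(-n (1/p - 1/2)). *)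
pose L := M * k `^ (- (n%:R / (2 * p))).
have L0 : 0 < L by rewrite mulr_gt0// powR_gt0.
have mf := cintegrable_cmeasurable cf.
have [mg mh] := cmeasurable_high_low L mf.
have inf := integrable_normc cf.
have cg : cintegrable (high_part L f).
  by apply: (cintegrable_le mg inf) => x; exact: (normc_high_low_le _ _ _).1.
have ch : cintegrable (low_part L f).
  by apply: (cintegrable_le mh inf) => x; exact: (normc_high_low_le _ _ _).2.
have msp : measurable_fun setT (fun x => (Normc.normc (f x) `^ p)%:E).
  apply/measurable_EFinP; apply: (measurableT_comp (measurable_powR p)).
  exact: measurable_normc.
have scale (c : R) : 0 <= c ->
    (\int[leb R n]_x (c * Normc.normc (f x) `^ p)%:E <= (c * M `^ p)%:E)%E.
  move=> c0; under eq_integral do rewrite EFinM.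
  rewrite ge0_integralZl//; last by move=> x _; rewrite lee_fin powR_ge0.
  by rewrite EFinM lee_wpmul2l.
have g1 : l1norm (high_part L f) <= L `^ (1 - p) * M `^ p.
  rewrite -lee_fin /l1norm /Rintegral fineK; last first.
    by apply: integrable_fin_num => //; exact: integrable_normc.
  apply: le_trans (scale _ (powR_ge0 _ _)); apply: ge0_le_integral => //.
  - by move=> x _; rewrite lee_fin normc_ge0.
  - by apply/measurable_EFinP; exact: measurable_normc.
  - by under eq_fun do rewrite EFinM; exact: measurable_funeM.
  - by move=> x _; rewrite lee_fin high_part_le.
have h2 : (\int[leb R n]_x (sqnormc (low_part L f x))%:E <= (L `^ (2 - p) * M `^ p)%:E)%E.
  apply: le_trans (scale _ (powR_ge0 _ _)); apply: ge0_le_integral => //.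
  - by move=> x _; rewrite lee_fin sqnormc_ge0.
  - by apply/measurable_EFinP; exact: measurable_sqnormc.
  - by under eq_fun do rewrite EFinM; exact: measurable_funeM.
  - by move=> x _; rewrite lee_fin low_part_le.
have g0 : 0 <= l1norm (high_part L f) by apply: Rintegral_ge0 => x _; exact: normc_ge0.
have mth := measurable_transform_sq mh.
have mfo : measurable_fun setT (fun xi => gauss_weight k xi * sqnormc (fourier f xi)).
  apply: measurable_funM; first exact: measurable_gauss_weight.
  by apply: measurable_sqnormc; exact: cmeasurable_fourier.
apply: (@le_trans _ _ (\int[leb R n]_xi ((16 * l1norm (high_part L f) ^+ 2)%:E * (gauss_weight k xi)%:E +
    4%:E * (transform_sq (low_part L f) xi)%:E))%E).
  apply: ge0_le_integral => //.
  - by move=> x _; rewrite lee_fin mulr_ge0 ?gauss_weight_ge0 ?sqnormc_ge0.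
  - exact/measurable_EFinP.
  - apply: emeasurable_funD; apply: measurable_funeM; apply/measurable_EFinP => //.
    exact: measurable_gauss_weight.
  - move=> x _; rewrite -!EFinM -EFinD lee_fin.
    have h1 := fourier_sqnormc_le x cf.
    have {}h1 : sqnormc (fourier f x) <= 2 * (2 * transform_sq (high_part L f) x +
        2 * transform_sq (low_part L f) x).
      apply: (le_trans h1); rewrite ler_wpM2l//.
      by rewrite {1}(high_low_part L f); exact: transform_sqD.
    have h3 := transform_sq_le x cg.
    have w0 := gauss_weight_ge0 k x.
    have w1 : gauss_weight k x <= 1.
      rewrite -expR0 ler_expR mulNr oppr_le0 mulr_ge0 ?(ltW k0)//.
      by apply: sumr_ge0 => i _; rewrite -expr2 sqr_ge0.
    have t0 := transform_sq_ge0 (low_part L f) x.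
    set w := gauss_weight k x in w0 w1 *.
    set th := transform_sq (low_part L f) x in t0 h1 *.
    apply: (le_trans (ler_wpM2l w0 h1)).
    have := ler_wpM2l w0 h3; have := ler_piMl t0 w1; nra.
rewrite ge0_integralD//; last 4 first.
- by move=> x _; rewrite -EFinM lee_fin mulr_ge0 ?gauss_weight_ge0// mulr_ge0 ?sqr_ge0.
- by apply: measurable_funeM; apply/measurable_EFinP; exact: measurable_gauss_weight.
- by move=> x _; rewrite -EFinM lee_fin mulr_ge0 ?transform_sq_ge0.
- by apply: measurable_funeM; apply/measurable_EFinP.
rewrite ge0_integralZl//; last 3 first.
- by apply/measurable_EFinP; exact: measurable_gauss_weight.
- by move=> x _; rewrite lee_fin gauss_weight_ge0.
- by rewrite lee_fin mulr_ge0 ?sqr_ge0.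
rewrite ge0_integralZl//; last 2 first.
- by apply/measurable_EFinP.
- by move=> x _; rewrite lee_fin transform_sq_ge0.
rewrite integral_gauss_weight// sqrt_div_expn// -EFinM.
have hT := integral_transform_sq ch.
have hT' : (4%:E * \int[leb R n]_x (transform_sq (low_part L f) x)%:E <=
   (4 * (2 * pi) ^+ n * (L `^ (2 - p) * M `^ p))%:E)%E.
  rewrite -mulrA (EFinM 4); apply: lee_wpmul2l => //; apply: (le_trans hT).
  rewrite EFinM; apply: lee_wpmul2l => //.
  by rewrite lee_fin exprn_ge0// mulr_ge0// pi_ge0.
apply: (le_trans (leeD (lexx _) hT')); rewrite -EFinD lee_fin.
set A := M ^+ 2 * _.
have E2 : L `^ (2 - p) * M `^ p = A.
  rewrite /L powRM ?powR_ge0 ?ltW// mulrAC -powRD; last by rewrite (gt_eqF M0) implybT.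
  rewrite subrK /A -(powR_mulrn 2 (ltW M0)) -powRrM; congr (_ * _ `^ _).
  by field; rewrite gt_eqF.
have E1 : (L `^ (1 - p) * M `^ p) ^+ 2 * k `^ (- (n%:R / 2)) = A.
  have -> : L `^ (1 - p) * M `^ p = M * (k `^ (- (n%:R / (2 * p)))) `^ (1 - p).
    rewrite /L powRM ?powR_ge0 ?ltW// mulrAC -powRD; last by rewrite (gt_eqF M0) implybT.
    by rewrite subrK (powRr1 (ltW M0)).
  rewrite exprMn -mulrA /A; congr (_ * _).
  rewrite -(powR_mulrn 2 (powR_ge0 _ _)) -!powRrM -powRD; last by rewrite (gt_eqF k0) implybT.
  by congr (_ `^ _); field; rewrite gt_eqF.
rewrite E2 /gauss_const [leRHS]mulrDl; apply: lerD => //; rewrite -[in leRHS]E1.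
set l := l1norm _; set X := k `^ _; set S := Num.sqrt pi ^+ n.
have -> : 16 * l ^+ 2 * (S * X) = 16 * S * (l ^+ 2 * X) by ring.
have S0 : 0 <= S by rewrite exprn_ge0 ?sqrtr_ge0.
apply: ler_wpM2l; first by rewrite mulr_ge0.
apply: ler_wpM2r; first exact: powR_ge0.
by rewrite lerXn2r ?nnegrE ?mulr_ge0 ?powR_ge0.
Qed.

(** * From integrable functions to L^p data *)

Lemma normcD_le (R : realType) (z w : R[i]) :
  Normc.normc (z + w) <= Normc.normc z + Normc.normc w.
Proof. exact: (@le_normcD R z w). Qed.

Lemma normc_opp (R : realType) (z : R[i]) : Normc.normc (- z) = Normc.normc z.
Proof. by rewrite !normc_sqrt /sqnormc ReN ImN !sqrrN. Qed.

Lemma sqnorm_ge0 (R : realType) n (x : 'rV[R]_n) : 0 <= sqnorm x.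
Proof. by apply: sumr_ge0 => i _; rewrite -expr2 sqr_ge0. Qed.

Lemma gauss_weight_le1 (R : realType) n (k : R) (x : 'rV[R]_n) :
  0 <= k -> gauss_weight k x <= 1.
Proof.
by move=> k0; rewrite -expR0 ler_expR mulNr oppr_le0 mulr_ge0// sqnorm_ge0.
Qed.

(** The norm at exponent +oo is an essential supremum only on a space of positive measure. *)
Lemma leb_setT_gt0 (R : realType) n : (0 < leb R n setT)%E.
Proof.
pose A := [set x : 'rV[R]_n | forall i, (`[0, 1]%classic : set R) (x 0 i)].
have A1 : leb R n A = 1%E.
  have -> := @leb_box R n (fun=> `[0, 1]%classic) (fun=> measurable_itv _).
  by rewrite big1// => i _; rewrite lebesgue_measure_itv/= lte_fin ltr01 oppr0 adde0.
apply: (@lt_le_trans _ _ (leb R n A)); first by rewrite A1 lte01.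
apply: le_measure; rewrite ?inE//.
rewrite (_ : A = \big[setI/setT]_(i < n)
    ((fun x : 'rV[R]_n => x 0 i : measurableTypeR R) @^-1` `[0, 1]%classic)).
  apply: bigsetI_measurable => i _; rewrite -[X in measurable X]setTI.
  exact: measurable_coord.
rewrite -bigcap_seq; apply/seteqP; split => [x Ax i _|x Ax i]; first exact: Ax.
by apply: (Ax i); rewrite /= mem_index_enum.
Qed.

Lemma cLnorm_ge0 (R : realType) n (q : \bar R) (f : 'rV[R]_n -> R[i]) :
  (0 <= cLnorm q f)%E.
Proof. exact: Lnorm_ge0. Qed.

Lemma cLnorm_powR (R : realType) n (p : R) (f : 'rV[R]_n -> R[i]) : 0 < p ->
  (cLnorm p%:E f `^ p = \int[leb R n]_x (Normc.normc (f x) `^ p)%:E)%E.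
Proof.
move=> p0; have := @poweR_Lnorm _ _ _ (leb R n) (fun x => (Normc.normc (f x))%:E) _ (lt0r_neq0 p0).
rewrite -/(cLnorm p%:E f) => ->; congr integral.
by apply/funext => x; rewrite abse_EFin ger0_norm ?normc_ge0// poweR_EFin.
Qed.

Lemma cLnorm_leP (R : realType) n (p M : R) (f : 'rV[R]_n -> R[i]) :
  0 < p -> 0 <= M ->
  (cLnorm p%:E f <= M%:E)%E <->
  (\int[leb R n]_x (Normc.normc (f x) `^ p)%:E <= (M `^ p)%:E)%E.
Proof.
move=> p0 M0; rewrite -cLnorm_powR//.
have := cLnorm_ge0 p%:E f; case: (cLnorm _ _) => [y| |].
- rewrite poweR_EFin !lee_fin => y0; split.
    by move=> yM; rewrite ge0_ler_powR ?nnegrE// ltW.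
  by apply: contraTT; rewrite -!ltNge => My; rewrite gt0_ltr_powR ?nnegrE.
- by move=> _; rewrite poweRE gt_eqF//= !leye_eq.
- by rewrite leNgt ltNyr.
Qed.

Lemma poweR_le_inv (R : realType) (p : R) (x y : \bar R) :
  0 < p -> (0 <= x)%E -> (0 <= y)%E -> (x `^ p <= y `^ p)%E -> (x <= y)%E.
Proof.
move=> p0; case: x => [x| |]; case: y => [y| |] //; rewrite ?leey//.
- rewrite !poweR_EFin !lee_fin => x0 y0.
  by apply: contraTT; rewrite -!ltNge => xy; rewrite gt0_ltr_powR ?nnegrE.
- by move=> _ _; rewrite poweRE gt_eqF//= poweR_EFin leye_eq.
Qed.

(** Minkowski's inequality for the real functions |f - g| and |f|, after the pointwise bound |g| <=
    |f - g| + |f|. *)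
Lemma cLnorm_le_normcD (R : realType) n (p : R) (f g : 'rV[R]_n -> R[i]) :
  1 <= p -> cmeasurable f -> cmeasurable g ->
  (cLnorm p%:E g <= cLnorm p%:E (fun x => f x - g x)%R + cLnorm p%:E f)%E.
Proof.
move=> p1 mf mg; have p0 : 0 < p by lra.
have mfg := cmeasurableB mf mg.
apply: (@le_trans _ _ (Lnorm (leb R n) p%:E (EFin \o
  ((fun x => Normc.normc (f x - g x)) \+ (fun x => Normc.normc (f x)))))).
  apply: (poweR_le_inv p0); [exact: Lnorm_ge0|exact: Lnorm_ge0|].
  rewrite cLnorm_powR//.
  have -> := @poweR_Lnorm _ _ _ (leb R n) (EFin \o
    ((fun x => Normc.normc (f x - g x)) \+ (fun x => Normc.normc (f x)))) _ (lt0r_neq0 p0).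
  apply: ge0_le_integral => //.
  - by move=> x _; rewrite lee_fin powR_ge0.
  - apply/measurable_EFinP; apply: (measurableT_comp (measurable_powR p)).
    exact: measurable_normc.
  - under eq_fun do rewrite abse_EFin poweR_EFin.
    apply/measurable_EFinP; apply: (measurableT_comp (measurable_powR p)).
    apply: measurableT_comp => //.
    by apply: measurable_funD; exact: measurable_normc.
  - move=> x _; rewrite abse_EFin poweR_EFin lee_fin.
    apply: ge0_ler_powR; rewrite ?nnegrE ?normc_ge0//; first exact: ltW.
    rewrite [leRHS]ger0_norm /=; last by rewrite addr_ge0 ?normc_ge0.
    rewrite -(normc_opp (f x - g x)) opprB.
    by apply: le_trans (normcD_le _ _); rewrite subrK.
by apply: minkowski_EFin => //; exact: measurable_normc.
Qed.

(** Smallness in L^s with s >= 2 implies smallness in the Gaussian-weighted L^2 norm. Where |h| <=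
    eta the Gaussian is integrable; where |h| > eta, |h|^2 <= eta^(2 - s) |h|^s. This controls the
    error between [v] and the transforms approximating it, which is small only in L^p'. *)
Lemma gauss_tail_le (R : realType) n (s : \bar R) (k eta : R) (h : 'rV[R]_n -> R[i]) :
  (2%:E <= s)%E -> 0 < k -> 0 < eta -> cmeasurable h ->
  (cLnorm s h <= eta%:E)%E ->
  (\int[leb R n]_xi (gauss_weight k xi * sqnormc (h xi))%:E <=
   (eta ^+ 2 * (Num.sqrt (pi / k) ^+ n + 1))%:E)%E.
Proof.
move=> s2 k0 eta0 mh.
have mw : measurable_fun setT (fun xi => (gauss_weight k xi * sqnormc (h xi))%:E).
  apply/measurable_EFinP; apply: measurable_funM.
    exact: measurable_gauss_weight.
  exact: measurable_sqnormc.
have mg := measurable_gauss_weight (n := n) k.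
have w0 (x : 'rV[R]_n) := gauss_weight_ge0 k x.
have w1 (x : 'rV[R]_n) : gauss_weight k x <= 1 by exact/gauss_weight_le1/ltW.
have me2 : measurable_fun setT (fun xi : 'rV[R]_n => ((eta ^+ 2)%:E * (gauss_weight k xi)%:E)%E).
  by apply: measurable_funeM; exact/measurable_EFinP.
case: s s2 => [s| |//]; last first.
  move=> _; rewrite /cLnorm unlock leb_setT_gt0 => /ess_supP he.
  apply: (@le_trans _ _ (\int[leb R n]_xi ((eta ^+ 2)%:E * (gauss_weight k xi)%:E))%E).
    apply: ae_ge0_le_integral => //.
    - by move=> x _; rewrite lee_fin mulr_ge0 ?sqnormc_ge0.
    - by move=> x _; rewrite -EFinM lee_fin mulr_ge0 ?sqr_ge0.
    - apply: filterS he => x hx _; rewrite -EFinM lee_fin mulrC ler_wpM2r//.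
      rewrite -sqr_normc_sqnormc; rewrite /= lee_fin ger0_norm ?normc_ge0// in hx.
      by rewrite lerXn2r ?nnegrE ?normc_ge0// ltW.
  rewrite ge0_integralZl//; last 3 first.
  - exact/measurable_EFinP.
  - by move=> x _; rewrite lee_fin.
  - by rewrite lee_fin sqr_ge0.
  rewrite integral_gauss_weight// -EFinM lee_fin ler_wpM2l ?sqr_ge0// lerDl//.
rewrite lee_fin => s2; have s0 : 0 < s by lra.
rewrite (cLnorm_leP _ s0 (ltW eta0)) => hs.
have ms : measurable_fun setT (fun xi => (Normc.normc (h xi) `^ s)%:E).
  apply/measurable_EFinP; apply: (measurableT_comp (measurable_powR s)).
  exact: measurable_normc.
have msc : measurable_fun setT (fun xi => ((eta `^ (2 - s))%:E * (Normc.normc (h xi) `^ s)%:E)%E).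
  exact: measurable_funeM.
have ee0 : 0 <= eta `^ (2 - s) by exact: powR_ge0.
apply: (@le_trans _ _ (\int[leb R n]_xi ((eta ^+ 2)%:E * (gauss_weight k xi)%:E +
    (eta `^ (2 - s))%:E * (Normc.normc (h xi) `^ s)%:E))%E).
  apply: ge0_le_integral => //.
  - by move=> x _; rewrite lee_fin mulr_ge0 ?sqnormc_ge0.
  - exact: emeasurable_funD.
  - move=> x _; rewrite -!EFinM -EFinD lee_fin -sqr_normc_sqnormc.
    have y0 := normc_ge0 (h x); set y := Normc.normc (h x) in y0 *.
    have [ye|ey] := leP y eta.
      apply: (@le_trans _ _ (eta ^+ 2 * gauss_weight k x)); last first.
        by rewrite lerDl mulr_ge0 ?powR_ge0.
      by rewrite mulrC ler_wpM2r// lerXn2r ?nnegrE// ltW.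
    have yp : 0 < y by exact: lt_trans ey.
    apply: (@le_trans _ _ (eta `^ (2 - s) * y `^ s)); last first.
      by rewrite lerDr mulr_ge0 ?sqr_ge0.
    apply: (@le_trans _ _ (y ^+ 2)); first by rewrite ler_piMl ?sqr_ge0.
    rewrite -(powR_mulrn 2 y0) -{1}(subrK s 2%:R) powRD; last by rewrite (gt_eqF yp) implybT.
    rewrite ler_wpM2r ?powR_ge0// -(opprB s) !powRN lef_pV2 ?posrE ?powR_gt0//.
    by apply: ge0_ler_powR; rewrite ?nnegrE ?subr_ge0// ltW.
rewrite ge0_integralD//; last 2 first.
- by move=> x _; rewrite -EFinM lee_fin mulr_ge0 ?sqr_ge0.
- by move=> x _; rewrite -EFinM lee_fin mulr_ge0 ?powR_ge0.
rewrite ge0_integralZl//; last 3 first.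
- exact/measurable_EFinP.
- by move=> x _; rewrite lee_fin.
- by rewrite lee_fin sqr_ge0.
rewrite ge0_integralZl//; last by move=> x _; rewrite lee_fin powR_ge0.
rewrite integral_gauss_weight// -EFinM mulrDr mulr1 EFinD; apply: leeD => //.
have -> : eta ^+ 2 = eta `^ (2 - s) * eta `^ s.
  rewrite -powRD; last by rewrite (gt_eqF eta0) implybT.
  by rewrite subrK -(powR_mulrn 2 (ltW eta0)).
by rewrite EFinM; apply: lee_wpmul2l.
Qed.

Lemma in_Lp_cmeasurable (R : realType) n q (f : 'rV[R]_n -> R[i]) :
  in_Lp q f -> cmeasurable f.
Proof. by case. Qed.

Lemma in_L1_cintegrable (R : realType) n (f : 'rV[R]_n -> R[i]) :
  in_Lp 1%E f -> cintegrable f.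
Proof.
move=> fL; have mf := in_Lp_cmeasurable fL; case: fL => _ _.
rewrite /cLnorm Lnorm1 => foo.
apply: (@cintegrable_le _ _ _ (fun x => Normc.normc (f x))) => //.
apply/integrableP; split => //.
by apply/measurable_EFinP; exact: measurable_normc.
Qed.

(** Passage to the limit in [gauss_fourier_le]: an approximant within eta of [u] has norm at most N
    + eta, its transform is within eta of [v] in L^p', and p' >= 2 (p' = +oo for p = 1). Working
    with N + eta also keeps the bound on the norm positive when u has norm 0. The factor 2 comes
    from |z + w|^2 <= 2 |z|^2 + 2 |w|^2. *)
Lemma is_fourier_gauss_le (R : realType) n (p k : R) (u v : 'rV[R]_n -> R[i]) :
  1 <= p -> p <= 2 -> 0 < k -> in_Lp p%:E u -> is_fourier p%:E u v ->
  (\int[leb R n]_xi (gauss_weight k xi * sqnormc (v xi))%:E <=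
   (2 * gauss_const R n * (fine (cLnorm p%:E u) ^+ 2 *
      k `^ (- (n%:R * (p^-1 - 2^-1)))))%:E)%E.
Proof.
move=> p1 p2 k0 uL [vL [F [FL Fu Fv]]].
have p0 : 0 < p by lra.
have mu := in_Lp_cmeasurable uL; have mv := in_Lp_cmeasurable vL.
pose W := Num.sqrt (pi / k) ^+ n + 1 : R.
pose N := fine (cLnorm p%:E u).
pose K := k `^ (- (n%:R * (p^-1 - 2^-1))).
have N0 : 0 <= N by rewrite fine_ge0// cLnorm_ge0.
have NE : cLnorm p%:E u = N%:E.
  by rewrite fineK// ge0_fin_numE ?cLnorm_ge0//; case: uL.
have s2 : (2%:E <= hoelder_conjugate p%:E)%E.
  have [->|pn1] := eqVneq p 1; first by rewrite hoelder_conjugate1 leey.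
  have p1' : 0 < p - 1 by rewrite subr_gt0 lt_neqAle eq_sym pn1.
  rewrite /hoelder_conjugate /= eqe gt_eqF// -EFinD inver gt_eqF// -EFinM lee_fin.
  by rewrite ler_pdivlMr//; lra.
have step (eta : R) : 0 < eta ->
    (\int[leb R n]_xi (gauss_weight k xi * sqnormc (v xi))%:E <=
    (2 * (gauss_const R n * ((N + eta) ^+ 2 * K)) + 2 * (eta ^+ 2 * W))%:E)%E.
  move=> eta0.
  have [j [hj1 hj2]] : exists j, (cLnorm p%:E (fun x => F j x - u x)%R <= eta%:E)%E /\
      (cLnorm (hoelder_conjugate p%:E) (fun xi => fourier (F j) xi - v xi)%R <= eta%:E)%E.
    have eta0' : (0 < eta%:E)%E by rewrite lte_fin.
    have e1 : \forall j \near \oo, (cLnorm p%:E (fun x => F j x - u x)%R <= eta%:E)%E.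
      have : nbhs (0 : \bar R) [set z | (z < eta%:E)%E].
        by apply: open_nbhs_nbhs; split => //; exact: open_ereal_lt_ereal.
      move=> /Fu h; have {}h : \forall j \near \oo, (cLnorm p%:E (fun x => F j x - u x)%R < eta%:E)%E by exact: h.
      by apply: filterS h => j; exact: ltW.
    have e2 : \forall j \near \oo, (cLnorm (hoelder_conjugate p%:E) (fun xi => fourier (F j) xi - v xi)%R <= eta%:E)%E.
      have : nbhs (0 : \bar R) [set z | (z < eta%:E)%E].
        by apply: open_nbhs_nbhs; split => //; exact: open_ereal_lt_ereal.
      move=> /Fv h; have {}h : \forall j \near \oo, (cLnorm (hoelder_conjugate p%:E) (fun xi => fourier (F j) xi - v xi)%R < eta%:E)%E by exact: h.
      by apply: filterS h => j; exact: ltW.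
    have [j _ hj] := filterI e1 e2.
    by exists j; have [] := hj j (leqnn j).
  have [Fj1 Fjp] := FL j.
  have cF := in_L1_cintegrable Fj1; have mF := cintegrable_cmeasurable cF.
  have mFF := cmeasurable_fourier mF.
  have b1 : (cLnorm p%:E (F j) <= (N + eta)%:E)%E.
    apply: (le_trans (cLnorm_le_normcD p1 mu mF)).
    rewrite NE (addrC N) EFinD; apply: leeD => //.
    apply: le_trans hj1; rewrite le_eqVlt; apply/orP; left; apply/eqP.
    by apply: eq_Lnorm => x; rewrite -normc_opp opprB.
  have Ne0 : 0 < N + eta by lra.
  have /cLnorm_leP := b1; move=> /(_ p0 (ltW Ne0)) b2.
  have c1 := gauss_fourier_le p1 p2 k0 Ne0 cF b2.
  have c2 := gauss_tail_le s2 k0 eta0 (cmeasurableB mFF mv) hj2.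
  have mw (h : 'rV[R]_n -> R[i]) : cmeasurable h ->
      measurable_fun setT (fun xi => (gauss_weight k xi * sqnormc (h xi))%:E).
    move=> mh; apply/measurable_EFinP; apply: measurable_funM.
      exact: measurable_gauss_weight.
    exact: measurable_sqnormc.
  have w0 (h : 'rV[R]_n -> R[i]) xi : (0 <= (gauss_weight k xi * sqnormc (h xi))%:E)%E.
    by rewrite lee_fin mulr_ge0 ?sqnormc_ge0 ?gauss_weight_ge0.
  apply: (@le_trans _ _ (\int[leb R n]_xi (2%:E * (gauss_weight k xi * sqnormc (fourier (F j) xi))%:E +
     2%:E * (gauss_weight k xi * sqnormc (fourier (F j) xi - v xi)%R)%:E))%E).
    apply: ge0_le_integral => //.
    - exact: mw.
    - by apply: emeasurable_funD; apply: measurable_funeM; apply: mw => //; exact: cmeasurableB.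
    - move=> x _; rewrite -!EFinM -EFinD lee_fin.
      rewrite mulrCA (mulrCA _ (gauss_weight k x)) -mulrDr ler_wpM2l ?gauss_weight_ge0//.
      have := sqnormcD (fourier (F j) x) (- (fourier (F j) x - v x)).
      rewrite opprB subrKC => h; apply: (le_trans h).
      by rewrite -opprB [X in _ + 2 * X]/sqnormc ReN ImN !sqrrN.
  rewrite ge0_integralD//; last 4 first.
  - by move=> x _; rewrite mule_ge0.
  - by apply: measurable_funeM; exact: mw.
  - by move=> x _; rewrite mule_ge0// (w0 (fun xi => fourier (F j) xi - v xi)).
  - by apply: measurable_funeM; apply: mw; exact: cmeasurableB.
  rewrite ge0_integralZl//; last exact: mw.
  rewrite ge0_integralZl//; [|by apply: mw; exact: cmeasurableB
    |by move=> x _; exact: (w0 (fun xi => fourier (F j) xi - v xi))].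
  by rewrite [leRHS]EFinD; apply: leeD; rewrite [leRHS]EFinM; apply: lee_wpmul2l.
(* The error eta runs through 1 / (j + 1); the left side of [step] does not depend on it. *)
have cv : (2 * (gauss_const R n * ((N + harmonic j) ^+ 2 * K)) +
    2 * (harmonic j ^+ 2 * W))%:E @[j --> \oo] -->
    (2 * gauss_const R n * (N ^+ 2 * K))%:E.
  apply: cvg_EFin; first by near=> j.
  rewrite (_ : 2 * _ * _ = 2 * (gauss_const R n * ((N + 0) ^+ 2 * K)) + 2 * (0 ^+ 2 * W)); last first.
    by ring.
  have ch := @cvg_harmonic R.
  apply: cvgD; apply: cvgMr.
    apply: cvgMr; apply: cvgMl.
    by rewrite expr2; apply: cvgM; apply: cvgD => //; exact: cvg_cst.
  by apply: cvgMl; rewrite expr2; exact: cvgM.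
apply: (@closed_cvg _ _ _ eventually_filter _
  [set z | (\int[leb R n]_xi (gauss_weight k xi * sqnormc (v xi))%:E <= z)%E] _ _ _ cv).
  exact: closed_ereal_le_ereal.
by near=> j; apply: step; exact: harmonic_gt0.
Unshelve. all: by end_near.
Qed.

(** * Gaussian-dominated multipliers *)

(** For finite q, |U|^q <= S^(q - 2) |U|^2. For q = +oo, where 1/q is 0, the right side is S, since
    the factor T^0 is 1. *)
Lemma cLnorm_interpolation (R : realType) n (q : \bar R) (S T : R)
    (U : 'rV[R]_n -> R[i]) :
  (2%:E <= q)%E -> 0 <= S -> 0 <= T -> cmeasurable U ->
  (forall x, Normc.normc (U x) <= S) ->
  (\int[leb R n]_x (sqnormc (U x))%:E <= (T ^+ 2)%:E)%E ->
  (cLnorm q U <=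
   (S `^ (1 - 2 * fine (q^-1)%E) * T `^ (2 * fine (q^-1)%E))%:E)%E.
Proof.
move=> q2 S0 T0 mU US UT; case: q q2 => [q| |//]; last first.
  move=> _; rewrite invey /= mulr0 subr0 powRr1// powRr0 mulr1.
  rewrite /cLnorm unlock leb_setT_gt0; apply/ess_supP; apply: aeW => x /=.
  by rewrite lee_fin ger0_norm ?normc_ge0.
rewrite lee_fin => q2; have q0 : 0 < q by lra.
rewrite inver gt_eqF//=; apply/cLnorm_leP => //.
  by rewrite mulr_ge0 ?powR_ge0.
rewrite powRM ?powR_ge0// -!powRrM.
have -> : (1 - 2 / q) * q = q - 2 by field; rewrite gt_eqF.
have -> : 2 / q * q = 2%:R by field; rewrite gt_eqF.
rewrite (powR_mulrn 2 T0).
apply: (@le_trans _ _ (\int[leb R n]_x ((S `^ (q - 2))%:E * (sqnormc (U x))%:E))%E).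
  apply: ge0_le_integral => //.
  - by move=> x _; rewrite lee_fin powR_ge0.
  - apply/measurable_EFinP; apply: (measurableT_comp (measurable_powR q)).
    exact: measurable_normc.
  - by apply: measurable_funeM; apply/measurable_EFinP; exact: measurable_sqnormc.
  - move=> x _; rewrite -EFinM lee_fin -sqr_normc_sqnormc.
    have y0 := normc_ge0 (U x).
    have -> : Normc.normc (U x) `^ q = Normc.normc (U x) `^ (q - 2) * Normc.normc (U x) ^+ 2.
      rewrite -(powR_mulrn 2 y0) -powRD ?subrK//; by rewrite gt_eqF.
    apply: ler_wpM2r; first exact: sqr_ge0.
    by apply: ge0_ler_powR; rewrite ?nnegrE ?subr_ge0.
rewrite ge0_integralZl//; last 3 first.
- by apply/measurable_EFinP; exact: measurable_sqnormc.
- by move=> x _; rewrite lee_fin sqnormc_ge0.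
- by rewrite lee_fin powR_ge0.
by rewrite EFinM; apply: lee_wpmul2l => //; rewrite lee_fin powR_ge0.
Qed.

(** One crude constant serving two bounds: with c = (2 pi)^(-n) and B = (2 pi)^n, the sup norm needs
    at most 3 c, as 8 c^2 <= (3 c)^2, and the L^2 norm needs the square root of 2 c^2 B. *)
Definition inv_const (R : realType) (n : nat) : R :=
  (pi *+ 2) ^- n * (3 + 2 * (1 + (2 * pi) ^+ n)).

Lemma twopi_gt0 (R : realType) : 0 < pi *+ 2 :> R.
Proof. by rewrite mulrn_wgt0// pi_gt0. Qed.

Lemma normc_inv_fourier_le (R : realType) n (m : 'rV[R]_n -> R[i]) x :
  cintegrable m -> Normc.normc (inv_fourier m x) <= inv_const R n * l1norm m.
Proof.
move=> cm.
have l0 : 0 <= l1norm m by apply: Rintegral_ge0 => y _; exact: normc_ge0.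
have c0 : 0 <= (pi *+ 2) ^- n :> R by rewrite invr_ge0 exprn_ge0// ltW// twopi_gt0.
apply: (@le_trans _ _ (3 * (pi *+ 2) ^- n * l1norm m)); last first.
  rewrite /inv_const ler_wpM2r// mulrC ler_wpM2l// lerDl mulr_ge0// addr_ge0//.
  by rewrite exprn_ge0// mulr_ge0// pi_ge0.
rewrite -(@ler_pXn2r _ 2) ?nnegrE ?normc_ge0 ?mulr_ge0//.
rewrite sqr_normc_sqnormc; apply: (le_trans (inv_fourier_sqnormc_le x cm)).
have h := transform_sq_le x cm.
rewrite !exprMn -[in leRHS]mulrA.
set c := ((pi *+ 2) ^- n) ^+ 2; have c20 : 0 <= c by exact: sqr_ge0.
apply: (@le_trans _ _ (2 * c * (4 * l1norm m ^+ 2))); first by rewrite ler_wpM2l// mulr_ge0.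
have := mulr_ge0 c20 (sqr_ge0 (l1norm m)); lra.
Qed.

Lemma integral_inv_fourier_sqnormc (R : realType) n (m : 'rV[R]_n -> R[i]) (Y : R) :
  0 <= Y -> cintegrable m ->
  (\int[leb R n]_x (sqnormc (m x))%:E <= (Y ^+ 2)%:E)%E ->
  (\int[leb R n]_x (sqnormc (inv_fourier m x))%:E <= ((inv_const R n * Y) ^+ 2)%:E)%E.
Proof.
move=> Y0 cm mY.
pose c : R := (pi *+ 2) ^- n.
have c0 : 0 <= c by rewrite invr_ge0 exprn_ge0// ltW// twopi_gt0.
have mm := cintegrable_cmeasurable cm.
apply: (@le_trans _ _ (\int[leb R n]_x ((2 * c ^+ 2)%:E * (transform_sq m x)%:E))%E).
  apply: ge0_le_integral => //.
  - by move=> x _; rewrite lee_fin sqnormc_ge0.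
  - apply/measurable_EFinP; apply: measurable_sqnormc.
    exact: cmeasurable_inv_fourier.
  - by apply: measurable_funeM; apply/measurable_EFinP; exact: measurable_transform_sq.
  - by move=> x _; rewrite -EFinM lee_fin inv_fourier_sqnormc_le.
have c20 : 0 <= 2 * c ^+ 2 by rewrite mulr_ge0 ?sqr_ge0.
rewrite ge0_integralZl//; last 2 first.
- by apply/measurable_EFinP; exact: measurable_transform_sq.
- by move=> x _; rewrite lee_fin transform_sq_ge0.
set B := (2 * pi) ^+ n : R.
have B0 : 0 <= B by rewrite exprn_ge0// mulr_ge0// pi_ge0.
apply: (@le_trans _ _ ((2 * c ^+ 2)%:E * (B * Y ^+ 2)%:E)%E).
  apply: lee_wpmul2l => //; apply: (le_trans (integral_transform_sq cm)).
  by rewrite EFinM; apply: lee_wpmul2l.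
rewrite -EFinM lee_fin /inv_const -/c -/B !exprMn mulrA ler_wpM2r ?sqr_ge0//.
have -> : 2 * c ^+ 2 * B = c ^+ 2 * (2 * B) by ring.
apply: ler_wpM2l; first exact: sqr_ge0.
nra.
Qed.

(* Bounds [\int gauss_weight k * Z] by Cauchy-Schwarz in the form of
   [2 Z <= L + Z ^ 2 / L]. *)
Lemma gauss_weight_cauchy_schwarz (R : realType) n (k Y : R) (Z : 'rV[R]_n -> R) :
  0 < k -> 0 <= Y -> measurable_fun setT Z ->
  (\int[leb R n]_x (gauss_weight k x * Z x ^+ 2)%:E <= (Y ^+ 2)%:E)%E ->
  (\int[leb R n]_x (gauss_weight k x * `|Z x|)%:E <=
   (Y * Num.sqrt (Num.sqrt (pi / k) ^+ n))%:E)%E.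
Proof.
move=> k0 Y0 mZ hZ; pose G := Num.sqrt (Num.sqrt (pi / k) ^+ n).
have pk : 0 < pi / k by rewrite divr_gt0// pi_gt0.
have G0 : 0 < G by rewrite sqrtr_gt0 exprn_gt0// sqrtr_gt0.
have G2 : Num.sqrt (pi / k) ^+ n = G ^+ 2 by rewrite sqr_sqrtr// exprn_ge0// sqrtr_ge0.
have w0 (x : 'rV[R]_n) := gauss_weight_ge0 k x.
have mw := measurable_gauss_weight (n := n) k.
(* [V] is a positive substitute for [Y], which may be 0: the inequality is used with L = V / G, and
   at the end V = Y + e / G with e tending to 0. *)
have step (V : R) : 0 < V -> Y <= V ->
    (\int[leb R n]_x (gauss_weight k x * `|Z x|)%:E <= (V * G)%:E)%E.
  move=> V0 YV; have VG0 : 0 < V / G by rewrite divr_gt0.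
  apply: (@le_trans _ _ (\int[leb R n]_x ((2^-1 * (V / G))%:E * (gauss_weight k x)%:E +
     (2^-1 * (G / V))%:E * (gauss_weight k x * Z x ^+ 2)%:E))%E).
    apply: ge0_le_integral => //.
    - by move=> x _; rewrite lee_fin mulr_ge0.
    - by apply/measurable_EFinP; apply: measurable_funM => //; exact: measurableT_comp.
    - apply: emeasurable_funD; apply: measurable_funeM; apply/measurable_EFinP => //.
      by apply: measurable_funM => //; exact: measurable_funX.
    - move=> x _; rewrite -!EFinM -EFinD lee_fin.
      have -> : 2^-1 * (V / G) * gauss_weight k x +
          2^-1 * (G / V) * (gauss_weight k x * Z x ^+ 2) =
          gauss_weight k x * (2^-1 * (V / G) + 2^-1 * (G / V) * Z x ^+ 2) by ring.
      apply: ler_wpM2l => //.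
      have := sqr_ge0 (`|Z x| - V / G); rewrite sqrrB real_normK ?num_real// => h.
      rewrite -(@ler_pM2l _ (V / G))//.
      have -> : V / G * (2^-1 * (V / G) + 2^-1 * (G / V) * Z x ^+ 2) =
        2^-1 * (V / G) ^+ 2 + 2^-1 * Z x ^+ 2.
        by field; rewrite !gt_eqF.
      lra.
  rewrite ge0_integralD//; last 4 first.
  - by move=> x _; rewrite -EFinM lee_fin mulr_ge0// mulr_ge0// ltW.
  - by apply: measurable_funeM; exact/measurable_EFinP.
  - move=> x _; rewrite -EFinM lee_fin; apply: mulr_ge0.
      by rewrite mulr_ge0// ltW// divr_gt0.
    by rewrite mulr_ge0 ?sqr_ge0.
  - by apply: measurable_funeM; apply/measurable_EFinP;
      apply: measurable_funM => //; exact: measurable_funX.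
  rewrite ge0_integralZl//; last 3 first.
  - exact/measurable_EFinP.
  - by move=> x _; rewrite lee_fin.
  - by rewrite lee_fin mulr_ge0// ltW.
  rewrite ge0_integralZl//; last 3 first.
  - by apply/measurable_EFinP; apply: measurable_funM => //; exact: measurable_funX.
  - by move=> x _; rewrite lee_fin mulr_ge0 ?sqr_ge0.
  - by rewrite lee_fin mulr_ge0// ltW// divr_gt0.
  rewrite integral_gauss_weight// G2 -EFinM.
  have -> : V * G = 2^-1 * (V / G) * G ^+ 2 + 2^-1 * (G / V) * V ^+ 2.
    by field; rewrite !gt_eqF.
  rewrite [leRHS]EFinD; apply: leeD => //; rewrite [leRHS]EFinM; apply: lee_wpmul2l.
    by rewrite lee_fin mulr_ge0// ltW// divr_gt0.
  by apply: (le_trans hZ); rewrite lee_fin lerXn2r ?nnegrE// ltW.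
apply/lee_addgt0Pr => e e0.
have V0 : 0 < Y + e / G by rewrite ltr_wpDl// divr_gt0.
apply: (le_trans (step _ V0 _)); first by rewrite lerDl ltW// divr_gt0.
by rewrite -/G mulrDl -EFinD lee_fin divfK// gt_eqF.
Qed.

(** A single weighted bound on [Z] gives both norms of [m]: the L^1 norm is at most Y G^(1/2), where
    G is the mass of the Gaussian, and the L^2 norm is at most Y because the Gaussian is at most 1.
    Interpolating the inverse transform between sup and L^2 leaves the power 1/2 - 1/q of G. *)
Lemma multiplier_le (R : realType) n (q : \bar R) (k Y : R)
    (m : 'rV[R]_n -> R[i]) (Z : 'rV[R]_n -> R) :
  (2%:E <= q)%E -> 0 < k -> 0 <= Y -> cmeasurable m -> measurable_fun setT Z ->
  (forall x, 0 <= Z x) ->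
  (forall x, Normc.normc (m x) <= gauss_weight k x * Z x) ->
  (\int[leb R n]_x (gauss_weight k x * Z x ^+ 2)%:E <= (Y ^+ 2)%:E)%E ->
  cintegrable m /\
  (cLnorm q (inv_fourier m) <=
   (inv_const R n * Y * (Num.sqrt (pi / k) ^+ n) `^ (2^-1 - fine (q^-1)%E))%:E)%E.
Proof.
move=> q2 k0 Y0 mm mZ Z0 mZle hZ.
have w0 (x : 'rV[R]_n) := gauss_weight_ge0 k x.
have mw := measurable_gauss_weight (n := n) k.
have l1 := gauss_weight_cauchy_schwarz k0 Y0 mZ hZ.
have cm : cintegrable m.
  apply: (cintegrable_le mm _ mZle); apply/integrableP; split.
    by apply/measurable_EFinP; exact: measurable_funM.
  apply: (@le_lt_trans _ _ _ _ _ _ (ltry _)); apply: le_trans l1.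
  rewrite le_eqVlt; apply/orP; left; apply/eqP; apply: eq_integral => x _.
  by rewrite /= normrM (ger0_norm (w0 x)).
split=> //.
pose G := Num.sqrt (pi / k) ^+ n : R.
have G0 : 0 <= G by rewrite exprn_ge0// sqrtr_ge0.
have iY : l1norm m <= Y * Num.sqrt G.
  rewrite -lee_fin; apply: le_trans l1; rewrite /l1norm /Rintegral fineK; last first.
    by apply: integrable_fin_num => //; exact: integrable_normc.
  apply: ge0_le_integral => //.
  - by move=> x _; rewrite lee_fin normc_ge0.
  - by apply/measurable_EFinP; exact: measurable_normc.
  - apply/measurable_EFinP; apply: measurable_funM => //; exact: measurableT_comp.
  - by move=> x _; rewrite lee_fin ger0_norm.
have i2 : (\int[leb R n]_x (sqnormc (m x))%:E <= (Y ^+ 2)%:E)%E.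
  apply: le_trans hZ; apply: ge0_le_integral => //.
  - by move=> x _; rewrite lee_fin sqnormc_ge0.
  - by apply/measurable_EFinP; exact: measurable_sqnormc.
  - by apply/measurable_EFinP; apply: measurable_funM => //; exact: measurable_funX.
  - move=> x _; rewrite lee_fin -sqr_normc_sqnormc.
    apply: (@le_trans _ _ ((gauss_weight k x * Z x) ^+ 2)).
      by rewrite lerXn2r ?nnegrE ?normc_ge0// mulr_ge0.
    rewrite exprMn ler_wpM2r ?sqr_ge0// expr2 ler_piMl//.
    by apply: gauss_weight_le1; exact: ltW.
have c0 : 0 <= inv_const R n.
  rewrite /inv_const mulr_ge0 ?invr_ge0 ?exprn_ge0 ?(ltW (twopi_gt0 R))//.
  by rewrite addr_ge0// mulr_ge0// addr_ge0// exprn_ge0// mulr_ge0// pi_ge0.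
have S0 : 0 <= inv_const R n * Y by rewrite mulr_ge0.
have := @cLnorm_interpolation _ n q (inv_const R n * Y * Num.sqrt G) (inv_const R n * Y)
  (inv_fourier m) q2 _ S0 (cmeasurable_inv_fourier mm) _
  (integral_inv_fourier_sqnormc Y0 cm i2).
move=> H; apply: (le_trans (H _ _)).
- by rewrite mulr_ge0 ?sqrtr_ge0.
- move=> x; apply: (le_trans (normc_inv_fourier_le x cm)).
  by rewrite -mulrA ler_wpM2l.
rewrite lee_fin powRM ?sqrtr_ge0// mulrAC -powR12_sqrt// -powRrM.
have -> : 2^-1 * (1 - 2 * fine (q^-1)%E) = 2^-1 - fine (q^-1)%E by field.
rewrite ler_wpM2r ?powR_ge0//.
(* When the base is 0 exponents cannot be added, since 0^0 is 1; the exponents 2/q = 0 and 2/q != 0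
   are then treated apart. *)
have [->|s0] := eqVneq (inv_const R n * Y) 0.
  have [->|f0] := eqVneq (2 * fine (q^-1)%E) 0.
    by rewrite subr0 powR0 ?mul0r.
  by rewrite (powR0 f0) mulr0.
by rewrite -powRD ?subrK ?powRr1// (negbTE s0) implybT.
Qed.

(** * Decay of the Green function on the cone *)

Lemma is_derive_le0_le (R : realType) (f df : R -> R) (t : R) : 0 <= t ->
  (forall s : R, is_derive s 1 f (df s)) -> (forall s, 0 <= s -> df s <= 0) ->
  f t <= f 0.
Proof.
move=> t0 fdf df0.
have h1 s : s \in `]0, t[ -> is_derive s 1 f (df s) by move=> _; exact: fdf.
have h2 : {within `[0, t], continuous f}.
  by apply: derivable_within_continuous => s _; case: (fdf s).
have [s] := MVT_segment t0 h1 h2; rewrite in_itv/= => /andP[s0 _] E.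
by rewrite -subr_le0 E subr0; have := df0 s s0; nra.
Qed.

(** A quarter of eps = 1 / (1 + r^2), the coefficient of the cross term in the Lyapunov function.
    This eps satisfies eps r <= 1/2, which keeps that function comparable to the energy, and eps (1
    + r^2) = 1, which closes the dissipation estimate. *)
Definition energy_rate (R : realType) (r : R) : R := ((1 + r ^+ 2) *+ 4)^-1.

Lemma damped_energy_le (R : realType) (r rho w : R) (y y' : R -> R) (t : R) :
  0 < r -> 0 <= rho -> 0 <= w -> rho <= r * w -> 0 <= t ->
  (forall s : R, is_derive s 1 y (y' s)) ->
  (forall s : R, is_derive s 1 y' (- (rho * y' s + w ^+ 2 * y s))) ->
  y' t ^+ 2 + w ^+ 2 * y t ^+ 2 <=
  2 * (y' 0 ^+ 2 + w ^+ 2 * y 0 ^+ 2) * expR (- energy_rate r * rho * t).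
Proof.
move=> r0 rho0 w0 rw t0 dy dy'.
(* Lyapunov function [V]: [rho <= r * w] makes the cross term comparable to the
   energy, and its derivative supplies the missing dissipation of [y ^+ 2]. *)
pose e := energy_rate r *+ 4; pose c := energy_rate r.
have e1 : e * (1 + r ^+ 2) = 1.
  rewrite /e /energy_rate; field; rewrite gt_eqF//; have := sqr_ge0 r; lra.
have e0 : 0 < e.
  by rewrite /e /energy_rate pmulrn_lgt0// invr_gt0 pmulrn_lgt0// ltr_pwDl ?sqr_ge0.
have c0 : c = e / 4 by rewrite /e /c; field.
pose V s := y' s ^+ 2 + w ^+ 2 * y s ^+ 2 + e * rho * (y s * y' s).
pose W s := V s * expR (c * rho * s).
pose dV s := - 2 * rho * y' s ^+ 2 + e * rho * (y' s ^+ 2 - rho * y s * y' s - w ^+ 2 * y s ^+ 2).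
have cross s : `|rho * y s * y' s| <= r * (w * `|y s|) * `|y' s|.
  rewrite !normrM (ger0_norm rho0) ler_wpM2r// mulrA ler_wpM2r//.
have er : e * r <= 2^-1.
  have h := sqr_ge0 (r - 1); rewrite sqrrB in h.
  rewrite -(ler_pM2r (_ : 0 < 1 + r ^+ 2)); last by rewrite ltr_pwDl ?sqr_ge0.
  by rewrite mulrAC e1; lra.
have dW (s : R) : is_derive s 1 W ((dV s + c * rho * V s) * expR (c * rho * s)).
  have := dy s; have := dy' s => h1 h2.
  apply: is_derive_eq; rewrite /GRing.scale /= /dV /V; ring.
have e1' : e <= 1 by rewrite -e1 ler_peMr ?lerDl ?sqr_ge0// ltW.
have Vb s : 3 / 4 * (y' s ^+ 2 + w ^+ 2 * y s ^+ 2) <= V s <= 5 / 4 * (y' s ^+ 2 + w ^+ 2 * y s ^+ 2).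
  have : `|e * rho * (y s * y' s)| <= 4^-1 * (y' s ^+ 2 + w ^+ 2 * y s ^+ 2).
    have -> : e * rho * (y s * y' s) = e * (rho * y s * y' s) by ring.
    rewrite normrM (ger0_norm (ltW e0)).
    apply: (le_trans (ler_wpM2l (ltW e0) (cross s))).
    have -> : e * (r * (w * `|y s|) * `|y' s|) = e * r * ((w * `|y s|) * `|y' s|) by ring.
    have P0 : 0 <= (w * `|y s|) * `|y' s| by rewrite !mulr_ge0.
    apply: (le_trans (ler_wpM2r P0 er)).
    rewrite -(real_normK (num_real (y s))) -(real_normK (num_real (y' s))).
    have := sqr_ge0 (w * `|y s| - `|y' s|); rewrite sqrrB exprMn; lra.
  by rewrite ler_norml /V => /andP[? ?]; apply/andP; split; lra.
have WW : W t <= W 0.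
  apply: (is_derive_le0_le t0 dW) => s _.
  apply: mulr_le0_ge0; last exact: expR_ge0.
  (* After factoring out rho, what remains is bounded by a quadratic form in a = |y'| and b = w |y|.
     Its sign follows from e (b - r a)^2 >= 0, where e r^2 a^2 = a^2 - e a^2; the surplus pays for
     the term c V. *)
  have -> : dV s + c * rho * V s = rho * (- 2 * y' s ^+ 2 + e * y' s ^+ 2
      - e * (rho * y s * y' s) - e * (w ^+ 2 * y s ^+ 2)
      + c * (y' s ^+ 2 + w ^+ 2 * y s ^+ 2) + c * e * (rho * y s * y' s)).
    by rewrite /dV /V; ring.
  apply: mulr_ge0_le0 => //.
  have cr := cross s; set X := rho * y s * y' s in cr *.
  have A2 := real_normK (num_real (y' s)); have B2 := real_normK (num_real (y s)).
  set a := `|y' s| in cr A2; set b := w * `|y s| in cr.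
  have Bb : w ^+ 2 * y s ^+ 2 = b ^+ 2 by rewrite /b exprMn B2.
  rewrite Bb -A2 c0.
  have h1 : 0 <= e * (b - r * a) ^+ 2 by rewrite mulr_ge0 ?sqr_ge0// ltW.
  have h2 : e * r ^+ 2 * a ^+ 2 = a ^+ 2 - e * a ^+ 2.
    by rewrite -[X in _ = X - _]mul1r -{1}e1; ring.
  have h3 : e * (1 - e / 4) * (- X) <= e * (r * b * a).
    apply: (@le_trans _ _ (e * (1 - e / 4) * (r * b * a))).
      apply: ler_wpM2l; first by rewrite mulr_ge0; lra.
      by move: cr; rewrite ler_norml; lra.
    have P0 : 0 <= r * b * a by rewrite /a /b !mulr_ge0// ltW.
    apply: ler_wpM2r => //; nra.
  have a0 := sqr_ge0 a; have b0 := sqr_ge0 b.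
  have h4 : e * a ^+ 2 <= a ^+ 2 by rewrite ler_piMl.
  have h5 : 0 <= e * b ^+ 2 by rewrite mulr_ge0// ltW.
  have E1 : e * (b - r * a) ^+ 2 = e * b ^+ 2 - 2 * (e * (r * b * a)) + e * r ^+ 2 * a ^+ 2.
    by ring.
  rewrite E1 h2 in h1; clearbody a b X; lra.
have V0 : V t * expR (c * rho * t) <= V 0.
  by move: WW; rewrite /W mulr0 expR0 mulr1.
have /andP[Vt _] := Vb t; have /andP[_ Vz] := Vb 0.
set Et := y' t ^+ 2 + _ in Vt *; set E0 := y' 0 ^+ 2 + _ in Vz *.
have E00 : 0 <= E0 by rewrite addr_ge0 ?sqr_ge0// mulr_ge0 ?sqr_ge0.
rewrite !mulNr expRN -/c ler_pdivlMr ?expR_gt0//.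
(* The comparison constants 3/4 and 5/4 give the ratio 5/3, rounded up to 2. *)
apply: (@le_trans _ _ (4 / 3 * V t * expR (c * rho * t))).
  by rewrite ler_wpM2r ?expR_ge0//; lra.
by rewrite -mulrA; lra.
Qed.

Lemma energy_rate_bounds (R : realType) (r : R) : 0 < energy_rate r <= 1.
Proof.
have h := sqr_ge0 r.
rewrite /energy_rate invr_gt0 pmulrn_lgt0// ltr_pwDl//= invf_le1.
  by rewrite -mulr_natr; nra.
by rewrite pmulrn_lgt0// ltr_pwDl.
Qed.

(** The energy controls w |y|, which says nothing about |y| as w tends to 0. Instead z = exp(m s) y,
    with m half the energy rate times rho, starts at 0 and has derivative exp(m s) (y' + m y),
    bounded by 2 (1 + r): the energy decays like exp(-2 m s), and m |y| <= rho |y| <= r w |y|. Hence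
    |z| grows at most linearly. *)
Lemma damped_linear_le (R : realType) (r rho w : R) (y y' : R -> R) (t : R) :
  0 < r -> 0 <= rho -> 0 <= w -> rho <= r * w -> 0 <= t ->
  (forall s : R, is_derive s 1 y (y' s)) ->
  (forall s : R, is_derive s 1 y' (- (rho * y' s + w ^+ 2 * y s))) ->
  y 0 = 0 -> y' 0 ^+ 2 <= 1 ->
  `|y t| <= 2 * (1 + r) * t * expR (- (energy_rate r / 2) * rho * t).
Proof.
move=> r0 rho0 w0 rw t0 dy dy' y00 y'0.
have /andP[c0 c1] := energy_rate_bounds r.
pose m := energy_rate r / 2 * rho.
have m0 : 0 <= m by rewrite mulr_ge0// ltW// divr_gt0.
pose z s := expR (m * s) * y s.
have dz (s : R) : is_derive s 1 z (expR (m * s) * (y' s + m * y s)).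
  have h := dy s; apply: is_derive_eq; rewrite /GRing.scale /=; ring.
have zb s : 0 <= s -> `|expR (m * s) * (y' s + m * y s)| <= 2 * (1 + r).
  move=> s0.
  have := damped_energy_le r0 rho0 w0 rw s0 dy dy'.
  rewrite y00 expr0n/= mulr0 addr0 => H.
  have {}H : y' s ^+ 2 + w ^+ 2 * y s ^+ 2 <= 2 * expR (- m * s) ^+ 2.
    apply: (le_trans H); have -> : expR (- m * s) ^+ 2 = expR (- energy_rate r * rho * s).
      by rewrite -expRM_natl; congr expR; rewrite /m; field.
    by rewrite ler_wpM2r ?expR_ge0//; lra.
  set E := expR (m * s); have E0 : 0 < E by exact: expR_gt0.
  have EE : E * expR (- m * s) = 1 by rewrite -expRD mulNr subrr expR0.
  have H1 : (E * y' s) ^+ 2 + (E * (w * y s)) ^+ 2 <= 2.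
    have : E ^+ 2 * (y' s ^+ 2 + w ^+ 2 * y s ^+ 2) <= E ^+ 2 * (2 * expR (- m * s) ^+ 2).
      by rewrite ler_wpM2l// sqr_ge0.
    have -> : E ^+ 2 * (2 * expR (- m * s) ^+ 2) = 2 * (E * expR (- m * s)) ^+ 2 by ring.
    by rewrite EE expr1n mulr1; apply: le_trans; rewrite le_eqVlt; apply/orP; left; apply/eqP; ring.
  have sq2 (x : R) : x ^+ 2 <= 2 -> `|x| <= 2.
    move=> hx; rewrite -(@ler_pXn2r _ 2) ?nnegrE// real_normK ?num_real//; lra.
  have a1 : `|E * y' s| <= 2 by apply: sq2; have := sqr_ge0 (E * (w * y s)); lra.
  have a2 : `|E * (w * y s)| <= 2 by apply: sq2; have := sqr_ge0 (E * y' s); lra.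
  have a3 : `|E * (m * y s)| <= r * `|E * (w * y s)|.
    rewrite (normrM E (m * _)) (normrM m) (normrM E (w * _)) (normrM w).
    rewrite (ger0_norm (ltW E0)) (ger0_norm m0) (ger0_norm w0).
    have -> : r * (E * (w * `|y s|)) = E * ((r * w) * `|y s|) by ring.
    rewrite ler_wpM2l ?(ltW E0)// ler_wpM2r//.
    by apply: le_trans rw; rewrite /m ler_piMl//; lra.
  rewrite mulrDr; apply: (le_trans (ler_normD _ _)).
  have := ler_wpM2l (ltW r0) a2; lra.
have K0 : 0 <= 2 * (1 + r) by lra.
have up : z t - 2 * (1 + r) * t <= z 0 - 2 * (1 + r) * 0.
  apply: (@is_derive_le0_le _ (fun s => z s - 2 * (1 + r) * s)
    (fun s => expR (m * s) * (y' s + m * y s) - 2 * (1 + r)) t t0).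
    by move=> s; have h := dz s; apply: is_derive_eq; rewrite /GRing.scale /=; ring.
  by move=> s s0; have := zb s s0; rewrite ler_norml => /andP[]; lra.
have dn : - z t - 2 * (1 + r) * t <= - z 0 - 2 * (1 + r) * 0.
  apply: (@is_derive_le0_le _ (fun s => - z s - 2 * (1 + r) * s)
    (fun s => - (expR (m * s) * (y' s + m * y s)) - 2 * (1 + r)) t t0).
    by move=> s; have h := dz s; apply: is_derive_eq; rewrite /GRing.scale /=; ring.
  by move=> s s0; have := zb s s0; rewrite ler_norml => /andP[]; lra.
have zt : `|z t| <= 2 * (1 + r) * t.
  have z0 : z 0 = 0 by rewrite /z y00 mulr0.
  by rewrite z0 in up dn; rewrite ler_norml; apply/andP; split; lra.
move: zt; rewrite /z normrM (ger0_norm (expR_ge0 _)) => zt.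
rewrite (_ : - (energy_rate r / 2) * rho * t = - (m * t)); last by rewrite /m; ring.
by rewrite expRN ler_pdivlMr ?expR_gt0// mulrC.
Qed.

(** * Time derivatives of the Green function *)

(** From order two on the derivatives are generated by the differential equation, so that bounds
    propagate by recursion and the explicit exponentials, with their degenerate case [lambda0 = 0],
    enter no estimate. *)
Fixpoint Gder (R : realType) n (e : 'I_n) (xi : 'rV[R]_n) (l : nat) (t : R) : R[i] :=
  match l with
  | 0 => Ghat e xi t
  | l'.+1 => match l' with
    | 0 => Ghat_d e xi t
    | l''.+1 => (- sqnorm xi)%:C * Gder e xi l' t - (xi 0 e ^+ 2)%:C * Gder e xi l'' t
    end
  end.

(** The multiplier of the first datum and its time derivatives: by the differential equation the
    first derivative of G_t + |xi|^2 G is -xi_1^2 G, which explains the case l >= 1. *)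
Definition Hder (R : realType) n (e : 'I_n) (xi : 'rV[R]_n) (l : nat) (t : R) : R[i] :=
  if l is l'.+1 then (- xi 0 e ^+ 2)%:C * Gder e xi l' t
  else Ghat_d e xi t + (sqnorm xi)%:C * Ghat e xi t.

Lemma Ghat_ddE (R : realType) n (e : 'I_n) (xi : 'rV[R]_n) (t : R) :
  Ghat_dd e xi t = (- sqnorm xi)%:C * Ghat_d e xi t - (xi 0 e ^+ 2)%:C * Ghat e xi t.
Proof.
have [_ _ /(_ t)] := Ghat_ode e xi.
have -> : ctime_derive (Ghat e xi) = Ghat_d e xi.
  by apply/funext => s; exact: ctdE (Ghat_d1 _ _ _).
rewrite (ctdE (Ghat_d2 _ _ _)) => /eqP; rewrite -addrA addr_eq0 => /eqP ->.
by rewrite opprD rmorphN mulNr.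
Qed.

Lemma is_ctd_Gder (R : realType) n (e : 'I_n) (xi : 'rV[R]_n) l (t : R) :
  is_ctime_derive (Gder e xi l) t (Gder e xi l.+1 t).
Proof.
suff : is_ctime_derive (Gder e xi l) t (Gder e xi l.+1 t) /\
  is_ctime_derive (Gder e xi l.+1) t (Gder e xi l.+2 t) by case.
elim: l => [|l [IH1 IH2]].
  split; first exact: Ghat_d1.
  have := Ghat_d2 e xi t; rewrite Ghat_ddE; exact.
split => //.
exact: (is_ctdB (is_ctdZ _ IH2) (is_ctdZ _ IH1)).
Qed.

Lemma is_ctd_Hder (R : realType) n (e : 'I_n) (xi : 'rV[R]_n) l (t : R) :
  is_ctime_derive (Hder e xi l) t (Hder e xi l.+1 t).
Proof.
case: l => [|l]; last exact: is_ctdZ (is_ctd_Gder e xi l t).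
have h1 := is_ctd_Gder e xi 1 t; have h0 := is_ctd_Gder e xi 0 t.
have := is_ctdB h1 (is_ctdZ (- (sqnorm xi)%:C) h0).
rewrite /= (_ : _ - _ - _ = (- xi 0 e ^+ 2)%:C * Ghat e xi t); last first.
  rewrite !rmorphN; ring.
congr is_ctime_derive; apply/funext => s; by rewrite mulNr opprK.
Qed.

(** Half of [energy_rate], because the energy bounds squares. *)
Definition decay_rate (R : realType) (r : R) : R := energy_rate r / 2.

Section symbol_bounds.
Variables (R : realType) (n : nat) (e : 'I_n) (r : R).
Hypothesis r0 : 0 < r.
Implicit Types xi : 'rV[R]_n.

(** The equation has real coefficients, so the real and imaginary parts of the Green function each
    solve it and the scalar energy estimates apply; [f] stands for either part. *)
Lemma Gder_component (f : R[i] -> R) xi :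
  (forall g t d, is_ctime_derive g t d -> is_derive t 1 (fun s => f (g s)) (f d)) ->
  (forall (a b : R) z w, f (a%:C * z - b%:C * w) = a * f z - b * f w) ->
  (forall s : R, is_derive s 1 (fun s => f (Gder e xi 0 s)) (f (Gder e xi 1 s))) /\
  (forall s : R, is_derive s 1 (fun s => f (Gder e xi 1 s))
     (- (sqnorm xi * f (Gder e xi 1 s) + `|xi 0 e| ^+ 2 * f (Gder e xi 0 s)))).
Proof.
move=> fd flin; split=> s; first exact: fd (is_ctd_Gder e xi 0 s).
have := fd _ _ _ (is_ctd_Gder e xi 1 s); rewrite [Gder e xi 2 s]/= flin.
by rewrite real_normK ?num_real// opprD mulNr.
Qed.

Lemma Gder0_0 xi : Gder e xi 0 0 = 0.
Proof. by have [] := Ghat_ode e xi. Qed.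

Lemma Gder1_0 xi : Gder e xi 1 0 = 1.
Proof. by have [_ <- _] := Ghat_ode e xi; rewrite (ctdE (Ghat_d1 _ _ _)). Qed.

(** The real and imaginary parts start with energies 1 and 0. The third bound adds the linear
    estimates of the two parts, whence the 4 in place of 2. *)
Lemma Gder_low_bounds xi t : sqnorm xi <= r * `|xi 0 e| -> 0 <= t ->
  [/\ Normc.normc (Gder e xi 1 t) <= 2 * expR (- decay_rate r * sqnorm xi * t),
   `|xi 0 e| * Normc.normc (Gder e xi 0 t) <= 2 * expR (- decay_rate r * sqnorm xi * t) &
   Normc.normc (Gder e xi 0 t) <=
     4 * (1 + r) * t * expR (- decay_rate r * sqnorm xi * t)].
Proof.
move=> xiD t0; have rho0 := sqnorm_ge0 xi; have w0 := normr_ge0 (xi 0 e).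
have [|re1 re2] := @Gder_component (@complex.Re R) xi (fun g s d h => h.1).
  by move=> a b [z1 z2] [w1 w2] /=; rewrite !mul0r !subr0.
have [|im1 im2] := @Gder_component (@complex.Im R) xi (fun g s d h => h.2).
  by move=> a b [z1 z2] [w1 w2] /=; rewrite !mul0r !addr0.
have ere := damped_energy_le r0 rho0 w0 xiD t0 re1 re2.
have eim := damped_energy_le r0 rho0 w0 xiD t0 im1 im2.
have lre := damped_linear_le r0 rho0 w0 xiD t0 re1 re2.
have lim := damped_linear_le r0 rho0 w0 xiD t0 im1 im2.
have a0 : complex.Re (Gder e xi 0 0) = 0 by rewrite Gder0_0.
have b0 : complex.Im (Gder e xi 0 0) = 0 by rewrite Gder0_0.
have a1 : complex.Re (Gder e xi 1 0) = 1 by rewrite Gder1_0.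
have b1 : complex.Im (Gder e xi 1 0) = 0 by rewrite Gder1_0.
move: ere eim lre lim; rewrite a0 b0 a1 b1 !expr0n/= expr1n !mulr0 !addr0 mulr1 mulr0 mul0r.
set E := expR (- decay_rate r * _ * t).
have -> : expR (- energy_rate r * sqnorm xi * t) = E ^+ 2.
  by rewrite -expRM_natl; congr expR; rewrite /decay_rate; field.
move=> ere eim lre lim.
have E0 : 0 <= E by exact: expR_ge0.
have sq4 (x y : R) : 0 <= x -> 0 <= y -> y ^+ 2 <= 2 * x ^+ 2 -> y <= 2 * x.
  move=> x0 y0 h; rewrite -(@ler_pXn2r _ 2) ?nnegrE ?mulr_ge0// exprMn.
  by have := sqr_ge0 x; lra.
have g0 := sqnormc_ge0 (Ghat e xi t); have g1 := sqnormc_ge0 (Ghat_d e xi t).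
have w2 := mulr_ge0 (sqr_ge0 `|xi 0 e|) g0.
have S : sqnormc (Ghat_d e xi t) + `|xi 0 e| ^+ 2 * sqnormc (Ghat e xi t) <= 2 * E ^+ 2.
  by rewrite /sqnormc; lra.
split.
- by apply: sq4; rewrite ?normc_ge0// sqr_normc_sqnormc; lra.
- apply: sq4; rewrite ?mulr_ge0 ?normc_ge0// exprMn sqr_normc_sqnormc; lra.
- apply: (le_trans (normc_le_ReIm _)).
  have := lre erefl (lexx _); have := lim erefl ler01; lra.
Qed.

(** Each use of the equation gains a factor |xi_1|: in |xi|^2 G^(k+1) because |xi|^2 <= r |xi_1|,
    and in xi_1^2 G^(k) by spending one of the two factors on the previous order. The recursion has
    two terms, so two consecutive orders are carried. *)
Lemma Gder_bound l : exists2 C : R, 0 <= C & forall xi t,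
  sqnorm xi <= r * `|xi 0 e| -> 0 <= t ->
  Normc.normc (Gder e xi l.+1 t) <=
    C * `|xi 0 e| ^+ l * expR (- decay_rate r * sqnorm xi * t).
Proof.
suff H : (exists2 C : R, 0 <= C & forall xi t,
      sqnorm xi <= r * `|xi 0 e| -> 0 <= t ->
      Normc.normc (Gder e xi l.+1 t) <=
        C * `|xi 0 e| ^+ l * expR (- decay_rate r * sqnorm xi * t)) /\
    (exists2 C : R, 0 <= C & forall xi t,
      sqnorm xi <= r * `|xi 0 e| -> 0 <= t ->
      Normc.normc (Gder e xi l.+2 t) <=
        C * `|xi 0 e| ^+ l.+1 * expR (- decay_rate r * sqnorm xi * t)).
  by case: H.
have rec xi t k (A B E : R) : sqnorm xi <= r * `|xi 0 e| ->
    Normc.normc (Gder e xi k.+1 t) <= A * E ->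
    `|xi 0 e| * Normc.normc (Gder e xi k t) <= B * E ->
    Normc.normc (Gder e xi k.+2 t) <= (r * A + B) * `|xi 0 e| * E.
  move=> xiD hA hB; rewrite [Gder e xi k.+2 t]/=.
  apply: (le_trans (normcD_le _ _)); rewrite normc_opp !Normc.normcM !normc_real.
  rewrite normrN (ger0_norm (sqnorm_ge0 _)) normrX.
  have h1 : sqnorm xi * Normc.normc (Gder e xi k.+1 t) <= (r * `|xi 0 e|) * (A * E).
    by apply: ler_pM => //; [exact: sqnorm_ge0|exact: normc_ge0].
  have h2 : `|xi 0 e| * (`|xi 0 e| * Normc.normc (Gder e xi k t)) <= `|xi 0 e| * (B * E).
    by apply: ler_wpM2l.
  by rewrite mulrA -expr2 in h2; move: h1 h2; rewrite [Gder e xi k.+1 t]/=; lra.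
elim: l => [|l [[C1 C10 h1] [C2 C20 h2]]].
  split.
    exists 2 => // xi t xiD t0; rewrite expr0 mulr1.
    by case: (Gder_low_bounds xiD t0).
  exists (r * 2 + 2) => [|xi t xiD t0]; first by rewrite addr_ge0// mulr_ge0// ltW.
  have [b1 b2 _] := Gder_low_bounds xiD t0; rewrite expr1; exact: rec.
split; first by exists C2.
exists (r * C2 + C1) => [|xi t xiD t0].
  by rewrite addr_ge0// mulr_ge0// ltW.
have b2 := h2 xi t xiD t0; have b1 := h1 xi t xiD t0.
have := @rec xi t l.+1 (C2 * `|xi 0 e| ^+ l.+1) (C1 * `|xi 0 e| ^+ l.+1)
  (expR (- decay_rate r * sqnorm xi * t)) xiD b2.
have -> : (r * (C2 * `|xi 0 e| ^+ l.+1) + C1 * `|xi 0 e| ^+ l.+1) * `|xi 0 e| =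
  (r * C2 + C1) * `|xi 0 e| ^+ l.+2 by rewrite !exprSr; ring.
apply; apply: (le_trans (ler_wpM2l (normr_ge0 (xi 0 e)) b1)).
by rewrite exprS; lra.
Qed.

(** For l >= 2 the factor xi_1^2 raises the |xi_1|^(l - 2) of [Gder] of order l - 1 to |xi_1|^l; for
    l = 1 it meets the bound on |xi_1| |G|; for l = 0 the term |xi|^2 |G| is at most r |xi_1|
    |G|. *)
Lemma Hder_bound l : exists2 C : R, 0 <= C & forall xi t,
  sqnorm xi <= r * `|xi 0 e| -> 0 <= t ->
  Normc.normc (Hder e xi l t) <=
    C * `|xi 0 e| ^+ l * expR (- decay_rate r * sqnorm xi * t).
Proof.
have sc xi t k : Normc.normc (Hder e xi k.+1 t) = `|xi 0 e| ^+ 2 * Normc.normc (Gder e xi k t).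
  by rewrite [Hder e xi k.+1 t]/= Normc.normcM normc_real normrN normrX.
case: l => [|[|l]].
- exists (2 + r * 2) => [|xi t xiD t0]; first by rewrite addr_ge0// mulr_ge0// ltW.
  have [b1 b2 _] := Gder_low_bounds xiD t0; rewrite expr0 mulr1 /=.
  apply: (le_trans (normcD_le _ _)); rewrite Normc.normcM normc_real.
  rewrite (ger0_norm (sqnorm_ge0 _)) mulrDl; apply: lerD => //.
  apply: (le_trans (ler_wpM2r (normc_ge0 _) xiD)).
  by have := ler_wpM2l (ltW r0) b2; rewrite [Gder e xi 0 t]/= !mulrA.
- exists 2 => // xi t xiD t0; rewrite sc.
  have [_ b2 _] := Gder_low_bounds xiD t0.
  have := ler_wpM2l (normr_ge0 (xi 0 e)) b2; rewrite mulrA -expr2 expr1; lra.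
- have [C C0 h] := Gder_bound l; exists C => // xi t xiD t0; rewrite sc.
  have := ler_wpM2l (sqr_ge0 `|xi 0 e|) (h xi t xiD t0).
  by rewrite !exprSr expr0; lra.
Qed.
End symbol_bounds.

(** * Measurability of the symbols *)

Lemma measurable_disc (R : realType) n (e : 'I_n) :
  measurable_fun setT (fun xi : 'rV[R]_n => disc e xi).
Proof.
apply: measurable_funB; first by apply: measurable_funX; exact: measurable_sqnorm.
by apply: measurable_funM => //; apply: measurable_funX; exact: measurable_coord.
Qed.

Lemma cmeasurable_lambda0 (R : realType) n (e : 'I_n) :
  cmeasurable (fun xi : 'rV[R]_n => lambda0 e xi).
Proof.
have md := @measurable_disc R n e.
have mr : measurable_fun setT (fun xi : 'rV[R]_n => Num.sqrt (disc e xi ^+ 2 + 0 ^+ 2)).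
  apply: (measurableT_comp (@measurable_sqrtT R)).
  by apply: measurable_funD => //; exact: measurable_funX.
(* [sqrtc] unfolded at a real number; the factor 1 is the sign it assigns to a zero imaginary
   part. *)
rewrite (_ : (fun xi => _) = (fun xi =>
    Num.sqrt ((Num.sqrt (disc e xi ^+ 2 + 0 ^+ 2) + disc e xi) / 2%:R) +i*
    (1 * Num.sqrt ((Num.sqrt (disc e xi ^+ 2 + 0 ^+ 2) - disc e xi) / 2%:R)))); last first.
  by apply/funext => xi; rewrite /lambda0 /sqrtc /= eqxx.
apply: cmeasurable_pair.
  apply: (measurableT_comp (@measurable_sqrtT R)).
  by apply: measurable_funM => //; exact: measurable_funD.
apply: measurable_funM => //; apply: (measurableT_comp (@measurable_sqrtT R)).
by apply: measurable_funM => //; exact: measurable_funB.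
Qed.

Lemma lambda0_eq0 (R : realType) n (e : 'I_n) (xi : 'rV[R]_n) :
  (lambda0 e xi == 0) = (disc e xi == 0).
Proof. by rewrite /lambda0 sqrtc_eq0 eq_complex /= eqxx andbT. Qed.

Lemma cmeasurable_if d (T : measurableType d) (R : realType) (b : T -> bool)
    (f g : T -> R[i]) : measurable_fun setT b -> cmeasurable f -> cmeasurable g ->
  cmeasurable (fun x => if b x then f x else g x).
Proof.
move=> mb [f1 f2] [g1 g2]; split.
  rewrite (_ : (fun x => _) = (fun x => if b x then complex.Re (f x) else complex.Re (g x))).
    exact: measurable_fun_ifT.
  by apply/funext => x; case: (b x).
rewrite (_ : (fun x => _) = (fun x => if b x then complex.Im (f x) else complex.Im (g x))).
  exact: measurable_fun_ifT.
by apply/funext => x; case: (b x).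
Qed.

Lemma cmeasurable_lambda (R : realType) n (e : 'I_n) :
  cmeasurable (fun xi : 'rV[R]_n => lambda_plus e xi) /\
  cmeasurable (fun xi : 'rV[R]_n => lambda_minus e xi).
Proof.
have m0 := @cmeasurable_lambda0 R n e.
have ms : cmeasurable (fun xi : 'rV[R]_n => - (sqnorm xi)%:C).
  by apply: cmeasurableN; apply: cmeasurable_real; exact: measurable_sqnorm.
split; apply: cmeasurableM; try exact: cmeasurable_cst.
  exact: cmeasurableD.
exact: cmeasurableB.
Qed.

Lemma measurable_disc_eq0 (R : realType) n (e : 'I_n) :
  measurable_fun setT (fun xi : 'rV[R]_n => lambda0 e xi == 0).
Proof.
under eq_fun do rewrite lambda0_eq0.
by apply: measurable_fun_eqr => //; exact: measurable_disc.
Qed.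

Lemma cmeasurable_Gder (R : realType) n (e : 'I_n) l (t : R) :
  cmeasurable (fun xi : 'rV[R]_n => Gder e xi l t).
Proof.
have m0 := @cmeasurable_lambda0 R n e.
have [mp mm] := @cmeasurable_lambda R n e.
have mb := @measurable_disc_eq0 R n e.
have ms := @measurable_sqnorm R n.
have mct (f : 'rV[R]_n -> R[i]) : cmeasurable f -> cmeasurable (fun xi => expc (f xi * t%:C)).
  by move=> mf; apply: cmeasurable_expc; apply: cmeasurableM.
have mE : measurable_fun setT (fun xi : 'rV[R]_n => expR (- sqnorm xi * t / 2)).
  apply: measurableT_comp => //; apply: measurable_funM => //.
  by apply: measurable_funM => //; exact: measurableT_comp.
suff : cmeasurable (fun xi : 'rV[R]_n => Gder e xi l t) /\
   cmeasurable (fun xi : 'rV[R]_n => Gder e xi l.+1 t) by case.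
elim: l => [|l [IH1 IH2]].
  split; apply: cmeasurable_if => //.
  - by apply: cmeasurable_real; exact: measurable_funM.
  - apply: cmeasurableM; last exact: cmeasurableV.
    by apply: cmeasurableB; exact: mct.
  - apply: cmeasurable_real; apply: measurable_funM => //.
    by apply: measurable_funB => //; apply: measurable_funM => //; exact: measurable_funM.
  - apply: cmeasurableM; first exact: cmeasurableV.
    by apply: cmeasurableB; apply: cmeasurableM => //; exact: mct.
split => //; apply: cmeasurableB; apply: cmeasurableM => //; apply: cmeasurable_real.
  exact: measurableT_comp.
by apply: measurable_funX; exact: measurable_coord.
Qed.

Lemma cmeasurable_Hder (R : realType) n (e : 'I_n) l (t : R) :
  cmeasurable (fun xi : 'rV[R]_n => Hder e xi l t).
Proof.
case: l => [|l].
  apply: cmeasurableD; first exact: (@cmeasurable_Gder R n e 1 t).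
  apply: cmeasurableM; last exact: (@cmeasurable_Gder R n e 0 t).
  by apply: cmeasurable_real; exact: measurable_sqnorm.
apply: cmeasurableM; last exact: (@cmeasurable_Gder R n e l t).
apply: cmeasurable_real; apply: measurableT_comp => //.
by apply: measurable_funX; exact: measurable_coord.
Qed.

(** * Derivatives of the solution *)

Lemma is_ctime_derive_cintegral (R : realType) n (a u v : R)
    (M M' : R -> 'rV[R]_n -> R[i]) (g : 'rV[R]_n -> R) :
  u < a -> a < v ->
  (forall s, u < s -> s < v -> cintegrable (M s)) ->
  (forall s x, u < s -> s < v -> is_ctime_derive (M ^~ x) s (M' s x)) ->
  (leb R n).-integrable setT (fun x => (g x)%:E) ->
  (forall s x, u < s -> s < v -> Normc.normc (M' s x) <= g x) ->
  is_ctime_derive (fun s => cintegral (M s)) a (cintegral (M' a)).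
Proof.
move=> ua av iM dM ig M'g.
have Ia : (`]u, v[%classic : set R) a by rewrite /= in_itv/= ua av.
have g0 y : 0 <= g y by exact: le_trans (normc_ge0 _) (M'g a y ua av).
suff H (f : R[i] -> R) :
    (forall s, u < s -> s < v -> (leb R n).-integrable setT (fun x => (f (M s x))%:E)) ->
    (forall s x, u < s -> s < v -> is_derive s 1 (fun s => f (M s x)) (f (M' s x))) ->
    (forall z, `|f z| <= Normc.normc z) ->
    is_derive a 1 (fun s => \int[leb R n]_x f (M s x)) (\int[leb R n]_x f (M' a x)).
  split; apply: H.
  - by move=> s us sv; case: (iM s us sv).
  - by move=> s x us sv; case: (dM s x us sv).
  - exact: normr_Re.
  - by move=> s us sv; case: (iM s us sv).
  - by move=> s x us sv; case: (dM s x us sv).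
  - exact: normr_Im.
move=> iF dF fle.
have i1 x : (`]u, v[%classic : set R) x -> (leb R n).-integrable setT (EFin \o (fun y => f (M x y))).
  by rewrite /= in_itv/= => /andP[us sv]; exact: iF.
have d1 x y : (`]u, v[%classic : set R) x -> [set: 'rV[R]_n] y ->
    derivable (fun s => f (M s y)) x 1.
  by rewrite /= in_itv/= => /andP[us sv] _; case: (dF x y us sv).
have pE x y : (`]u, v[%classic : set R) x -> partial1of2 (fun s y => f (M s y)) x y = f (M' x y).
  rewrite /= in_itv/= => /andP[us sv]; rewrite partial1of2E.
  have h := dF x y us sv; exact: derive_val.
have b1 x y : (`]u, v[%classic : set R) x -> [set: 'rV[R]_n] y ->
    `|partial1of2 (fun s y => f (M s y)) x y| <= g y.
  move=> Ix _; rewrite pE//; apply: (le_trans (fle _)).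
  by move: Ix; rewrite /= in_itv/= => /andP[us sv]; exact: M'g.
have dd := derivable_under_integral measurableT Ia i1 d1 g0 ig b1.
have := differentiation_under_integral measurableT Ia i1 d1 g0 ig b1.
move=> E; apply: DeriveDef => //; rewrite -derive1E E.
by apply: eq_Rintegral => y _; exact: pE.
Qed.

(** Seen as a derivative in one real variable along a line, a partial derivative falls under the
    same theorem on differentiation under the integral as the time derivative. *)
Lemma cpartial_line (R : realType) n (j : 'I_n) (f : 'rV[R]_n -> R[i]) x :
  cpartial j f x = ctime_derive (fun h => f (x + h *: delta_mx 0 j)) 0.
Proof.
have E (g : 'rV[R]_n -> R) : 'D_(delta_mx 0 j) g x =
    derive1 (fun h => g (x + h *: delta_mx 0 j)) 0.
  rewrite /derive /derive1.
  rewrite (_ : (fun h : R => _) = (fun h : R => h^-1 *: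
     (g (x + (h + 0) *: delta_mx 0 j) - g (x + 0 *: delta_mx 0 j))))//.
  by apply/funext => h /=; rewrite scale0r !addr0 [X in g X]addrC.
by rewrite /cpartial /ctime_derive !E.
Qed.

Lemma expcD (R : realType) (z w : R[i]) : expc (z + w) = expc z * expc w.
Proof.
case: z w => a b [c d]; rewrite /expc /= expRD cosD sinD.
apply/eqP; rewrite eq_complex /=; apply/andP; split; apply/eqP; ring.
Qed.

Lemma normc_expc_imag (R : realType) (y : R) : Normc.normc (expc (0 +i* y)) = 1.
Proof. by rewrite expc_imag /= cos2Dsin2 sqrtr1. Qed.

Lemma dotvDZ (R : realType) n (x y : 'rV[R]_n) (h : R) j :
  dotv (x + h *: delta_mx 0 j) y = dotv x y + h * y 0 j.
Proof.
rewrite /dotv (eq_bigr (fun i => x 0 i * y 0 i + (if i == j then h * y 0 j else 0))).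
  by rewrite big_split/= -big_mkcond big_pred1_eq.
move=> i _; rewrite !mxE /= mulrDl; congr (_ + _).
by case: eqVneq => [->|ij]; rewrite ?mulr1// mulr0 mul0r.
Qed.

Lemma cmeasurable_char_mul (R : realType) n (m : 'rV[R]_n -> R[i]) x :
  cmeasurable m -> cmeasurable (fun xi => expc (0 +i* dotv x xi) * m xi).
Proof.
move=> mm; apply: cmeasurableM => //; apply: cmeasurable_expc.
by apply: cmeasurable_pair => //; exact: measurable_dotv.
Qed.

Lemma cintegrable_char_mul (R : realType) n (m : 'rV[R]_n -> R[i]) x :
  cintegrable m -> cintegrable (fun xi => expc (0 +i* dotv x xi) * m xi).
Proof.
move=> cm; have mm := cintegrable_cmeasurable cm.
apply: (cintegrable_le (cmeasurable_char_mul x mm) (integrable_normc cm)).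
by move=> xi; rewrite Normc.normcM normc_expc_imag mul1r.
Qed.

(** The character has modulus 1 along the whole line, so |xi_j m(xi)| dominates the derivative of
    the integrand. *)
Lemma cpartial_inv_fourier (R : realType) n (j : 'I_n) (m : 'rV[R]_n -> R[i]) :
  cintegrable m -> cintegrable (fun xi => (0 +i* xi 0 j) * m xi) ->
  cpartial j (inv_fourier m) = inv_fourier (fun xi => (0 +i* xi 0 j) * m xi).
Proof.
move=> cm cjm; apply/funext => x; rewrite cpartial_line.
apply: ctdE; apply: is_ctdZ.
pose M h xi := expc (0 +i* dotv (x + h *: delta_mx 0 j) xi) * m xi.
pose M' h xi := expc (0 +i* dotv (x + h *: delta_mx 0 j) xi) * ((0 +i* xi 0 j) * m xi).
have := @is_ctime_derive_cintegral R n 0 (-1) 1 M M'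
  (fun xi => Normc.normc ((0 +i* xi 0 j) * m xi)).
rewrite (_ : M' 0 = fun xi => expc (0 +i* dotv x xi) * ((0 +i* xi 0 j) * m xi)); last first.
  by apply/funext => xi; rewrite /M' scale0r addr0.
apply.
- by rewrite ltrN10.
- exact: ltr01.
- by move=> s _ _; exact: cintegrable_char_mul.
- move=> s xi _ _; rewrite /M /M'.
  have E h : expc (0 +i* dotv (x + h *: delta_mx 0 j) xi) * m xi =
      m xi * expc (0 +i* dotv x xi) * expc ((0 +i* xi 0 j) * h%:C).
    rewrite mulrC -mulrA -expcD; congr (_ * expc _); rewrite dotvDZ.
    by apply/eqP; rewrite eq_complex /=; apply/andP; split; apply/eqP; ring.
  rewrite (_ : (fun h => _) = fun h => m xi * expc (0 +i* dotv x xi) * expc ((0 +i* xi 0 j) * h%:C)); last first.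
    by apply/funext => h; exact: E.
  have := is_ctdZ (m xi * expc (0 +i* dotv x xi)) (is_ctd_expc (0 +i* xi 0 j) s).
  by congr is_ctime_derive; rewrite mulrCA -E mulrCA.
- exact: integrable_normc.
- by move=> s xi _ _; rewrite Normc.normcM normc_expc_imag mul1r.
Qed.

(** * Symbols vanishing off [Dset] *)

(** The complement of the support is an arbitrary union of open sets on each of which v vanishes
    almost everywhere. Cubes with rational centre and half-side 1 / (k + 1), enumerated by
    [unpickle], make it a countable union, for which null sets add up. *)
Lemma ess_support_ae (R : realType) n (v : 'rV[R]_n -> R[i]) :
  {ae leb R n, forall x, ~ ess_support v x -> v x = 0}.
Proof.
have aux1 (a d : R) : 0 < d -> a - d < a + d by move=> ?; lra.
have aux2 (a q d : R) : a - d < q -> q < a + d -> `|q - a| < d.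
  by move=> h1 h2; rewrite ltr_norml; apply/andP; split; lra.
have aux3 (q a b d e : R) : `|q - a| < d -> `|q - b| < d -> d < e / 2 -> `|a - b| < e.
  rewrite !ltr_norml => /andP[h1 h2] /andP[h3 h4] h5.
  by apply/andP; split; lra.
pose F := [set U : set 'rV[R]_n | open U /\ {ae leb R n, forall x, U x -> v x = 0}].
pose B (c : 'rV[rat]_n * nat) : set 'rV[R]_n :=
  [set x | forall j, `|ratr (c.1 0 j) - x 0 j| < c.2.+1%:R^-1].
have HB (i : nat) : {ae leb R n, forall x, forall c, unpickle i = Some c ->
    (exists2 U, F U & B c `<=` U) -> B c x -> v x = 0}.
  case: (unpickle i) => [c|]; last by apply: aeW.
  have [[U [_ vU] BU]|nU] := pselect (exists2 U, F U & B c `<=` U); last first.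
    by apply: aeW => x c' [<-] /nU.
  by apply: filterS vU => x vx c' [<-] _ /BU.
have := ae_foralln HB; apply: filterS => x hx nx.
have [U [oU vU] Ux] : (\bigcup_(U in F) U) x by apply: contrapT.
have : nbhs x U by exact: open_nbhs_nbhs.
move=> /nbhs_ballP[e /= e0 xeU].
(* Points of a cube containing x lie within 2 / (k + 1) of x, so such a cube stays in the ball of
   radius e. *)
have [k ke] : exists k : nat, k.+1%:R^-1 < e / 2.
  have h : 0 < e / 2 by rewrite divr_gt0.
  exists (Num.bound (e / 2)^-1); rewrite invf_plt ?posrE ?ltr0n//.
  apply: (lt_trans (archi_boundP _)); first by rewrite invr_ge0 ltW.
  by rewrite ltr_nat.
have /choice[q qx] : forall j : 'I_n, exists q : rat, `|ratr q - x 0 j| < k.+1%:R^-1.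
  move=> j; have k0 : 0 < k.+1%:R^-1 :> R by rewrite invr_gt0 ltr0n.
  have xx : x 0 j - k.+1%:R^-1 < x 0 j + k.+1%:R^-1 by exact: aux1.
  have [q] := rat_in_itvoo xx; rewrite in_itv/= => /andP[h1 h2]; exists q.
  exact: aux2.
pose c : 'rV[rat]_n * nat := (\row_j q j, k).
apply: (hx (pickle c) c); first exact: pickleK.
- exists U => // y By; apply: xeU; split => // i j; rewrite (ord1 i).
  have h1 := By j; rewrite /= mxE in h1.
  exact: (aux3 _ _ _ _ _ (qx j) h1 ke).
- by move=> j; rewrite /= mxE.
Qed.

Lemma coord_sqr_le_sqnorm (R : realType) n (xi : 'rV[R]_n) j :
  xi 0 j ^+ 2 <= sqnorm xi.
Proof.
rewrite /sqnorm /dotv (bigD1 j)//= -expr2 lerDl sumr_ge0// => i _.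
by rewrite -expr2 sqr_ge0.
Qed.

Lemma normr_coord_le (R : realType) n (xi : 'rV[R]_n) j :
  `|xi 0 j| <= Num.sqrt (sqnorm xi).
Proof. by rewrite -sqrtr_sqr ler_wsqrtr// coord_sqr_le_sqnorm. Qed.

(** [Dset e r] consists of two closed balls of radius r / 2 tangent at the origin: xi_1^2 <= |xi|^2
    <= r |xi_1| forces |xi_1| <= r. *)
Lemma Dset_bounded (R : realType) n (e : 'I_n) (r : R) (xi : 'rV[R]_n) :
  0 < r -> Dset e r xi -> `|xi 0 e| <= r /\ sqnorm xi <= r ^+ 2.
Proof.
rewrite /Dset /= => r0 xiD; have h := coord_sqr_le_sqnorm xi e.
have w0 := normr_ge0 (xi 0 e).
have wr : `|xi 0 e| <= r.
  have : `|xi 0 e| ^+ 2 <= r * `|xi 0 e| by rewrite real_normK ?num_real// (le_trans h).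
  rewrite expr2; have [->|w1] := eqVneq `|xi 0 e| 0; first by move=> _; exact: ltW.
  by rewrite ler_pM2r// lt_neqAle eq_sym w1.
by split=> //; rewrite (le_trans xiD)// expr2 ler_wpM2l// ltW.
Qed.

(** The transform vanishes off [Dset] only almost everywhere; this representative does so
    everywhere, which pointwise bounds on symbols require. *)
Definition cut (R : realType) n (e : 'I_n) (r : R) (v : 'rV[R]_n -> R[i]) xi : R[i] :=
  if sqnorm xi <= r * `|xi 0 e| then v xi else 0.

Lemma cmeasurable_cut (R : realType) n (e : 'I_n) (r : R) (v : 'rV[R]_n -> R[i]) :
  cmeasurable v -> cmeasurable (cut e r v).
Proof.
move=> mv; apply: cmeasurable_if => //.
apply: measurable_fun_ler; first exact: measurable_sqnorm.
apply: measurable_funM => //; apply: measurableT_comp => //.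
exact: measurable_coord.
Qed.

Lemma cut_ae (R : realType) n (e : 'I_n) (r : R) (v : 'rV[R]_n -> R[i]) :
  ess_support v `<=` Dset e r -> {ae leb R n, forall xi, cut e r v xi = v xi}.
Proof.
move=> vD; have := ess_support_ae v; apply: filterS => xi h.
rewrite /cut; case: ifPn => // nD; rewrite h// => /vD.
by rewrite /Dset /=; apply/negP.
Qed.

Lemma sqnormc_cut_le (R : realType) n (e : 'I_n) (r : R) (v : 'rV[R]_n -> R[i]) xi :
  sqnormc (cut e r v xi) <= sqnormc (v xi).
Proof.
by rewrite /cut; case: ifP => // _; rewrite /sqnormc/= expr0n/= addr0 -/(sqnormc _) sqnormc_ge0.
Qed.

(** On [Dset] the Gaussian is at least exp(-r^2), and |v| <= 1 + |v|^2, so a finite weighted square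
    integral yields integrability. *)
Lemma cintegrable_cut (R : realType) n (e : 'I_n) (r : R) (v : 'rV[R]_n -> R[i]) :
  0 < r -> cmeasurable v ->
  (\int[leb R n]_xi (gauss_weight 1 xi * sqnormc (v xi))%:E < +oo)%E ->
  cintegrable (cut e r v).
Proof.
move=> r0 mv vfin; have mc := cmeasurable_cut e r mv.
apply: (@cintegrable_le _ _ _ (fun xi => expR (r ^+ 2) *
    (gauss_weight 1 xi + gauss_weight 1 xi * sqnormc (v xi)))) => //.
  have iv : (leb R n).-integrable setT (fun xi => (gauss_weight 1 xi * sqnormc (v xi))%:E).
    apply/integrableP; split.
      apply/measurable_EFinP; apply: measurable_funM; first exact: measurable_gauss_weight.
      exact: measurable_sqnormc.
    under eq_integral do rewrite abse_EFin ger0_norm ?mulr_ge0 ?gauss_weight_ge0 ?sqnormc_ge0//.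
    exact: vfin.
  have := integrableZl measurableT (expR (r ^+ 2))
    (integrableD measurableT (integrable_gauss_weight n ltr01) iv).
  by congr (integrable _ _ _).
move=> xi; have -> : expR (r ^+ 2) * (gauss_weight 1 xi + gauss_weight 1 xi * sqnormc (v xi)) =
  expR (r ^+ 2) * gauss_weight 1 xi * (1 + sqnormc (v xi)) by ring.
rewrite /cut; case: ifPn => [xiD|_]; last first.
  rewrite normc_real normr0; apply: mulr_ge0; last by rewrite addr_ge0 ?sqnormc_ge0.
  by apply: mulr_ge0; [exact: expR_ge0|exact: gauss_weight_ge0].
have [_ h] := Dset_bounded r0 xiD.
have y0 := normc_ge0 (v xi).
have h1 : 1 <= expR (r ^+ 2) * gauss_weight 1 xi.
  by rewrite /gauss_weight -expRD -[leLHS]expR0 ler_expR mulN1r subr_ge0.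
have h2 : Normc.normc (v xi) <= 1 + sqnormc (v xi).
  by rewrite -sqr_normc_sqnormc; have := sqr_ge0 (Normc.normc (v xi) - 1); rewrite sqrrB; lra.
apply: (le_trans h2); rewrite ler_peMl// addr_ge0 ?sqnormc_ge0//.
Qed.

Lemma inv_fourier_ae (R : realType) n (m m' : 'rV[R]_n -> R[i]) :
  cmeasurable m -> cmeasurable m' -> {ae leb R n, forall xi, m xi = m' xi} ->
  inv_fourier m = inv_fourier m'.
Proof.
move=> mm mm' E; apply/funext => x; rewrite /inv_fourier; congr (_ * _).
have [h1 h2] := cmeasurable_char_mul x mm.
have [h1' h2'] := cmeasurable_char_mul x mm'.
rewrite /cintegral; congr (_ +i* _); congr fine; apply: ae_eq_integral => //.
all: try exact/measurable_EFinP.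
all: by apply: filterS E => xi -> _.
Qed.

(* The symbols of the partial derivatives of the solution: supported in
   [Dset e r], so that polynomial factors preserve integrability. *)
Definition symbol_on (R : realType) n (e : 'I_n) (r : R) (m : 'rV[R]_n -> R[i]) :=
  cintegrable m /\ forall xi, ~ Dset e r xi -> m xi = 0.

Lemma symbol_on_mul (R : realType) n (e : 'I_n) (r C : R) (m f : 'rV[R]_n -> R[i]) :
  symbol_on e r m -> cmeasurable f ->
  (forall xi, Dset e r xi -> Normc.normc (f xi) <= C) ->
  symbol_on e r (fun xi => f xi * m xi).
Proof.
move=> [cm m0] mf fC; split; last by move=> xi nD; rewrite m0// mulr0.
have mm := cintegrable_cmeasurable cm.
apply: (@cintegrable_le _ _ _ (fun xi => C * Normc.normc (m xi))).
- exact: cmeasurableM.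
- exact: (integrableZl measurableT C (integrable_normc cm)).
- move=> xi; rewrite Normc.normcM.
  have [xiD|nD] := pselect (Dset e r xi); last by rewrite m0// Normc.normc0 !mulr0.
  by rewrite ler_wpM2r ?normc_ge0// fC.
Qed.

Lemma normc_imag (R : realType) (y : R) : Normc.normc (0 +i* y) = `|y|.
Proof. by rewrite /= expr0n/= add0r sqrtr_sqr. Qed.

Lemma cmeasurable_icoord (R : realType) n (j : 'I_n) :
  cmeasurable (fun xi : 'rV[R]_n => 0 +i* xi 0 j).
Proof. by apply: cmeasurable_pair => //; exact: measurable_coord. Qed.

Lemma symbol_on_icoord (R : realType) n (e : 'I_n) (r : R) j (m : 'rV[R]_n -> R[i]) :
  0 < r -> symbol_on e r m -> symbol_on e r (fun xi => (0 +i* xi 0 j) * m xi).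
Proof.
move=> r0 sm; apply: (symbol_on_mul (C := r) sm).
  exact: cmeasurable_icoord.
move=> xi xiD; rewrite normc_imag (le_trans (normr_coord_le _ _))//.
have [_ h] := Dset_bounded r0 xiD.
by rewrite -(ger0_norm (ltW r0)) -sqrtr_sqr ler_wsqrtr.
Qed.

Lemma iter_cpartial_inv_fourier (R : realType) n (e : 'I_n) (r : R) j k
    (m : 'rV[R]_n -> R[i]) : 0 < r -> symbol_on e r m ->
  symbol_on e r (fun xi => (0 +i* xi 0 j) ^+ k * m xi) /\
  iter k (cpartial j) (inv_fourier m) =
    inv_fourier (fun xi => (0 +i* xi 0 j) ^+ k * m xi).
Proof.
move=> r0 sm; elim: k => [|k [IH1 IH2]].
  by split => /=; under eq_fun do rewrite expr0 mul1r.
have S := symbol_on_icoord j r0 IH1.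
have E : (fun xi : 'rV[R]_n => (0 +i* xi 0 j) * ((0 +i* xi 0 j) ^+ k * m xi)) =
    (fun xi : 'rV[R]_n => (0 +i* xi 0 j) ^+ k.+1 * m xi).
  by apply/funext => xi; rewrite mulrA -exprS.
rewrite -E; split => //=; rewrite IH2; apply: cpartial_inv_fourier.
  by case: IH1.
by case: S.
Qed.

Definition monomial (R : realType) n (a : 'I_n -> nat) (xi : 'rV[R]_n) : R[i] :=
  \prod_(j <- enum 'I_n) (0 +i* xi 0 j) ^+ a j.

Lemma multi_partial_inv_fourier (R : realType) n (e : 'I_n) (r : R) a
    (m : 'rV[R]_n -> R[i]) : 0 < r -> symbol_on e r m ->
  symbol_on e r (fun xi => monomial a xi * m xi) /\
  multi_partial a (inv_fourier m) = inv_fourier (fun xi => monomial a xi * m xi).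
Proof.
move=> r0 sm; rewrite /multi_partial /monomial; elim: (enum _) => [|j s [IH1 IH2]].
  by split => /=; under eq_fun do rewrite big_nil mul1r.
have [S1 S2] := iter_cpartial_inv_fourier j (a j) r0 IH1.
have E : (fun xi : 'rV[R]_n => \prod_(j <- j :: s) (0 +i* xi 0 j) ^+ a j * m xi) =
  (fun xi : 'rV[R]_n => (0 +i* xi 0 j) ^+ a j * (\prod_(j <- s) (0 +i* xi 0 j) ^+ a j * m xi)).
  by apply/funext => xi; rewrite big_cons mulrA.
by rewrite E /= IH2.
Qed.

Lemma normc_monomial (R : realType) n (a : 'I_n -> nat) (xi : 'rV[R]_n) :
  Normc.normc (monomial a xi) <= Num.sqrt (sqnorm xi) ^+ multi_size a.
Proof.
rewrite /monomial big_enum /multi_size; elim/big_ind2 : _ => //.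
- by rewrite expr0 Normc.normc1.
- move=> n1 z1 n2 z2 h1 h2; rewrite Normc.normcM exprD.
  by apply: ler_pM => //; exact: normc_ge0.
- move=> j _; elim: (a j) => [|k IH]; first by rewrite !expr0 Normc.normc1.
  rewrite !exprS Normc.normcM; apply: ler_pM => //; rewrite ?normc_ge0//.
  by rewrite normc_imag normr_coord_le.
Qed.

(** * Time derivatives of the inverse transform *)

Lemma is_ctdD (R : realType) (f g : R -> R[i]) t d d' :
  is_ctime_derive f t d -> is_ctime_derive g t d' ->
  is_ctime_derive (fun s => f s + g s) t (d + d').
Proof.
move=> hf hg; have := is_ctdB hf (is_ctdZ (-1) hg).
by rewrite mulN1r opprK; congr is_ctime_derive; apply/funext => s; rewrite mulN1r opprK.
Qed.

Lemma ctime_derive_eq_near (R : realType) (f g : R -> R[i]) (t : R) :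
  (\near t, f t = g t) -> ctime_derive f t = ctime_derive g t.
Proof.
move=> fg; rewrite /ctime_derive !derive1E; congr (_ +i* _).
  by apply: near_eq_derive; apply: filterS fg => s ->.
by apply: near_eq_derive; apply: filterS fg => s ->.
Qed.

Section time_derivatives.
Variables (R : realType) (n : nat) (r : R) (e : 'I_n).
Hypothesis (r0 : 0 < r).
Implicit Types (xi : 'rV[R]_n) (v : 'rV[R]_n -> R[i]).

Lemma decay_rate_gt0 : 0 < decay_rate r.
Proof. by rewrite divr_gt0//; case/andP: (energy_rate_bounds r). Qed.

Lemma expR_decay_le1 xi t : 0 <= t -> expR (- decay_rate r * sqnorm xi * t) <= 1.
Proof.
move=> t0; rewrite -expR0 ler_expR !mulNr oppr_le0.
by apply: mulr_ge0 => //; apply: mulr_ge0; [exact: ltW decay_rate_gt0|exact: sqnorm_ge0].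
Qed.

(** The restriction to times at most T is due to l = 0: the Green function itself is bounded by a
    multiple of t near the origin of frequencies. *)
Lemma Gder_bounded l T : 0 <= T -> exists2 C : R, 0 <= C & forall xi t,
  Dset e r xi -> 0 <= t -> t <= T -> Normc.normc (Gder e xi l t) <= C.
Proof.
move=> T0; case: l => [|l].
  exists (4 * (1 + r) * T) => [|xi t xiD t0 tT].
    by apply: mulr_ge0 => //; apply: mulr_ge0 => //; rewrite addr_ge0// ltW.
  have [_ _ h] := Gder_low_bounds r0 xiD t0; apply: (le_trans h).
  have c0 : 0 <= 4 * (1 + r) by apply: mulr_ge0 => //; rewrite addr_ge0// ltW.
  apply: (@le_trans _ _ (4 * (1 + r) * t)); last exact: ler_wpM2l.
  by apply: ler_piMr; [exact: mulr_ge0|exact: expR_decay_le1].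
have [C C0 h] := Gder_bound e r0 l.
exists (C * r ^+ l) => [|xi t xiD t0 tT]; first by rewrite mulr_ge0// exprn_ge0// ltW.
apply: (le_trans (h xi t xiD t0)).
have [w _] := Dset_bounded r0 xiD.
apply: (@le_trans _ _ (C * `|xi 0 e| ^+ l)).
  by apply: ler_piMr; [rewrite mulr_ge0// exprn_ge0|exact: expR_decay_le1].
by apply: ler_wpM2l => //; apply: lerXn2r => //; rewrite nnegrE// ltW.
Qed.

Lemma Hder_bounded l : exists2 C : R, 0 <= C & forall xi t,
  Dset e r xi -> 0 <= t -> Normc.normc (Hder e xi l t) <= C.
Proof.
have [C C0 h] := Hder_bound e r0 l.
exists (C * r ^+ l) => [|xi t xiD t0]; first by rewrite mulr_ge0// exprn_ge0// ltW.
apply: (le_trans (h xi t xiD t0)).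
have [w _] := Dset_bounded r0 xiD.
apply: (@le_trans _ _ (C * `|xi 0 e| ^+ l)).
  by apply: ler_piMr; [rewrite mulr_ge0// exprn_ge0|exact: expR_decay_le1].
by apply: ler_wpM2l => //; apply: lerXn2r => //; rewrite nnegrE// ltW.
Qed.

Definition uhat_der v0 v1 l t xi : R[i] :=
  Hder e xi l t * v0 xi + Gder e xi l t * v1 xi.

Lemma is_ctd_uhat_der v0 v1 l t xi :
  is_ctime_derive (fun s => uhat_der v0 v1 l s xi) t (uhat_der v0 v1 l.+1 t xi).
Proof.
have h0 := is_ctdZ (v0 xi) (is_ctd_Hder e xi l t).
have h1 := is_ctdZ (v1 xi) (is_ctd_Gder e xi l t).
have := is_ctdD h0 h1; rewrite /uhat_der ![_ * v0 xi]mulrC ![_ * v1 xi]mulrC.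
by congr is_ctime_derive; apply/funext => s; rewrite ![_ * v0 xi]mulrC ![_ * v1 xi]mulrC.
Qed.

Lemma symbol_onD (m m' : 'rV[R]_n -> R[i]) : symbol_on e r m -> symbol_on e r m' ->
  symbol_on e r (fun xi => m xi + m' xi).
Proof.
move=> [cm m0] [cm' m0']; split; last by move=> xi nD; rewrite m0// m0'// addr0.
have mm := cintegrable_cmeasurable cm; have mm' := cintegrable_cmeasurable cm'.
apply: (cintegrable_le (cmeasurableD mm mm')
  (integrableD measurableT (integrable_normc cm) (integrable_normc cm'))).
by move=> xi; exact: normcD_le.
Qed.

Lemma uhat_der_le v0 v1 l T : symbol_on e r v0 -> symbol_on e r v1 -> 0 <= T ->
  exists2 C : R, 0 <= C & forall xi t, 0 <= t -> t <= T ->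
  Normc.normc (uhat_der v0 v1 l t xi) <=
    C * (Normc.normc (v0 xi) + Normc.normc (v1 xi)).
Proof.
move=> [_ s0] [_ s1] T0; have [C1 C10 h1] := Gder_bounded l T0.
have [C2 C20 h2] := Hder_bounded l.
exists (C1 + C2) => [|xi t t0 tT]; first exact: addr_ge0.
have [xiD|nD] := pselect (Dset e r xi); last first.
  rewrite /uhat_der s0// s1// !mulr0 addr0 normc_real normr0.
  by apply: mulr_ge0; rewrite addr_ge0.
apply: (le_trans (normcD_le _ _)); rewrite !Normc.normcM.
have a0 := normc_ge0 (v0 xi); have a1 := normc_ge0 (v1 xi).
have b1 := ler_wpM2r a1 (h1 xi t xiD t0 tT).
have b2 := ler_wpM2r a0 (h2 xi t xiD t0).
have c1 := mulr_ge0 C10 a0; have c2 := mulr_ge0 C20 a1.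
by apply: (le_trans (lerD b2 b1)); lra.
Qed.

Lemma symbol_on_uhat_der v0 v1 l t : symbol_on e r v0 -> symbol_on e r v1 ->
  0 <= t -> symbol_on e r (uhat_der v0 v1 l t).
Proof.
move=> s0 s1 t0; apply: symbol_onD.
  have [C C0 h] := Hder_bounded l.
  by apply: (symbol_on_mul (C := C) s0) => [|xi xiD]; [exact: cmeasurable_Hder|exact: h].
have [C C0 h] := Gder_bounded l t0.
by apply: (symbol_on_mul (C := C) s1) => [|xi xiD]; [exact: cmeasurable_Gder|exact: h].
Qed.

Lemma ctime_derive_inv_fourier v0 v1 l t x :
  symbol_on e r v0 -> symbol_on e r v1 -> 0 < t ->
  ctime_derive (fun s => inv_fourier (uhat_der v0 v1 l s) x) t =
    inv_fourier (uhat_der v0 v1 l.+1 t) x.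
Proof.
move=> s0 s1 t0; apply: ctdE; apply: is_ctdZ.
have T0 : 0 <= t * 2 by rewrite mulr_ge0// ltW.
have [C C0 h] := uhat_der_le l.+1 s0 s1 T0.
have tt : t < t * 2 by lra.
apply: (@is_ctime_derive_cintegral _ _ t 0 (t * 2)
  (fun s xi => expc (0 +i* dotv x xi) * uhat_der v0 v1 l s xi)
  (fun s xi => expc (0 +i* dotv x xi) * uhat_der v0 v1 l.+1 s xi)
  (fun xi => C * (Normc.normc (v0 xi) + Normc.normc (v1 xi)))) => //.
- move=> s ps _; apply: cintegrable_char_mul.
  by case: (symbol_on_uhat_der l s0 s1 (ltW ps)).
- by move=> s xi _ _; apply: is_ctdZ; exact: is_ctd_uhat_der.
- have := integrableZl measurableT C (integrableD measurableT
    (integrable_normc s0.1) (integrable_normc s1.1)).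
  by congr (integrable _ _ _).
- move=> s xi ps st; rewrite Normc.normcM normc_expc_imag mul1r.
  by apply: h; exact: ltW.
Qed.

Lemma iter_ctime_derive v0 v1 l (t : R) x (u : 'rV[R]_n -> R -> R[i]) :
  symbol_on e r v0 -> symbol_on e r v1 ->
  (forall s : R, 0 < s -> u x s = inv_fourier (uhat_der v0 v1 0 s) x) -> 0 < t ->
  iter l (@ctime_derive R) (u x) t = inv_fourier (uhat_der v0 v1 l t) x.
Proof.
move=> s0 s1 hu; elim: l t => [|l IH] t t0 /=; first exact: hu.
rewrite -(@ctime_derive_inv_fourier _ _ _ _ _ s0 s1 t0).
(* The formula for the iterate holds at positive times only, so the two functions agree near t
   rather than everywhere. *)
apply: ctime_derive_eq_near.
by near=> s; apply: IH; near: s; exact: lt_nbhsr.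
Unshelve. all: by end_near. Qed.

(** Replacing the data by their cuts changes [uhat] on a null set, which the inverse transform does
    not see; after that, every derivative acts on an integrable symbol supported in [Dset]. *)
Lemma mixed_derivative_solution a l v0 v1 (t : R) : cmeasurable v0 -> cmeasurable v1 ->
  ess_support v0 `<=` Dset e r -> ess_support v1 `<=` Dset e r ->
  symbol_on e r (cut e r v0) -> symbol_on e r (cut e r v1) -> 0 < t ->
  mixed_derivative a l (solution e v0 v1) t =
    inv_fourier (fun xi => monomial a xi * uhat_der (cut e r v0) (cut e r v1) l t xi).
Proof.
move=> m0 m1 d0 d1 s0 s1 t0.
have S := symbol_on_uhat_der l s0 s1 (ltW t0).
rewrite -(multi_partial_inv_fourier a r0 S).2 /mixed_derivative; congr multi_partial.
apply/funext => x; apply: iter_ctime_derive => // s ps; rewrite /solution.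
apply: (congr1 (fun f => f x)); apply: inv_fourier_ae.
- have -> : uhat e v0 v1 s = uhat_der v0 v1 0 s.
    by apply/funext => xi; rewrite /uhat (ctdE (Ghat_d1 _ _ _)).
  apply: cmeasurableD; apply: cmeasurableM => //; first exact: cmeasurable_Hder.
  exact: cmeasurable_Gder.
- exact: cintegrable_cmeasurable (symbol_on_uhat_der 0 s0 s1 (ltW ps)).1.
have h0 := cut_ae d0; have h1 := cut_ae d1.
apply: filterS2 h0 h1 => xi E0 E1.
by rewrite /uhat_der E0 E1 /uhat (ctdE (Ghat_d1 _ _ _)).
Qed.

End time_derivatives.

(** * Time decay *)

(** z^m / m! is one term of the exponential series. *)
Lemma exprn_mul_expRN_le (R : realType) (z : R) m :
  0 <= z -> z ^+ m * expR (- z) <= m`!%:R.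
Proof.
move=> z0; rewrite expRN ler_pdivrMr ?expR_gt0//.
case: m => [|m]; first by rewrite expr0 mul1r -expR0 ler_expR.
rewrite mulrC -ler_pdivrMr ?ltr0n ?fact_gt0//.
by apply: le_trans (expR_ge1Dxn m z0); rewrite lerDr.
Qed.

(** Half of the Gaussian absorbs the power. With y = s t^(1/2), y^m <= 1 + (y^2)^m, and (y^2)^m
    exp(-kappa y^2 / 2) <= (2 / kappa)^m m!; passing to y^2 keeps the exponents integral. *)
Lemma gauss_power_le (R : realType) (kappa : R) m : 0 < kappa ->
  exists2 C : R, 0 <= C & forall s t : R, 0 <= s -> 0 < t ->
  s ^+ m * expR (- kappa * s ^+ 2 * t) <=
    C * t `^ (- (m%:R / 2)) * expR (- (kappa / 2 * t) * s ^+ 2).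
Proof.
move=> k0; have c0 : 0 <= (2 / kappa) ^+ m by rewrite exprn_ge0// divr_ge0// ltW.
exists (1 + (2 / kappa) ^+ m * m`!%:R) => [|s t s0 t0].
  by rewrite addr_ge0// mulr_ge0.
have -> : - kappa * s ^+ 2 * t = - (kappa / 2 * t) * s ^+ 2 + - (kappa / 2 * t) * s ^+ 2.
  by field.
rewrite expRD mulrA; apply: ler_wpM2r; first exact: expR_ge0.
have st : 0 < Num.sqrt t by rewrite sqrtr_gt0.
have -> : t `^ (- (m%:R / 2)) = (Num.sqrt t) ^- m.
  by rewrite -(powR12_sqrt (ltW t0)) -powR_invn ?powR_ge0// -powRrM; congr (_ `^ _); field.
rewrite ler_pdivlMr ?exprn_gt0// mulrAC -exprMn.
set y := s * _; have y2 : y ^+ 2 = s ^+ 2 * t by rewrite exprMn sqr_sqrtr// ltW.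
have -> : - (kappa / 2 * t) * s ^+ 2 = - (kappa / 2 * y ^+ 2) by rewrite y2; ring.
set z := kappa / 2 * _.
have z0 : 0 <= z by rewrite /z; apply: mulr_ge0; [rewrite divr_ge0// ltW|exact: sqr_ge0].
have h := ler_wpM2l c0 (exprn_mul_expRN_le m z0).
have ym : (y ^+ m) ^+ 2 = (2 / kappa) ^+ m * z ^+ m.
  rewrite -exprMn exprAC; congr (_ ^+ m); rewrite /z; field; exact: lt0r_neq0.
have e1 : expR (- z) <= 1 by rewrite -expR0 ler_expR oppr_le0.
have e0 := expR_ge0 (- z).
have yle : y ^+ m <= 1 + (2 / kappa) ^+ m * z ^+ m.
  by rewrite -ym; have := sqr_ge0 (y ^+ m - 1); have := sqr_ge0 (y ^+ m); rewrite sqrrB1; lra.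
apply: (le_trans (ler_wpM2r e0 yle)); rewrite mulrDl mul1r; apply: lerD => //.
by rewrite -mulrA.
Qed.

Lemma floor_half_nat (R : realType) l : Num.floor (l%:R / 2 : R) = l./2.
Proof.
apply/eqP; rewrite floor_eq intrD -pmulrn.
have -> : l%:R = (odd l)%:R + 2 * (l./2)%:R :> R.
  by rewrite -{1}(odd_double_half l) natrD -mul2n natrM.
have o0 : 0 <= ((odd l)%:R : R) by exact: ler0n.
have o1 : ((odd l)%:R : R) <= 1 by rewrite (ler_nat R _ 1) leq_b1.
rewrite mulr1z; apply/andP; split; lra.
Qed.

Lemma floor_half_pred (R : realType) l : Num.floor ((l.+1%:R - 1) / 2 : R) = l./2.
Proof. by rewrite -natr1 addrK floor_half_nat. Qed.

Lemma floor_half_neg (R : realType) : Num.floor ((0 - 1) / 2 : R) = - 1.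
Proof.
apply/eqP; rewrite floor_eq; apply/andP; split; rewrite ?rmorphN ?intrD /=; lra.
Qed.

Section symbol_decay.
Variables (R : realType) (r : R) (n : nat) (e : 'I_n).
Hypothesis (r0 : 0 < r).
Implicit Types (xi : 'rV[R]_n) (t : R).

Lemma direction_power_le l xi : Dset e r xi ->
  `|xi 0 e| ^+ l <= (1 + r) * Num.sqrt (sqnorm xi) ^+ l./2.*2.
Proof.
move=> xiD; have [w _] := Dset_bounded r0 xiD.
rewrite -{1}(odd_double_half l) exprD; apply: ler_pM; rewrite ?exprn_ge0//.
  by case: (odd l); [rewrite [_ ^+ true]expr1 (le_trans w)// lerDr|rewrite [_ ^+ false]expr0 lerDl ltW].
by apply: lerXn2r; rewrite ?nnegrE ?sqrtr_ge0//; exact: normr_coord_le.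
Qed.

Lemma decay_power_le l m : exists2 C : R, 0 <= C & forall xi t,
  Dset e r xi -> 0 < t ->
  Num.sqrt (sqnorm xi) ^+ m *
    (`|xi 0 e| ^+ l * expR (- decay_rate r * sqnorm xi * t)) <=
  C * t `^ (- (m%:R / 2) - l./2%:R) * gauss_weight (decay_rate r / 2 * t) xi.
Proof.
have [C C0 h] := gauss_power_le (m + l./2.*2) (decay_rate_gt0 r).
have r1 : 0 <= 1 + r by rewrite addr_ge0// ltW.
exists ((1 + r) * C) => [|xi t xiD t0]; first exact: mulr_ge0.
have s0 := sqrtr_ge0 (sqnorm xi).
have := ler_wpM2l r1 (h _ t s0 t0); rewrite sqr_sqrtr ?sqnorm_ge0//.
have -> : - ((m + l./2.*2)%:R / 2) = - (m%:R / 2) - l./2%:R :> R.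
  by rewrite natrD -mul2n natrM; field.
rewrite -/(gauss_weight _ _) !mulrA; apply: le_trans.
set E := expR _; have E0 : 0 <= E by exact: expR_ge0.
apply: ler_wpM2r => //; rewrite exprD mulrA [(1 + r) * _]mulrC -!mulrA.
by apply: ler_wpM2l; [exact: exprn_ge0|exact: direction_power_le].
Qed.

Lemma Hder_decay l m : exists2 C : R, 0 <= C & forall xi t,
  Dset e r xi -> 0 < t ->
  Num.sqrt (sqnorm xi) ^+ m * Normc.normc (Hder e xi l t) <=
  C * t `^ (- (m%:R / 2) - (Num.floor (l%:R / 2 : R))%:~R) *
    gauss_weight (decay_rate r / 2 * t) xi.
Proof.
have [C C0 h] := Hder_bound e r0 l; have [C' C'0 h'] := decay_power_le l m.
exists (C * C') => [|xi t xiD t0]; first exact: mulr_ge0.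
have s0 := exprn_ge0 m (sqrtr_ge0 (sqnorm xi)).
apply: (le_trans (ler_wpM2l s0 (h xi t xiD (ltW t0)))).
rewrite floor_half_nat -pmulrn.
have := ler_wpM2l C0 (h' xi t xiD t0); congr (_ <= _); ring.
Qed.

Lemma Gder_decay l m : exists2 C : R, 0 <= C & forall xi t,
  Dset e r xi -> 0 < t ->
  Num.sqrt (sqnorm xi) ^+ m * Normc.normc (Gder e xi l t) <=
  C * t `^ (- (m%:R / 2) - (Num.floor ((l%:R - 1) / 2 : R))%:~R) *
    gauss_weight (decay_rate r / 2 * t) xi.
Proof.
case: l => [|l].
  have [C C0 h] := decay_power_le 0 m.
  have r1 : 0 <= 4 * (1 + r) by rewrite mulr_ge0// addr_ge0// ltW.
  exists (4 * (1 + r) * C) => [|xi t xiD t0]; first exact: mulr_ge0.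
  have [_ _ b] := Gder_low_bounds r0 xiD (ltW t0).
  have := h xi t xiD t0; rewrite expr0 mul1r subr0 => h'.
  (* Here [-1/2] = -1, so the exponent contains +1, which is the factor t in the bound on the Green
     function. *)
  rewrite floor_half_neg mulrN1z opprK powRD; last by rewrite (gt_eqF t0) implybT.
  rewrite powRr1; last exact: ltW.
  have s0 := exprn_ge0 m (sqrtr_ge0 (sqnorm xi)).
  apply: (le_trans (ler_wpM2l s0 b)).
  have c0 : 0 <= 4 * (1 + r) * t by apply: mulr_ge0 => //; exact: ltW.
  have := ler_wpM2l c0 h'; congr (_ <= _); ring.
have [C C0 h] := Gder_bound e r0 l; have [C' C'0 h'] := decay_power_le l m.
exists (C * C') => [|xi t xiD t0]; first exact: mulr_ge0.
have s0 := exprn_ge0 m (sqrtr_ge0 (sqnorm xi)).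
apply: (le_trans (ler_wpM2l s0 (h xi t xiD (ltW t0)))).
rewrite floor_half_pred -pmulrn.
have := ler_wpM2l C0 (h' xi t xiD t0); congr (_ <= _); ring.
Qed.

End symbol_decay.

(** * Assembly of the estimate *)

(** The bound is written as a square to serve as the hypothesis of [multiplier_le]. The sum of the
    two squared contributions is at most the square of their sum because the cross term is
    nonnegative; taking the root halves the exponent of k. *)
Lemma gauss_quadratic_sum_le (R : realType) n (p k A0 A1 : R) (e : 'I_n) (r : R)
    (u0 u1 v0 v1 : 'rV[R]_n -> R[i]) :
  1 <= p -> p <= 2 -> 0 < k -> 0 <= A0 -> 0 <= A1 ->
  in_Lp p%:E u0 -> in_Lp p%:E u1 -> is_fourier p%:E u0 v0 -> is_fourier p%:E u1 v1 ->
  (\int[leb R n]_xi (gauss_weight k xi *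
    (A0 * Normc.normc (cut e r v0 xi) + A1 * Normc.normc (cut e r v1 xi)) ^+ 2)%:E <=
  ((2 * Num.sqrt (gauss_const R n) * k `^ (- (n%:R / 2 * (p^-1 - 2^-1))) *
    (A0 * fine (cLnorm p%:E u0) + A1 * fine (cLnorm p%:E u1))) ^+ 2)%:E)%E.
Proof.
move=> p1 p2 k0 A00 A10 L0 L1 F0 F1.
have b0 := is_fourier_gauss_le p1 p2 k0 L0 F0.
have b1 := is_fourier_gauss_le p1 p2 k0 L1 F1.
have mv0 := in_Lp_cmeasurable F0.1; have mv1 := in_Lp_cmeasurable F1.1.
have mg : forall v : 'rV[R]_n -> R[i], cmeasurable v ->
    measurable_fun setT (fun xi => (gauss_weight k xi * sqnormc (v xi))%:E).
  move=> v mv; apply/measurable_EFinP; apply: measurable_funM.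
    exact: measurable_gauss_weight.
  exact: measurable_sqnormc.
have g0 : forall (v : 'rV[R]_n -> R[i]) xi, 0 <= gauss_weight k xi * sqnormc (v xi).
  by move=> v xi; apply: mulr_ge0; [exact: gauss_weight_ge0|exact: sqnormc_ge0].
have c0 : 0 <= 2 * A0 ^+ 2 by apply: mulr_ge0 => //; exact: sqr_ge0.
have c1 : 0 <= 2 * A1 ^+ 2 by apply: mulr_ge0 => //; exact: sqr_ge0.
pose B (A : R) (v : 'rV[R]_n -> R[i]) xi := (A%:E * (gauss_weight k xi * sqnormc (v xi))%:E)%E.
have B0 A v xi : 0 <= A -> (0 <= B A v xi)%E.
  by move=> hA; rewrite /B -EFinM lee_fin; apply: mulr_ge0.
have mB A v : cmeasurable v -> measurable_fun setT (B A v).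
  move=> mv; apply: emeasurable_funM => //; exact: mg.
have N00 := fine_ge0 (cLnorm_ge0 p%:E u0); have N10 := fine_ge0 (cLnorm_ge0 p%:E u1).
move: b0 b1; set N0 := fine _ in N00 *; set N1 := fine _ in N10 *; clearbody N0 N1.
set G := gauss_const R n; have G0 : 0 <= G by exact: gauss_const_ge0.
have -> : k `^ (- (n%:R * (p^-1 - 2^-1))) = (k `^ (- (n%:R / 2 * (p^-1 - 2^-1)))) ^+ 2.
  by rewrite -powR_mulrn ?powR_ge0// -powRrM; congr (_ `^ _); field; lra.
set K := k `^ _; have K0 : 0 <= K by exact: powR_ge0.
move=> b0 b1.
apply: (@le_trans _ _ (\int[leb R n]_xi (B (2 * A0 ^+ 2)%R v0 xi + B (2 * A1 ^+ 2)%R v1 xi)%E)%E).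
  apply: ge0_le_integral => //.
  - move=> xi _; rewrite lee_fin; apply: mulr_ge0; [exact: gauss_weight_ge0|exact: sqr_ge0].
  - apply/measurable_EFinP; apply: measurable_funM; first exact: measurable_gauss_weight.
    apply: measurable_funX; apply: measurable_funD; apply: measurable_funM => //.
      by apply: measurable_normc; exact: cmeasurable_cut.
    by apply: measurable_normc; exact: cmeasurable_cut.
  - by apply: emeasurable_funD; exact: mB.
  - move=> xi _; rewrite /B -!EFinM -EFinD lee_fin.
    have g := gauss_weight_ge0 k xi.
    have s0 := sqnormc_cut_le e r v0 xi; have s1 := sqnormc_cut_le e r v1 xi.
    rewrite -sqr_normc_sqnormc in s0; rewrite -[sqnormc (cut e r v1 xi)]sqr_normc_sqnormc in s1.
    move: s0 s1; set a := Normc.normc (cut e r v0 xi); set b := Normc.normc (cut e r v1 xi).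
    set x := sqnormc (v0 xi); set y := sqnormc (v1 xi); move=> s0 s1.
    have -> : 2 * A0 ^+ 2 * (gauss_weight k xi * x) + 2 * A1 ^+ 2 * (gauss_weight k xi * y) =
      gauss_weight k xi * (2 * A0 ^+ 2 * x + 2 * A1 ^+ 2 * y) by ring.
    apply: ler_wpM2l => //.
    have := ler_wpM2l c0 s0; have := ler_wpM2l c1 s1; have := sqr_ge0 (A0 * a - A1 * b).
    have -> : (A0 * a + A1 * b) ^+ 2 =
      2 * A0 ^+ 2 * a ^+ 2 + 2 * A1 ^+ 2 * b ^+ 2 - (A0 * a - A1 * b) ^+ 2 by ring.
    lra.
rewrite ge0_integralD//; [|by move=> xi _; exact: B0|exact: mB|by move=> xi _; exact: B0|exact: mB].
rewrite !ge0_integralZl//; [|exact: mg|by move=> xi _; rewrite lee_fin|exact: mg|by move=> xi _; rewrite lee_fin].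
have e0 := lee_wpmul2l _ b0; have e1 := lee_wpmul2l _ b1.
apply: (le_trans (leeD (e0 (2 * A0 ^+ 2)%R%:E _) (e1 (2 * A1 ^+ 2)%R%:E _))); rewrite ?lee_fin//.
have -> : (2 * Num.sqrt G * K * (A0 * N0 + A1 * N1)) ^+ 2 =
  4 * G * K ^+ 2 * (A0 * N0 + A1 * N1) ^+ 2.
  by rewrite !exprMn sqr_sqrtr//; ring.
have cr : 0 <= (A0 * N0) * (A1 * N1) by apply: mulr_ge0; exact: mulr_ge0.
have gk : 0 <= G * K ^+ 2 by apply: mulr_ge0 => //; exact: sqr_ge0.
have := mulr_ge0 gk cr.
rewrite sqrrD; set P := G * _ => hP.
have -> : 2 * A0 ^+ 2 * (2 * G * (N0 ^+ 2 * K ^+ 2)) + 2 * A1 ^+ 2 * (2 * G * (N1 ^+ 2 * K ^+ 2))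
  = 4 * P * ((A0 * N0) ^+ 2 + (A1 * N1) ^+ 2) by rewrite /P; ring.
rewrite -[4 * G * _]mulrA -/P mulr2n; lra.
Qed.

Lemma measurable_normc_cut (R : realType) n (e : 'I_n) (r : R) (v : 'rV[R]_n -> R[i]) :
  cmeasurable v -> measurable_fun setT (fun xi => Normc.normc (cut e r v xi)).
Proof. by move=> mv; apply: measurable_normc; exact: cmeasurable_cut. Qed.

Lemma symbol_on_cut (R : realType) n (e : 'I_n) (p r : R) (u v : 'rV[R]_n -> R[i]) :
  0 < r -> 1 <= p -> p <= 2 -> in_Lp p%:E u -> is_fourier p%:E u v ->
  symbol_on e r (cut e r v).
Proof.
move=> r0 p1 p2 uL F; split; last first.
  by move=> xi; rewrite /Dset /cut /=; case: ifP.
apply: cintegrable_cut => //; first exact: in_Lp_cmeasurable F.1.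
exact: le_lt_trans (is_fourier_gauss_le p1 p2 ltr01 uL F) (ltry _).
Qed.

(** The right side is a Gaussian times a combination A0 |v0| + A1 |v1|, the shape that
    [multiplier_le] and [gauss_quadratic_sum_le] share. *)
Lemma normc_symbol_le (R : realType) n (e : 'I_n) (r : R) (a : 'I_n -> nat) l : 0 < r ->
  exists2 C : R, 0 <= C & forall (v0 v1 : 'rV[R]_n -> R[i]) xi (t : R), 0 < t ->
  Normc.normc (monomial a xi * uhat_der e (cut e r v0) (cut e r v1) l t xi) <=
  gauss_weight (decay_rate r / 2 * t) xi *
    (C * t `^ (- ((multi_size a)%:R / 2) - (Num.floor (l%:R / 2 : R))%:~R) *
       Normc.normc (cut e r v0 xi) +
     C * t `^ (- ((multi_size a)%:R / 2) - (Num.floor ((l%:R - 1) / 2 : R))%:~R) *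
       Normc.normc (cut e r v1 xi)).
Proof.
move=> r0.
have [C0 C00 h0] := Hder_decay e r0 l (multi_size a).
have [C1 C10 h1] := Gder_decay e r0 l (multi_size a).
exists (C0 + C1) => [|v0 v1 xi t t0]; first exact: addr_ge0.
set T0 := t `^ _ in h0 *; set T1 := t `^ _ in h1 *.
have T00 : 0 <= T0 by exact: powR_ge0.
have T10 : 0 <= T1 by exact: powR_ge0.
set g := gauss_weight _ _; have g0 : 0 <= g by exact: gauss_weight_ge0.
set n0 := Normc.normc (cut e r v0 xi); set n1 := Normc.normc (cut e r v1 xi).
have n00 : 0 <= n0 by exact: normc_ge0.
have n10 : 0 <= n1 by exact: normc_ge0.
have [xiD|nD] := pselect (Dset e r xi); last first.
  have z v : cut e r v xi = 0 by rewrite /cut; case: ifP => // /nD.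
  rewrite /uhat_der !z !mulr0 addr0 mulr0 normc_real normr0.
  by apply: mulr_ge0 => //; apply: addr_ge0; apply: mulr_ge0 => //; apply: mulr_ge0 => //; exact: addr_ge0.
rewrite Normc.normcM.
apply: (le_trans (ler_wpM2r (normc_ge0 _) (normc_monomial a xi))).
set s := _ ^+ _; have s0 : 0 <= s by rewrite exprn_ge0// sqrtr_ge0.
have := normcD_le (Hder e xi l t * cut e r v0 xi) (Gder e xi l t * cut e r v1 xi).
rewrite !Normc.normcM -/n0 -/n1 => b.
apply: (le_trans (ler_wpM2l s0 b)).
have b0 := ler_wpM2r n00 (h0 xi t xiD t0).
have b1 := ler_wpM2r n10 (h1 xi t xiD t0).
rewrite -/s -/T0 -/g in b0; rewrite -/s -/T1 -/g in b1.
have x0 : 0 <= C1 * T0 * g * n0 by apply: mulr_ge0 => //; apply: mulr_ge0 => //; exact: mulr_ge0.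
have x1 : 0 <= C0 * T1 * g * n1 by apply: mulr_ge0 => //; apply: mulr_ge0 => //; exact: mulr_ge0.
lra.
Qed.

Lemma low_frequency_estimate (R : realType) n (e : 'I_n) (r : R) (a : 'I_n -> nat) l
    (p : R) (q : \bar R) : 0 < r -> 1 <= p -> p <= 2 -> (2%:E <= q)%E ->
  exists C : R, forall u0 u1 v0 v1 : 'rV[R]_n -> R[i],
    in_Lp p%:E u0 -> in_Lp p%:E u1 ->
    is_fourier p%:E u0 v0 -> is_fourier p%:E u1 v1 ->
    ess_support v0 `<=` Dset e r -> ess_support v1 `<=` Dset e r ->
    forall t : R, 0 < t ->
      (cLnorm q (mixed_derivative a l (solution e v0 v1) t)
       <= (C * t `^ (- ((multi_size a)%:R / 2)
                     - (Num.floor (l%:R / 2 : R))%:~R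
                     - n%:R / 2 * (p^-1 - fine (q^-1)%E)))%:E
            * cLnorm p%:E u0
        + (C * t `^ (- ((multi_size a)%:R / 2)
                     - (Num.floor ((l%:R - 1) / 2 : R))%:~R
                     - n%:R / 2 * (p^-1 - fine (q^-1)%E)))%:E
            * cLnorm p%:E u1)%E.
Proof.
move=> r0 p1 p2 q2; have [C C0 hC] := normc_symbol_le e a l r0.
(* The rate left over after half of the decay has absorbed the powers of |xi|. *)
pose c := decay_rate r / 2; have c0 : 0 < c by rewrite divr_gt0// decay_rate_gt0.
pose theta := 2^-1 - fine (q^-1)%E.
pose b := - (n%:R / 2 * (p^-1 - 2^-1)).
(* [K] gathers the constants of the data and multiplier bounds together with the powers of c split
   off from (c t)^b and (c t)^(-(n/2) theta). The exponents b and -(n/2) theta of t add up to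
   -(n/2)(1/p - 1/q). *)
pose K := inv_const R n * (2 * Num.sqrt (gauss_const R n) * c `^ b * C) *
  ((Num.sqrt pi ^+ n) `^ theta * c `^ (- (n%:R / 2) * theta)).
exists K => u0 u1 v0 v1 L0 L1 F0 F1 D0 D1 t t0.
have m0 := in_Lp_cmeasurable F0.1; have m1 := in_Lp_cmeasurable F1.1.
have S0 := symbol_on_cut e r0 p1 p2 L0 F0.
have S1 := symbol_on_cut e r0 p1 p2 L1 F1.
rewrite (mixed_derivative_solution r0)//.
set w0 := _ - _ - _; set w1 := _ - _ - _.
set al0 := - _ - (Num.floor (l%:R / 2))%:~R in hC w0 *.
set al1 := - _ - (Num.floor ((l%:R - 1) / 2))%:~R in hC w1 *.
have k0 : 0 < c * t by exact: mulr_gt0.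
set N0 := cLnorm p%:E u0; set N1 := cLnorm p%:E u1.
have E0 : N0 = (fine N0)%:E by rewrite fineK// ge0_fin_numE ?cLnorm_ge0//; case: L0.
have E1 : N1 = (fine N1)%:E by rewrite fineK// ge0_fin_numE ?cLnorm_ge0//; case: L1.
have Ct0 al : 0 <= C * t `^ al by apply: mulr_ge0 => //; exact: powR_ge0.
have Q := gauss_quadratic_sum_le e r p1 p2 k0 (Ct0 al0) (Ct0 al1) L0 L1 F0 F1.
have f0 : 0 <= fine N0 by exact: fine_ge0 (cLnorm_ge0 _ _).
have f1 : 0 <= fine N1 by exact: fine_ge0 (cLnorm_ge0 _ _).
set Y := 2 * _ * _ * _ in Q.
have Y0 : 0 <= Y.
  apply: mulr_ge0; last by apply: addr_ge0; exact: mulr_ge0.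
  apply: mulr_ge0; last exact: powR_ge0.
  by apply: mulr_ge0 => //; exact: sqrtr_ge0.
have S := symbol_on_uhat_der r0 l S0 S1 (ltW t0).
have [Sm _] := (multi_partial_inv_fourier a r0 S).1.
have mZ : measurable_fun setT (fun xi => C * t `^ al0 * Normc.normc (cut e r v0 xi) +
    C * t `^ al1 * Normc.normc (cut e r v1 xi)).
  by apply: measurable_funD; apply: measurable_funM => //; exact: measurable_normc_cut.
have Z0 xi : 0 <= C * t `^ al0 * Normc.normc (cut e r v0 xi) +
    C * t `^ al1 * Normc.normc (cut e r v1 xi).
  by apply: addr_ge0; apply: mulr_ge0 => //; exact: normc_ge0.
have [_ M] := multiplier_le q2 k0 Y0 (cintegrable_cmeasurable Sm) mZ Z0
  (fun xi => hC v0 v1 xi t t0) Q.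
apply: (le_trans M); rewrite E0 E1 -!EFinM -EFinD lee_fin.
have sn0 : 0 <= Num.sqrt (pi : R) ^+ n by rewrite exprn_ge0// sqrtr_ge0.
rewrite -/theta sqrt_div_expn// (powRM _ sn0 (powR_ge0 _ _)).
rewrite -powRrM /Y -/N0 -/N1 -/b !(powRM _ (ltW c0) (ltW t0)).
have W0 : t `^ w0 = t `^ al0 * (t `^ b * t `^ (- (n%:R / 2) * theta)).
  rewrite -!powRD ?(gt_eqF t0) ?implybT//; congr (_ `^ _).
  by rewrite /w0 /b /theta; ring.
have W1 : t `^ w1 = t `^ al1 * (t `^ b * t `^ (- (n%:R / 2) * theta)).
  rewrite -!powRD ?(gt_eqF t0) ?implybT//; congr (_ `^ _).
  by rewrite /w1 /b /theta; ring.
rewrite W0 W1 /K le_eqVlt; apply/orP; left; apply/eqP; ring.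
Qed.

Theorem theorem3p1 (R : realType) (n : nat) (hn : (3 <= n)%N) (r : R)
    (hr : 2 < r) (a : 'I_n -> nat) (l : nat) :
  (forall (p : R) (q : \bar R),
     1 <= p -> p < 2 -> ((2 * p / (2 - p))%:E <= q)%E ->
     exists C : R, forall u0 u1 v0 v1 : 'rV[R]_n -> R[i],
       in_Lp p%:E u0 -> in_Lp p%:E u1 ->
       is_fourier p%:E u0 v0 -> is_fourier p%:E u1 v1 ->
       ess_support v0 `<=` Dset (dir1 hn) r ->
       ess_support v1 `<=` Dset (dir1 hn) r ->
       forall t : R, 0 < t ->
         (cLnorm q (mixed_derivative a l (solution (dir1 hn) v0 v1) t)
          <= (C * t `^ (- ((multi_size a)%:R / 2)
                        - (Num.floor (l%:R / 2 : R))%:~R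
                        - n%:R / 2 * (p^-1 - fine (q^-1)%E)))%:E
               * cLnorm p%:E u0
           + (C * t `^ (- ((multi_size a)%:R / 2)
                        - (Num.floor ((l%:R - 1) / 2 : R))%:~R
                        - n%:R / 2 * (p^-1 - fine (q^-1)%E)))%:E
               * cLnorm p%:E u1)%E)
  /\
  (forall q : \bar R,
     (2%:E <= q)%E ->
     exists C : R, forall u0 u1 v0 v1 : 'rV[R]_n -> R[i],
       in_Lp 2%:E u0 -> in_Lp 2%:E u1 ->
       is_fourier 2%:E u0 v0 -> is_fourier 2%:E u1 v1 ->
       ess_support v0 `<=` Dset (dir1 hn) r ->
       ess_support v1 `<=` Dset (dir1 hn) r ->
       forall t : R, 0 < t ->
         (cLnorm q (mixed_derivative a l (solution (dir1 hn) v0 v1) t)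
          <= (C * t `^ (- ((multi_size a)%:R / 2)
                        - (Num.floor (l%:R / 2 : R))%:~R
                        - n%:R / 2 * (2^-1 - fine (q^-1)%E)))%:E
               * cLnorm 2%:E u0
           + (C * t `^ (- ((multi_size a)%:R / 2)
                        - (Num.floor ((l%:R - 1) / 2 : R))%:~R
                        - n%:R / 2 * (2^-1 - fine (q^-1)%E)))%:E
               * cLnorm 2%:E u1)%E).
Proof.
have r0 : 0 < r by apply: lt_trans hr.
split=> [p q p1 p2 pq|q q2]; last first.
  by apply: low_frequency_estimate => //; rewrite ler1n.
apply: low_frequency_estimate => //; first exact: ltW.
(* 2 <= 2 p / (2 - p) because p >= 1, so q lies in the range of the common estimate. *)
apply: le_trans pq; rewrite lee_fin ler_pdivlMr ?subr_gt0//; lra.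
Qed.
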